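(* There exists an absolute constant $c>0$ such that for every $f\in L\log L(\mathbb{T}^2)$ and every $\lambda>0$, $$\left|\left\{(x,y)\in\mathbb{T}^2:\ \mathrm{BMO}\left[S_{nn}(x,y,f)\right]>\lambda\right\}\right|\le \frac{c}{\lambda}\left(1+\iint_{\mathbb{T}^2}|f|\log^+|f|\right).$$
   Context: $\mathbb{T}=[-\pi,\pi)=\mathbb{R}/2\pi\mathbb{Z}$; functions on $\mathbb{T}^2$ are identified with functions on $\mathbb{R}^2$ that are $2\pi$-periodic in each variable. Integrals are with respect to Lebesgue measure, and $|E|$ is the Lebesgue measure of $E$. $\log^+u=\log u$ if $u>1$ and $\log^+u=0$ otherwise. $L\log L(\mathbb{T}^2)$ is the class of measurable functions $f$ on $\mathbb{T}^2$ with $\iint_{\mathbb{T}^2}|f|\log^+|f|<\infty$ (such $f$ are integrable). Fourier coefficients: $\widehat f(m,k)=\frac{1}{4\pi^2}\iint_{\mathbb{T}^2}f(x,y)e^{-i(mx+ky)}\,dx\,dy$. Quadratic partial sums, for $n=0,1,2,\dots$: $S_{nn}(x,y,f)=\sum_{m=-n}^{n}\sum_{k=-n}^{n}\widehat f(m,k)e^{i(mx+ky)}$. BMO norm: for $g\in L_1[0,1]$, $\|g\|_{\mathrm{BMO}}=\sup_{I}\frac{1}{|I|}\int_I|g(t)-g_I|\,dt+\left|\int_0^1g(t)\,dt\right|$, where $g_I=\frac1{|I|}\int_Ig(t)\,dt$ and the supremum is over all intervals $I\subset[0,1]$. For a sequence of numbers $\{\xi_n\}_{n=0}^\infty$, $$\mathrm{BMO}[\xi_n]=\sup_{0\le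 n<\infty}\left\|\sum_{k=0}^n\xi_k\,\mathbb{I}_{\delta_k^n}(t)\right\|_{\mathrm{BMO}},\qquad \delta_k^n=\left[\tfrac{k}{n+1},\tfrac{k+1}{n+1}\right],$$ where $\mathbb{I}_{\delta}$ is the characteristic function of $\delta$ on $[0,1]$. In the claim, for fixed $(x,y)$, $\mathrm{BMO}[S_{nn}(x,y,f)]$ is this quantity for the sequence $\xi_n=S_{nn}(x,y,f)$, $n=0,1,2,\dots$ (it may be $+\infty$). *)

(* Defs.v *)
From HB Require Import structures.
From mathcomp Require Import all_boot all_order all_algebra.
From mathcomp Require Import complex.
From mathcomp Require Import all_classical all_reals all_analysis.
From mathcomp Require Import measurable_realfun.

Set Implicit Arguments.
Unset Strict Implicit.
Unset Printing Implicit Defensive.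

Import Order.TTheory GRing.Theory Num.Theory.
Import numFieldNormedType.Exports.

Local Open Scope classical_set_scope.
Local Open Scope complex_scope.
Local Open Scope ring_scope.

(** [ComplexField.Normc.normc] is the modulus with values in [R], whereas
    [`|z|] lives in [R[i]]. *)
Definition modc {R : realType} (z : R[i]) : R := ComplexField.Normc.normc z.

Definition expi {R : realType} (t : R) : R[i] := cos t +i* sin t.

Definition cintegral {d : measure_display} {T : measurableType d}
    {R : realType} (mu : {measure set T -> \bar R}) (D : set T)
    (g : T -> R[i]) : R[i] :=
  (\int[mu]_(x in D) complex.Re (g x)) +i* (\int[mu]_(x in D) complex.Im (g x)).

Section BMO.
Context {R : realType}.
Local Notation mu := (@lebesgue_measure R).

Definition len (I : interval R) : R := fine (mu [set` I]).

Definition mean (g : R -> R[i]) (I : interval R) : R[i] :=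
  ((len I)^-1)%:C * cintegral mu [set` I] g.

Definition oscillation (g : R -> R[i]) (I : interval R) : \bar R :=
  (((len I)^-1)%:E * \int[mu]_(t in [set` I]) (modc (g t - mean g I))%:E)%E.

(** The intervals of the supremum may be open, closed or half-open; degenerate
    ones, for which the mean is undefined, are excluded. *)
Definition BMO_norm (g : R -> R[i]) : \bar R :=
  (ereal_sup [set oscillation g I | I in
     [set I : interval R | [set` I] `<=` `[0%R, 1%R] /\ (0 < len I)%R]]
   + (modc (cintegral mu `[0%R, 1%R] g))%:E)%E.

Definition delta (n k : nat) : set R :=
  `[k%:R / n.+1%:R, k.+1%:R / n.+1%:R].

Definition step_fun (xi : nat -> R[i]) (n : nat) (t : R) : R[i] :=
  \sum_(k < n.+1) xi k * (\1_(delta n k) t)%:C.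

Definition BMO_seq (xi : nat -> R[i]) : \bar R :=
  ereal_sup [set BMO_norm (step_fun xi n) | n in [set: nat]].

End BMO.

(** [measurableTypeR R] is [R] with its Borel sigma-algebra. *)
Notation plane R := (measurableTypeR R * measurableTypeR R)%type.

Section Fourier.
Context {R : realType}.
Local Notation plane := (plane R).

Definition mu2 : {measure set plane -> \bar R} :=
  (@lebesgue_measure R \x @lebesgue_measure R)%E.

Definition torus2 : set plane := `[- pi, pi[ `*` `[- pi, pi[.

Definition fourier_coef (f : plane -> R[i]) (m k : int) : R[i] :=
  ((4 * pi ^+ 2)^-1)%:C *
  cintegral mu2 torus2
    (fun p => f p * expi (- (m%:~R * p.1 + k%:~R * p.2))).

(** The frequencies [-n, ..., n] are written [i - n] with [0 <= i < 2n+1]. *)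
Definition quad_sum (f : plane -> R[i]) (n : nat) (p : plane) : R[i] :=
  \sum_(i < n.*2.+1) \sum_(j < n.*2.+1)
    (let m := i%:Z - n%:Z in let k := j%:Z - n%:Z in
     fourier_coef f m k * expi (m%:~R * p.1 + k%:~R * p.2)).

Definition logp (u : R) : R := if 1 < u then ln u else 0.

Definition LlogL_integral (f : plane -> R[i]) : \bar R :=
  (\int[mu2]_(p in torus2) (modc (f p) * logp (modc (f p)))%:E)%E.

(** Measurability with respect to the Lebesgue sigma-algebra of the plane, i.e.
    the [mu2]-completion of the Borel one.  The integral against [mu2] of such
    a function is its Lebesgue integral: the supremum over Borel simple
    functions below a nonnegative Lebesgue measurable function equals the one
    over Lebesgue measurable simple functions. *)
Definition lebesgue_measurable2 (g : plane -> R) : Prop :=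
  forall Y : set R, measurable Y -> completed_algebra_gen mu2 (g @^-1` Y).

Definition LlogL (f : plane -> R[i]) : Prop :=
  [/\ forall y, periodic (fun x => f (x, y)) (pi *+ 2),
      forall x, periodic (fun y => f (x, y)) (pi *+ 2),
      lebesgue_measurable2 (fun p => complex.Re (f p)),
      lebesgue_measurable2 (fun p => complex.Im (f p)) &
      (LlogL_integral f < +oo)%E].

End Fourier.

(* Main.v *)
Require Import Defs.
From mathcomp Require Import all_boot all_order all_algebra.
From mathcomp Require Import complex.
From mathcomp Require Import all_classical all_reals all_analysis.
From mathcomp Require Import measurable_realfun.
From mathcomp Require Import ring lra zify.
Set Implicit Arguments.
Unset Strict Implicit.
Unset Printing Implicit Defensive.
Import Order.TTheory GRing.Theory Num.Theory.
Import numFieldNormedType.Exports.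
Local Open Scope classical_set_scope.
Local Open Scope ring_scope.

(** By transfer and Jensen's inequality it suffices to bound, for a trigonometric
    polynomial [G] on the grid [(Z/L)^2] with [L] large, the number of points at
    which some block of the sequence [S_n G] has large mean oscillation or some
    mean of the [S_n G] is large.

    The ring [max(|m|, |k|) <= n] is cut by the diagonals [m = k] and [m = - k]:
    with [s+-] the sign of [m +- k], the difference [S_n G - S_a G] is a sum of
    one-variable partial sums, in [x] or in [y], of the Hilbert transforms
    [H+- G] along the diagonals.  These transforms are in [L^1] with norm at most
    [C (1 + int |G| log+ |G|)], by Zygmund's theorem.  On almost every line the
    one-variable partial sums of an [L^1] function have bounded block
    oscillations, with a weak (1,1) bound: near the point the kernel is
    controlled by the maximal function, and away from it by a large sieve
    inequality and a Marcinkiewicz integral.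

    Small oscillation on all dyadic multiples of [0, n] makes the mean of
    [S_0, ..., S_n] comparable with the multiplier [(n+1)/(n+1+max(|m|, |k|))].
    Since [max(|m|, |k|) = (|m + k| + |m - k|)/2] is the symbol of a jump
    generator, these resolvents are of weak type (1,1) by the maximum principle. *)

(** The estimate is maximal: one exceptional set has to serve all blocks [[a, a + N)] at once. This
    is possible because moving a block multiplies its kernel by a unimodular character: the bounds
    see only [|G|], and the exceptional set is built from [|G|] alone. Oscillation bounds say
    nothing about size, yet the BMO norm contains the mean; the resolvents supply the missing size.
    Working on a finite group makes every maximum attained and every kernel identity exact: [L] is
    taken so large that no frequency in use is aliased, and no constant depends on [L] or on the
    degree. Zygmund's bound is obtained by duality: the conjugate of a bounded function is
    exponentially integrable, and Young's inequality pairs this with [|G| log+ |G|]. Since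
    [u log+ u] is not homogeneous, the polynomial replacing [f] must come from a kernel with a
    majorant of mass at most [1]; dividing by a constant achieves this and is undone at the end. *)

(** * Modulus, real and imaginary parts, and the exponential [expi] *)

Section ComplexBasics.
Context {R : realType}.
Local Notation C := R[i].
Local Open Scope complex_scope.
Implicit Types (z w : C) (x y : R).

Lemma modc0 : modc (0 : C) = 0.
Proof. exact: ComplexField.Normc.normc0. Qed.

Lemma modc1 : modc (1 : C) = 1.
Proof. exact: ComplexField.Normc.normc1. Qed.

Lemma modc_ge0 z : 0 <= modc z.
Proof. by case: z => a b; exact: sqrtr_ge0. Qed.

Lemma modcM z w : modc (z * w) = modc z * modc w.
Proof. exact: ComplexField.Normc.normcM. Qed.

Lemma modcV z : modc z^-1 = (modc z)^-1.
Proof. exact: ComplexField.Normc.normcV. Qed.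

Lemma modcX z n : modc (z ^+ n) = modc z ^+ n.
Proof. by elim: n => [|n IH]; rewrite ?expr0 ?modc1// !exprS modcM IH. Qed.

Lemma modcD z w : modc (z + w) <= modc z + modc w.
Proof. exact: le_normcD. Qed.

Lemma modcN z : modc (- z) = modc z.
Proof. exact: normcN. Qed.

Lemma modcB z w : modc (z - w) <= modc z + modc w.
Proof. by rewrite -(modcN w) modcD. Qed.

Lemma modcBC z w : modc (z - w) = modc (w - z).
Proof. by rewrite -modcN opprB. Qed.

Lemma modc_triangle w z v : modc (z - v) <= modc (z - w) + modc (w - v).
Proof. by rewrite (le_trans _ (modcD _ _))// addrA subrK. Qed.

Lemma modc_sum I (r : seq I) (P : pred I) (F : I -> C) :
  modc (\sum_(i <- r | P i) F i) <= \sum_(i <- r | P i) modc (F i).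
Proof.
elim/big_ind2: _ => [|x1 x2 y1 y2 h1 h2|//]; first by rewrite modc0.
by rewrite (le_trans (modcD _ _))// lerD.
Qed.

Lemma modcR x : modc x%:C = `|x|.
Proof. by rewrite /modc/= expr0n/= addr0 sqrtr_sqr. Qed.

Lemma modc_nat n : modc (n%:R : C) = n%:R.
Proof. by rewrite -(rmorph_nat (real_complex R)) modcR normr_nat. Qed.

Lemma modcJ z : modc (conjc z) = modc z.
Proof. by case: z => a b; rewrite /modc/= sqrrN. Qed.

Lemma modc_sqr z : modc z ^+ 2 = complex.Re z ^+ 2 + complex.Im z ^+ 2.
Proof. by case: z => a b; rewrite /modc/= sqr_sqrtr// addr_ge0// sqr_ge0. Qed.

Lemma mulcJ z : z * conjc z = (modc z ^+ 2)%:C.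
Proof.
rewrite modc_sqr; case: z => a b; rewrite /=; apply/eqP; rewrite eq_complex/=.
by apply/andP; split; apply/eqP; ring.
Qed.

Lemma Re_modc z : `|complex.Re z| <= modc z.
Proof.
rewrite -(@ler_pXn2r _ 2) ?nnegrE ?modc_ge0//.
by rewrite modc_sqr real_normK ?num_real// lerDl sqr_ge0.
Qed.

Lemma Im_modc z : `|complex.Im z| <= modc z.
Proof.
rewrite -(@ler_pXn2r _ 2) ?nnegrE ?modc_ge0//.
by rewrite modc_sqr real_normK ?num_real// lerDr sqr_ge0.
Qed.

Lemma modc_ReIm z : modc z <= `|complex.Re z| + `|complex.Im z|.
Proof.
rewrite -(@ler_pXn2r _ 2) ?nnegrE ?modc_ge0 ?addr_ge0//.
rewrite modc_sqr sqrrD !real_normK ?num_real// -addrA lerD2l lerDr.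
by rewrite mulrn_wge0// mulr_ge0.
Qed.

Lemma ReD z w : complex.Re (z + w) = complex.Re z + complex.Re w.
Proof. by case: z w => [a b] [c d]. Qed.

Lemma ImD z w : complex.Im (z + w) = complex.Im z + complex.Im w.
Proof. by case: z w => [a b] [c d]. Qed.

Lemma ReN z : complex.Re (- z) = - complex.Re z.
Proof. by case: z. Qed.

Lemma ImN z : complex.Im (- z) = - complex.Im z.
Proof. by case: z. Qed.

Lemma ReM z w :
  complex.Re (z * w) = complex.Re z * complex.Re w - complex.Im z * complex.Im w.
Proof. by case: z w => [a b] [c d]. Qed.

Lemma ImM z w :
  complex.Im (z * w) = complex.Re z * complex.Im w + complex.Im z * complex.Re w.
Proof. by case: z w => [a b] [c d]. Qed.

Lemma ReZ x z : complex.Re (x%:C * z) = x * complex.Re z.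
Proof. by rewrite ReM/= mul0r subr0. Qed.

Lemma ImZ x z : complex.Im (x%:C * z) = x * complex.Im z.
Proof. by rewrite ImM/= mul0r addr0. Qed.

Lemma Re_sum I (r : seq I) (P : pred I) (F : I -> C) :
  complex.Re (\sum_(i <- r | P i) F i) = \sum_(i <- r | P i) complex.Re (F i).
Proof. exact: (big_morph _ ReD). Qed.

Lemma Im_sum I (r : seq I) (P : pred I) (F : I -> C) :
  complex.Im (\sum_(i <- r | P i) F i) = \sum_(i <- r | P i) complex.Im (F i).
Proof. exact: (big_morph _ ImD). Qed.

Lemma complexP z w : complex.Re z = complex.Re w ->
  complex.Im z = complex.Im w -> z = w.
Proof. by case: z w => [a b] [c d] /= -> ->. Qed.

Lemma modc_phase z : exists2 u : C, modc u <= 1 & u * z = (modc z)%:C.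
Proof.
have [->|z0] := eqVneq z 0.
  by exists 0; rewrite ?modc0// mul0r.
have mz : modc z != 0.
  by apply: contra z0 => /eqP/ComplexField.Normc.eq0_normc ->.
exists ((modc z)^-1%:C * conjc z).
  rewrite modcM modcR modcJ ger0_norm ?invr_ge0 ?modc_ge0//.
  by rewrite mulVf.
rewrite -mulrA (mulrC (conjc z)) mulcJ -rmorphM/= expr2 mulrA mulVf// mul1r//.
Qed.

Lemma expiD x y : expi (x + y) = expi x * expi y.
Proof.
apply: complexP; rewrite ?ReM ?ImM /expi/= ?cosD ?sinD//.
by rewrite addrC.
Qed.

Lemma expi0 : expi (0 : R) = 1.
Proof. by rewrite /expi cos0 sin0. Qed.

Lemma expiN x : expi (- x) = conjc (expi x).
Proof. by rewrite /expi cosN sinN. Qed.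

Lemma modc_expi x : modc (expi x) = 1.
Proof. by rewrite /modc/= cos2Dsin2 sqrtr1. Qed.

Lemma expiMn x n : expi (x *+ n) = expi x ^+ n.
Proof.
by elim: n => [|n IH]; rewrite ?mulr0n ?expi0// mulrS expiD IH exprS.
Qed.

Lemma expi2pi : expi (pi *+ 2 : R) = 1.
Proof. by rewrite /expi cos2pi sin2pi. Qed.

Lemma expi_period (m : int) : expi (m%:~R * (pi *+ 2) : R) = 1.
Proof.
have H n : expi (n%:R * (pi *+ 2) : R) = 1.
  by rewrite mulr_natl expiMn expi2pi expr1n.
case: m => n; first exact: H.
by rewrite NegzE rmorphN/= mulNr expiN H conjc1.
Qed.

Lemma expi_neq0 x : expi x != 0.
Proof.
apply/eqP => h; have := modc_expi x; rewrite h modc0 => /eqP.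
by rewrite eq_sym oner_eq0.
Qed.

End ComplexBasics.

(** * The maximum principle behind the weak type bounds *)

Section MaximumPrinciple.
Context {R : realType}.

(* Garsia's argument: [U] is the positive part of the maximum of the [u a]. *)
Lemma garsia (X A T : finType) (c : T -> R) (s : T -> X -> X)
    (u : A -> X -> R) (g : X -> R) :
  let U j := \big[Num.max/0]_(a : A) u a j in
  (forall t, 0 <= c t) -> (forall t, injective (s t)) ->
  (forall a j, 0 < u a j -> \sum_t c t * (u a j - U (s t j)) <= g j) ->
  0 <= \sum_(j | 0 < U j) g j.
Proof.
move=> U c0 sI H.
have U0 j : 0 <= U j by rewrite /U; apply: bigmax_ge_id.
have Hg j : 0 < U j -> \sum_t c t * (U j - U (s t j)) <= g j.
  move=> Uj.
  have [a Ea] : exists a, U j = u a j.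
    move: Uj; rewrite /U; elim/big_ind: _ => [|x y IHx IHy|a _ _].
    - by rewrite ltxx.
    - by rewrite /Num.max; case: ifP => _; [exact: IHy|exact: IHx].
    - by exists a.
  by rewrite Ea; apply: H; rewrite -Ea.
apply: (@le_trans _ _ (\sum_(j | 0 < U j) \sum_t c t * (U j - U (s t j)))); last first.
  by apply: ler_sum => j; exact: Hg.
rewrite exchange_big/=; apply: sumr_ge0 => t _.
rewrite -mulr_sumr mulr_ge0// sumrB subr_ge0.
(* The set where [U] is positive carries the whole sum of [U], whereas [U] composed with the
   bijection [s t], which has the same total, may have part of its mass outside that set. *)
have -> : \sum_(j | 0 < U j) U j = \sum_j U j.
  rewrite [RHS](bigID (fun j => 0 < U j))/= [X in _ + X]big1 ?addr0// => j.
  by rewrite -leNgt => Uj; apply/eqP; rewrite eq_le Uj U0.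
rewrite (le_trans _ (_ : \sum_j U (s t j) <= _))//.
  rewrite [leRHS](bigID (fun j => 0 < U j))/= lerDl sumr_ge0//.
by rewrite [leRHS](reindex_inj (sI t)).
Qed.
End MaximumPrinciple.

(** * The cyclic group Z/L and its distance to [0] *)

Section CyclicGroup.
Variable l : nat.
Local Notation L := l.+2.
Implicit Types s t : 'I_L.

Definition nrm t : nat := minn t (L - t).

Lemma val_addZ s t :
  (s + t)%R = (if (s + t < L)%N then s + t else s + t - L)%N :> nat.
Proof.
rewrite /= ; case: ifP => h; first by rewrite modn_small.
have hs := ltn_ord s; have ht := ltn_ord t.
have {1}-> : (s + t = s + t - L + L)%N by lia.
by rewrite modnDr modn_small//; lia.
Qed.

Lemma val_oppZ t : (- t)%R = (if (t : nat) == 0 then 0 else L - t)%N :> nat.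
Proof.
have ht := ltn_ord t.
rewrite /=; case: ifP => [/eqP ->|/negbT h]; first by rewrite subn0 modnn.
by rewrite modn_small//; lia.
Qed.

Lemma nrm0 : nrm 0 = 0%N.
Proof. by rewrite /nrm min0n. Qed.

Lemma nrmN t : nrm (- t) = nrm t.
Proof. by rewrite /nrm val_oppZ; have ht := ltn_ord t; case: eqP; lia. Qed.

Lemma nrmD s t : (nrm (s + t)%R <= nrm s + nrm t)%N.
Proof.
rewrite /nrm val_addZ; have ht := ltn_ord t; have hs := ltn_ord s.
by case: ifP; lia.
Qed.

Lemma nrmB s t : nrm (s - t) = nrm (t - s).
Proof. by rewrite -nrmN opprB. Qed.

Lemma nrm_eq0 t : (nrm t == 0)%N = (t == 0).
Proof.
have ht := ltn_ord t; rewrite /nrm -val_eqE /=.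
by apply/idP/idP; lia.
Qed.

Lemma nrm_le t : (nrm t <= t)%N.
Proof. exact: geq_minl. Qed.

Lemma nrm_lt t : (nrm t < L)%N.
Proof. exact: leq_ltn_trans (nrm_le t) (ltn_ord t). Qed.

End CyclicGroup.

(** * The maximal function on Z/L *)

Section GridSums.
Context {R : realType}.
Variable l : nat.
Local Notation L := l.+2.
Implicit Types (f : 'I_L -> R) (lambda : R).

Lemma sum_shift (V : zmodType) (F : 'I_L -> V) x : \sum_t F (x + t) = \sum_t F t.
Proof. by rewrite [RHS](reindex_inj (addrI x)). Qed.

Lemma sum_opp (V : zmodType) (F : 'I_L -> V) : \sum_t F (- t) = \sum_t F t.
Proof. by rewrite [RHS](reindex_inj oppr_inj). Qed.

Lemma sum_rev (V : zmodType) (F : 'I_L -> V) x : \sum_t F (x - t) = \sum_t F t.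
Proof. by rewrite (sum_opp (fun t => F (x + t))) sum_shift. Qed.

(** Hopf's maximal ergodic inequality for the translation by [d]. With [u J z] the sum of
    [f - lambda] over [J] steps from [z], one has [u J.+1 z = f z - lambda + u J (z + d)], which is
    the hypothesis of [garsia] for a single jump of rate [1]. *)
Lemma shift_maximal f lambda (d : 'I_L) (N : nat) :
  (forall t, 0 <= f t) -> 0 < lambda ->
  exists B : {set 'I_L}, lambda * #|B|%:R <= \sum_t f t /\
    forall z, z \notin B -> forall J, (J <= N)%N ->
      \sum_(i < J) f (z + d *+ i) <= lambda * J%:R.
Proof.
move=> f0 la0.
pose u (J : 'I_N.+1) z : R := \sum_(i < J) (f (z + d *+ i) - lambda).
pose U z := \big[Num.max/0]_(J : 'I_N.+1) u J z.
have U0 z : 0 <= U z by exact: bigmax_ge_id.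
have uU J z : u J z <= U z by exact: (le_bigmax _ (u^~ z)).
have := @garsia R 'I_L 'I_N.+1 'I_1 (fun=> 1) (fun _ z => z + d) u
  (fun z => f z - lambda) (fun=> ler01) (fun _ => @addIr _ d).
rewrite -/U; move=> /(_ _)/wrap[].
  move=> J z; rewrite big_ord1 mul1r.
  case: J => -[|J] hJ uz; first by move: uz; rewrite /u big_ord0 ltxx.
  have hJ' : (J < N.+1)%N by exact: ltnW.
  have := uU (Ordinal hJ') (z + d).
  rewrite /u/= big_ord_recl/= mulr0n addr0.
  under [in X in _ -> X]eq_bigr do rewrite /bump/= add1n mulrS addrA.
  by move=> h; rewrite lerBlDr lerD2l.
rewrite sumrB => H.
exists [set z | 0 < U z]%SET; split.
  rewrite -subr_ge0; apply: (le_trans H).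
  rewrite lerB//.
    rewrite [leRHS](bigID (fun j => 0 < U j))/= lerDl sumr_ge0//.
  by rewrite mulr_natr -sumr_const; under eq_bigl do rewrite inE.
move=> z; rewrite inE -leNgt => Uz J hJ.
have := uU (Ordinal (hJ : (J < N.+1)%N)) z.
move=> /le_trans/(_ Uz); rewrite /u/= sumrB sumr_const card_ord.
by rewrite subr_le0 mulr_natr.
Qed.

(** A ball is covered by two arcs issuing from its centre, so [shift_maximal] is used for the steps
    [1] and [-1]; this doubles both the size of the exceptional set and the bound. *)
Lemma maximal f lambda : (forall t, 0 <= f t) -> 0 < lambda ->
  exists B : {set 'I_L}, lambda * #|B|%:R <= 2 * \sum_t f t /\
    forall z, z \notin B -> forall r : nat,
      \sum_(s | (nrm (s - z)%R <= r)%N) f s <= 2 * lambda * r.+1%:R.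
Proof.
move=> f0 la0.
have [B1 [hB1 H1]] := shift_maximal 1 L f0 la0.
have [B2 [hB2 H2]] := shift_maximal (-1) L f0 la0.
exists (B1 :|: B2)%SET; split.
  rewrite mulr_natl mulr2n (le_trans _ (lerD hB1 hB2))// -mulrDr ler_wpM2l ?(ltW la0)//.
  by rewrite -natrD ler_nat cardsU leq_subr.
move=> z; rewrite inE negb_or => /andP[/H1 {}H1 /H2 {}H2] r.
rewrite (reindex_inj (addrI z))/=.
under eq_bigl do rewrite addrAC subrr add0r.
rewrite -mulrA mulr_natl mulr2n.
(* Arcs are cut at [L] points, the longest for which they do not wrap around and meet a point
   twice. *)
set q := minn r.+1 L.
have qL : (q <= L)%N by exact: geq_minr.
have lq : lambda * q%:R <= lambda * r.+1%:R.
  by rewrite ler_wpM2l ?(ltW la0)// ler_nat geq_minl.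
have {H1 lq} H12 := lerD (le_trans (H1 _ qL) lq) (le_trans (H2 _ qL) lq).
apply: le_trans H12.
have E i : (i%:R : 'I_L) = inZp i by rewrite Zp_nat.
rewrite (le_trans (_ : _ <= \sum_(t : 'I_L | (t < q)%N) f (z + t) +
  \sum_(t : 'I_L | (t < q)%N) f (z - t)))//; last first.
  rewrite lerD//.
    rewrite (big_ord_widen L (fun i => f (z + 1 *+ i)))//.
    by rewrite le_eqVlt; apply/orP; left; apply/eqP/eq_bigr => i _; rewrite E valZpK.
  rewrite (big_ord_widen L (fun i => f (z + (-1) *+ i)))//.
  by rewrite le_eqVlt; apply/orP; left; apply/eqP/eq_bigr => i _;
    rewrite mulNrn E valZpK.
rewrite (_ : \sum_(t : 'I_L | (t < q)%N) f (z - t) =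
  \sum_(t : 'I_L | ((- t)%R < q)%N) f (z + t)); last first.
  by rewrite (reindex_inj oppr_inj)/=; under eq_bigr do rewrite opprK.
rewrite [leLHS]big_mkcond [X in _ <= X + _]big_mkcond [X in _ <= _ + X]big_mkcond.
rewrite -big_split; apply: ler_sum => t _.
rewrite -[leRHS]/((if (t < q)%N then f (z + t) else 0) +
  (if ((- t)%R < q)%N then f (z + t) else 0)).
have [h|] := boolP (nrm t <= r)%N; last first.
  by move=> _; rewrite addr_ge0//; case: ifP.
have ht := ltn_ord t; move: h; rewrite /nrm val_oppZ /q => h.
have [h1|h1] := boolP (t < minn r.+1 L)%N.
  by rewrite lerDl; case: ifP.
case: ifP => [_|]; first by rewrite add0r.
case: ifP => [/eqP t0|_] h2.
  by move: h1; rewrite t0; lia.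
by exfalso; lia.
Qed.

End GridSums.

(** These are the Fourier coefficients of the squared modulus of a sum of [K] consecutive
    exponentials, that is, of [K] times a Fejér kernel; they serve both on the grid and on the
    torus. *)
Lemma count_diff (K : nat) (m : int) : (`|m| <= K)%N ->
  (\sum_(b < K) \sum_(b' < K) (b%:Z - b'%:Z + m == 0)%R = K - `|m|)%N.
Proof.
move=> mK.
have step (b : 'I_K) : (\sum_(b' < K) (b%:Z - b'%:Z + m == 0)%R =
    (0 <= b%:Z + m < K%:Z)%R)%N.
  have [/andP[h1 h2]|h] := boolP (0 <= b%:Z + m < K%:Z)%R.
    have hb : (`|(b%:Z + m)%R| < K)%N by lia.
    rewrite (bigD1 (Ordinal hb))//= big1 ?addn0; first by lia.
    by move=> i; rewrite -val_eqE/= => hi; apply/eqP; rewrite eqb0; lia.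
  by rewrite big1// => i _; apply/eqP; rewrite eqb0; have := ltn_ord i; lia.
under eq_bigr do rewrite step.
have H (P : pred nat) a c : (c <= K)%N -> (a <= c)%N ->
    (forall b, (b < K)%N -> P b = (a <= b < c)%N) ->
    (\sum_(b < K) P b = c - a)%N.
  move=> cK ac hP.
  rewrite (eq_bigr (fun b : 'I_K => nat_of_bool (a <= b < c)%N)); last first.
    by move=> b _; rewrite hP.
  rewrite -(big_mkord xpredT (fun b => nat_of_bool (a <= b < c)%N)).
  rewrite (@big_cat_nat _ _ _ c)//= (@big_cat_nat _ _ _ a 0 c)//=.
  rewrite [X in (X + _ + _)%N]big_nat_cond [X in (X + _ + _)%N]big1; last first.
    by move=> i; rewrite andbT => /andP[_ h]; apply/eqP; rewrite eqb0; lia.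
  rewrite [X in (_ + X)%N]big_nat_cond [X in (_ + X)%N]big1; last first.
    by move=> i; rewrite andbT => /andP[h _]; apply/eqP; rewrite eqb0; lia.
  rewrite (eq_big_nat _ _ (F2 := fun=> 1%N)); last by move=> i ->.
  by rewrite sum_nat_const_nat; lia.
case: m mK {step} => n mK.
  rewrite (H (fun b => 0 <= b%:Z + n < K%:Z)%R 0%N (K - n)%N); [lia|lia|lia|].
  by move=> b bK; lia.
rewrite (H (fun b => 0 <= b%:Z + Negz n < K%:Z)%R n.+1 K); [lia|lia|by []|].
by move=> b bK; lia.
Qed.

(** * Characters of Z/L, Dirichlet and Fejér kernels *)

Section Characters.
Context {R : realType}.
Variable l : nat.
Local Notation L := l.+2.
Local Notation C := R[i].
Local Open Scope complex_scope.
Implicit Types (s t : 'I_L) (m k : int).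

Lemma modc_expiB1 (x : R) : modc (expi x - 1) = 2 * `|sin (x / 2)|.
Proof.
apply/eqP; rewrite -(@eqrXn2 _ 2) ?modc_ge0 ?mulr_ge0//.
rewrite modc_sqr exprMn real_normK ?num_real//.
have {1 2}-> : x = x / 2 + x / 2 by rewrite -splitr.
rewrite expiD /expi/=.
have := cos2Dsin2 (x / 2); set c := cos _; set s := sin _ => h.
by apply/eqP; nra.
Qed.

Lemma sin_ge_mulcos (x : R) : 0 <= x <= pi / 2 -> x * cos x <= sin x.
Proof.
move=> /andP[x0 xpi]; have pi0 : 0 < pi :> R := pi_gt0 R.
have h1 z : z \in `]0, x[ -> is_derive z 1 sin (cos z) by move=> _; exact: is_derive_sin.
have h2 : {within `[0, x], continuous (@sin R)}.
  exact: continuous_subspaceT (@continuous_sin R).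
have [y] := MVT_segment x0 h1 h2.
rewrite in_itv/= => /andP[y0 yx]; rewrite sin0 !subr0 => ->.
rewrite mulrC ler_wpM2r// leNgt ltr_cos ?in_itv/=; first by rewrite -leNgt.
- by apply/andP; split; lra.
- by apply/andP; split; lra.
Qed.

(** By the double angle formula and [sin_ge_mulcos] at [x / 2], [sin x] is at least [x cos(x/2)^2],
    and [cos x >= 0] forces [cos(x/2)^2 >= 1/2]. *)
Lemma sin_ge_half (x : R) : 0 <= x <= pi / 2 -> x / 2 <= sin x.
Proof.
move=> /andP[x0 xpi]; have pi0 : 0 < pi :> R := pi_gt0 R.
have h : 0 <= x / 2 <= pi / 2 by apply/andP; split; lra.
have cx0 : 0 <= cos x by apply: cos_ge0_pihalf; apply/andP; split; lra.
have := sin_ge_mulcos h; have := cos_ge0_pihalf (_ : - (pi / 2) <= x / 2 <= pi / 2).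
have e : x = x / 2 + x / 2 by rewrite -splitr.
move: cx0; rewrite {1}e cosD [in X in _ -> _ -> _ -> X]e sinD.
have := cos2Dsin2 (x / 2); set c := cos _; set s := sin _ => h1 h2.
move=> /(_ ltac:(lra)) h3 h4.
nra.
Qed.

Definition ang t : R := pi *+ 2 * (t : nat)%:R / L%:R.

Definition chi m t : C := expi (m%:~R * ang t).

Lemma L_gt0 : 0 < L%:R :> R. Proof. by rewrite ltr0n. Qed.

Let L_neq0 : 2 + l%:R != 0 :> R. Proof. by rewrite -natrD pnatr_eq0. Qed.

Lemma chiD m s t : chi m (s + t) = chi m s * chi m t.
Proof.
rewrite /chi -expiD -mulrDr /ang val_addZ.
case: ifPn => h; first by congr expi; rewrite natrD; field; exact: L_neq0.
rewrite natrB; last by rewrite leqNgt.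
rewrite natrD -[RHS]mulr1 -(expi_period (- m)) -expiD; congr expi.
by rewrite rmorphN/=; field; exact: L_neq0.
Qed.

Lemma chi0 m : chi m 0 = 1.
Proof. by rewrite /chi /ang mulr0 mul0r mulr0 expi0. Qed.

Lemma chi_freq0 t : chi 0 t = 1.
Proof. by rewrite /chi mul0r expi0. Qed.

Lemma chi_freqD m k t : chi (m + k) t = chi m t * chi k t.
Proof. by rewrite /chi rmorphD/= mulrDl expiD. Qed.

Lemma chi_freqN m t : chi (- m) t = conjc (chi m t).
Proof. by rewrite /chi rmorphN/= mulNr expiN. Qed.

Lemma modc_chi m t : modc (chi m t) = 1.
Proof. exact: modc_expi. Qed.

Lemma chiN m t : chi m (- t) = chi (- m) t.
Proof.
have h : chi m t != 0 by exact: expi_neq0.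
by apply: (mulIf h); rewrite -chiD addNr chi0 -chi_freqD addNr chi_freq0.
Qed.

Lemma chiB m s t : chi m (s - t) = chi m s * chi (- m) t.
Proof. by rewrite chiD chiN. Qed.

Lemma chi_freqX (n : nat) t : chi n%:Z t = chi 1 t ^+ n.
Proof. by rewrite /chi mul1r -expiMn mulr_natl. Qed.

Lemma sum_chi m : (`|m| < L)%N -> m != 0 -> \sum_t chi m t = 0.
Proof.
move=> mL m0.
have h : chi m 1 != 1.
  rewrite -subr_eq0; apply/eqP => h.
  have := modc_expiB1 (m%:~R * ang 1); rewrite -/(chi m 1) h modc0 => /esym/eqP.
  rewrite mulf_eq0 pnatr_eq0/= normr_eq0.
  rewrite -[_ == 0]orbb -{1}oppr_eq0 -sinN.
  have pi0 : 0 < pi :> R := pi_gt0 R.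
  have key : 0 < sin (`|m|%N%:R * pi / L%:R : R).
    apply: sin_gt0_pi; apply/andP; split.
      by rewrite divr_gt0 ?mulr_gt0 ?L_gt0// ltr0n absz_gt0.
    by rewrite ltr_pdivrMr ?L_gt0// mulrC ltr_pM2l// ltr_nat.
  have e1 : ang 1 = pi *+ 2 / L%:R by rewrite /ang mulr1.
  case: m {mL m0 h} key => n /= key; rewrite e1.
    rewrite [X in _ || X](_ : _ = false) ?orbF.
      move=> /eqP; rewrite sinN => /eqP; rewrite oppr_eq0.
      rewrite [X in sin X](_ : _ = n%:R * pi / L%:R) ?(gt_eqF key)//.
      by field; exact: L_neq0.
    rewrite [X in sin X](_ : _ = n%:R * pi / L%:R) ?(gt_eqF key)//.
    by field; exact: L_neq0.
  rewrite sinN oppr_eq0 orbb -oppr_eq0 -sinN.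
  rewrite [X in sin X](_ : _ = n.+1%:R * pi / L%:R) ?(gt_eqF key)//.
  by rewrite NegzE rmorphN/=; field; exact: L_neq0.
apply/eqP; rewrite -[_ == 0]orFb -(negbTE h) -subr_eq0 -mulf_eq0.
rewrite mulrBl mul1r mulr_sumr subr_eq0; apply/eqP.
by under eq_bigr do rewrite -chiD; rewrite sum_shift.
Qed.

Lemma sum_chiE m : (`|m| < L)%N -> \sum_t chi m t = (L%:R *+ (m == 0)).
Proof.
move=> mL; have [->|m0] := eqVneq m 0; last by rewrite sum_chi.
by under eq_bigr do rewrite chi_freq0; rewrite sumr_const card_ord.
Qed.

Lemma modc_chiB1 t : 2 * (nrm t)%:R / L%:R <= modc (chi 1 t - 1).
Proof.
rewrite /chi mul1r modc_expiB1.
have pi0 : 0 < pi :> R := pi_gt0 R; have pi2 := pi_ge2 R.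
pose y (n : nat) : R := pi * n%:R / L%:R.
have -> : ang t / 2 = y t.
  by rewrite /ang /y; field; exact: L_neq0.
have H (n : nat) : (n.*2 <= L)%N -> n%:R / L%:R <= sin (y n).
  move=> n2; rewrite (le_trans _ (sin_ge_half _))//.
    rewrite (_ : y n / 2 = pi / 2 * (n%:R / L%:R)); last by rewrite /y; field; exact: L_neq0.
    by rewrite ler_peMl ?divr_ge0//; lra.
  rewrite /y; apply/andP; split; first by rewrite divr_ge0 ?mulr_ge0// ltW.
  rewrite ler_pdivrMr ?L_gt0// -mulrA ler_wpM2l ?(ltW pi0)//.
  by rewrite ler_pdivlMl// -natrM ler_nat mul2n.
have ht := ltn_ord t.
rewrite -mulrA ler_wpM2l//; rewrite /nrm.
have [h|h] := leqP t.*2 L.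
  have -> : minn t (L - t) = t by lia.
  by rewrite (le_trans (H _ h))// ler_norm.
have -> : minn t (L - t) = (L - t)%N by lia.
have -> : sin (y t) = sin (y (L - t)%N).
  rewrite -[LHS]opprK -sinN -sinDpi; congr sin.
  by rewrite /y natrB ?(ltnW ht)//; field; exact: L_neq0.
by rewrite (le_trans (H _ _))// ?ler_norm//; lia.
Qed.

(** The one-sided Dirichlet sum. Its squared modulus is [K] times the Fejér kernel, the positive
    kernel of the large sieve, of the jump generator and of the de la Vallée Poussin means. *)
Definition dir (K : nat) t : C := \sum_(b < K) chi b%:Z t.

Lemma modc_dir K t : modc (dir K t) <= K%:R.
Proof.
rewrite (le_trans (modc_sum _ _ _))//.
by under eq_bigr do rewrite modc_chi; rewrite sumr_const card_ord.
Qed.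

Lemma dir_geom K t : (chi 1 t - 1) * dir K t = chi K%:Z t - 1.
Proof.
rewrite chi_freqX subrX1; congr (_ * _); apply: eq_bigr => b _.
exact: chi_freqX.
Qed.

Lemma modc_dir_nrm K t : modc (dir K t) * (nrm t)%:R <= L%:R.
Proof.
have := congr1 (@modc R) (dir_geom K t); rewrite modcM => h.
have h2 : modc (chi K%:Z t - 1) <= 2.
  by rewrite (le_trans (modcB _ _))// modc_chi modc1.
have := modc_chiB1 t; have := modc_ge0 (dir K t); have := L_gt0.
move: h2; rewrite -h; set A := modc _; set D := modc _; set n := _%:R => h2 h3 h4.
rewrite ler_pdivrMr//; nra.
Qed.

Lemma dir_sqr K t :
  (modc (dir K t) ^+ 2)%:C = \sum_(b < K) \sum_(b' < K) chi (b%:Z - b'%:Z) t.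
Proof.
rewrite -mulcJ rmorph_sum/= big_distrl/=; apply: eq_bigr => b _.
by rewrite big_distrr/=; apply: eq_bigr => b' _; rewrite chi_freqD chi_freqN.
Qed.

(** The frequencies [b - b' + m] that occur have absolute value below [2 K <= L], so orthogonality
    of characters counts exact solutions of [b - b' + m = 0], not solutions modulo [L]. *)
Lemma fejer_coef K m : (K.*2 <= L)%N -> (`|m| <= K)%N ->
  \sum_t (modc (dir K t) ^+ 2)%:C * chi m t = (L * (K - `|m|))%N%:R.
Proof.
move=> KL mK.
under eq_bigr do rewrite dir_sqr big_distrl/=.
rewrite exchange_big/=.
transitivity (\sum_(b < K) \sum_(b' < K) L%:R *+ (b%:Z - b'%:Z + m == 0) : C).
  apply: eq_bigr => b _.
  under eq_bigr do rewrite big_distrl/=.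
  rewrite exchange_big/=; apply: eq_bigr => b' _.
  under eq_bigr do rewrite -chi_freqD.
  rewrite sum_chiE//; have := ltn_ord b; have := ltn_ord b'; lia.
rewrite -(count_diff mK) mulnC natrM mulr_natl.
by rewrite -sumrMnr; apply: eq_bigr => b _; rewrite -sumrMnr.
Qed.

End Characters.

Arguments chi : simpl never.
Arguments expi : simpl never.

(** * A dyadic decay kernel and the large sieve *)

Section Kernel.
Context {R : realType}.
Variable l : nat.
Local Notation L := l.+2.
Local Notation C := R[i].
Local Open Scope complex_scope.

(* A dyadic substitute for [min(1, (rho / u)^2)]. *)
Definition kern (rho u : nat) : R :=
  \sum_(k < L) (4 ^- k) * (u <= 2 ^ k * rho)%N%:R.

Lemma kern_ge0 rho u : 0 <= kern rho u.
Proof. by apply: sumr_ge0 => k _; rewrite mulr_ge0// invr_ge0 exprn_ge0. Qed.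

(** Take the least [k] with [u <= 2 ^ k * rho]; its term alone suffices. If [k] is positive,
    minimality gives [u > 2 ^ (k - 1) * rho], hence [x <= 4 ^- (k - 1)], which is the origin of the
    factor [4]. Since [u < L <= 2 ^ L], this [k] is among the [L] terms kept in [kern]. *)
Lemma kern_ge rho u (x : R) : (0 < rho)%N -> (u < L)%N -> 0 <= x <= 1 ->
  x * u%:R ^+ 2 <= rho%:R ^+ 2 -> x <= 4 * kern rho u.
Proof.
move=> rho0 uL /andP[x0 x1] xu.
have ex : exists k, (u <= 2 ^ k * rho)%N.
  by exists u; rewrite (leq_trans (ltnW (ltn_expl u (isT : 1 < 2)%N)))// leq_pmulr.
have kP := ex_minnP ex; case: kP => k hk kmin.
have kL : (k < L)%N.
  rewrite ltnS; apply: kmin; rewrite (@leq_trans (2 ^ l.+1))//; last exact: leq_pmulr.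
  have hu : (u <= l.+1)%N by []. exact: leq_trans hu (ltnW (ltn_expl l.+1 (isT : 1 < 2)%N)).
have hK : 4 ^- k <= kern rho u.
  rewrite /kern (bigD1 (Ordinal kL))//= hk mulr1 lerDl sumr_ge0//.
rewrite (le_trans _ (ler_wpM2l _ hK))//.
case: k {kL hK} hk kmin => [|k] hk kmin; first by rewrite expr0 invr1; lra.
have hu : (2 ^ k * rho <= u)%N.
  by rewrite ltnW// ltnNge; apply/negP => /kmin; rewrite ltnn.
have h4 : 0 < 4 ^+ k :> R by rewrite exprn_gt0.
have -> : 4 * 4 ^- k.+1 = 4 ^- k :> R by rewrite exprS; field; rewrite expf_neq0.
rewrite -[leRHS]mul1r ler_pdivlMr//.
have r0 : 0 < rho%:R ^+ 2 :> R by rewrite exprn_gt0// ltr0n.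
rewrite -(ler_pM2r r0) mul1r (le_trans _ xu)// -mulrA ler_wpM2l//.
have -> : 4 ^+ k * rho%:R ^+ 2 = (2 ^ k * rho)%:R ^+ 2 :> R.
  by rewrite natrM natrX exprMn -exprM mulnC exprM; congr (_ ^+ k * _); ring.
by rewrite lerXn2r ?nnegrE// ler_nat.
Qed.

Lemma sum_half n : \sum_(k < n) (2 ^- k : R) <= 2.
Proof.
suff -> : \sum_(k < n) (2 ^- k : R) = 2 - 2 * 2 ^- n.
  by rewrite lerBlDr lerDl mulr_ge0// invr_ge0 exprn_ge0.
elim: n => [|n IH]; first by rewrite big_ord0 expr0 invr1 mulr1 subrr.
by rewrite big_ord_recr/= IH exprS; field; rewrite expf_neq0.
Qed.

Lemma sum_quarter n : \sum_(k < n) (4 ^- k : R) <= 2.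
Proof.
rewrite (le_trans _ (sum_half n))//; apply: ler_sum => k _.
by rewrite lef_pV2 ?posrE ?exprn_gt0// lerXn2r ?nnegrE//; lra.
Qed.

(** The ball of radius [2 ^ k * rho] about [y] lies in the ball of radius [2 ^ k * rho + d] about
    [z], where averages are controlled, and the weights [4 ^- k] make the series converge. The
    centre [y] may itself be bad: its distance to a good point is only an additive loss. *)
Lemma kern_sum (f : 'I_L -> R) (lambda : R) (z y : 'I_L) (rho d : nat) :
  (forall t, 0 <= f t) -> 0 < lambda -> (0 < rho)%N -> (nrm (y - z)%R <= d)%N ->
  (forall r : nat, \sum_(s | (nrm (s - z)%R <= r)%N) f s <= 2 * lambda * r.+1%:R) ->
  \sum_s f s * kern rho (nrm (s - y)) <= 8 * lambda * (rho%:R + d%:R).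
Proof.
move=> f0 la0 rho0 hd H.
under eq_bigr do rewrite /kern big_distrr/=.
rewrite exchange_big/=.
pose q := fun k : nat => 2 * lambda * (2 ^- k * rho%:R + 4 ^- k * d.+1%:R).
apply: (@le_trans _ _ (\sum_(k < L) q k)).
  apply: ler_sum => k _.
  apply: (@le_trans _ _ (4 ^- k * (2 * lambda * (2 ^ k * rho + d).+1%:R))).
    rewrite (eq_bigr (fun s => 4 ^- k * (f s * (nrm (s - y)%R <= 2 ^ k * rho)%N%:R))).
      rewrite -mulr_sumr ler_wpM2l ?invr_ge0 ?exprn_ge0//.
      rewrite (le_trans _ (H _))// [leRHS]big_mkcond/=.
      apply: ler_sum => s _.
      have [h|h] := boolP (nrm (s - y)%R <= 2 ^ k * rho)%N; last first.
        by rewrite mulr0; case: ifP.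
      rewrite mulr1 ifT//.
      have -> : s - z = (s - y) + (y - z) by rewrite addrA subrK.
      by rewrite (leq_trans (nrmD _ _))// leq_add.
    by move=> s _; rewrite mulrCA.
  rewrite /q -(natr1 d) -(natr1 (_ + d)%N) natrD natrM natrX le_eqVlt; apply/orP; left; apply/eqP.
  have e : 4 ^- k * 2 ^+ k = 2 ^- k :> R.
    have -> : 4 = 2 * 2 :> R by ring.
    by rewrite exprMn invfM -mulrA mulVf ?mulr1// expf_neq0.
  by rewrite -e; ring.
rewrite -mulr_sumr big_split/= -!mulr_suml.
have h1 := sum_half L; have h2 := sum_quarter L.
have r1 : 1 <= rho%:R :> R by rewrite ler1n.
have d0 : 0 <= d%:R :> R by [].
rewrite -(natr1 d).
move: h1 h2; set A := \sum_(_ < _) _; set B := \sum_(_ < _) _ => h1 h2.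
have hA : A * rho%:R <= 2 * rho%:R by rewrite ler_wpM2r.
have hB : B * (d%:R + 1) <= 2 * (d%:R + 1) by rewrite ler_wpM2r// addr_ge0.
have -> : 8 * lambda * (rho%:R + d%:R) = 2 * lambda * (4 * (rho%:R + d%:R)) by ring.
rewrite ler_wpM2l ?mulr_ge0 ?(ltW la0)//; lra.
Qed.

(** Each frequency in [[0, N)] is a difference [b - b'] of elements of [[0, 2N)] in at least [N]
    ways. Summing over all pairs instead gives a quadratic form whose kernel is the squared modulus
    of [dir N.*2]. *)
Lemma large_sieve (H : 'I_L -> C) (N : nat) :
  N%:R * \sum_(n < N) modc (\sum_t H t * chi n%:Z t) ^+ 2 <=
  \sum_t \sum_s modc (H t) * modc (H s) * modc (dir N.*2 (t - s)) ^+ 2.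
Proof.
pose F (m : int) : R := modc (\sum_t H t * chi m t) ^+ 2.
have F0 m : 0 <= F m by rewrite exprn_ge0 ?modc_ge0.
apply: (@le_trans _ _ (\sum_(b' < N.*2) \sum_(b < N.*2) F (b%:Z - b'%:Z))).
  have -> : N.*2 = (N + N)%N by rewrite addnn.
  rewrite [leRHS]big_split_ord/= -[leLHS]addr0 lerD//; last first.
    by apply: sumr_ge0 => b' _; apply: sumr_ge0.
  rewrite mulr_natl -[N in _ *+ N]card_ord -sumr_const; apply: ler_sum => b' _.
  rewrite -(big_mkord xpredT (fun n => F n%:Z)).
  rewrite -(big_mkord xpredT (fun b => F (b%:Z - b'%:Z))).
  have hb := ltn_ord b'.
  rewrite [leRHS](@big_cat_nat _ _ _ b')//=; last by lia.
  rewrite -[leLHS]add0r lerD//; first by apply: sumr_ge0.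
  rewrite [leRHS](@big_cat_nat _ _ _ (b' + N)%N)//=; [|lia|lia].
  rewrite -[leLHS]addr0 lerD//; last by apply: sumr_ge0.
  rewrite -{1}[b' : nat]add0n big_addn addKn.
  by under [leRHS]eq_bigr do rewrite PoszD addrK.
have e : (\sum_(b' < N.*2) \sum_(b < N.*2) F (b%:Z - b'%:Z))%:C =
    \sum_t \sum_s H t * conjc (H s) * (modc (dir N.*2 (t - s)) ^+ 2)%:C.
  under [RHS]eq_bigr do under eq_bigr do rewrite dir_sqr big_distrr/=.
  under [RHS]eq_bigr do rewrite exchange_big/=.
  rewrite [RHS]exchange_big/= [LHS]rmorph_sum/=.
  under [LHS]eq_bigr do rewrite rmorph_sum/=.
  rewrite [LHS]exchange_big/=; apply: eq_bigr => b _.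
  under [RHS]eq_bigr do under eq_bigr do rewrite big_distrr/=.
  under [RHS]eq_bigr do rewrite exchange_big/=.
  rewrite [RHS]exchange_big/=; apply: eq_bigr => b' _.
  rewrite /F -mulcJ rmorph_sum/= big_distrl/=; apply: eq_bigr => t _.
  rewrite big_distrr/=; apply: eq_bigr => s _.
  by rewrite rmorphM/= chiB chi_freqN mulrACA.
rewrite -[leLHS]ger0_norm; last by apply: sumr_ge0 => b' _; apply: sumr_ge0.
rewrite -modcR e (le_trans (modc_sum _ _ _))//; apply: ler_sum => t _.
rewrite (le_trans (modc_sum _ _ _))//; apply: ler_sum => s _.
by rewrite !modcM modcJ modcR ger0_norm// exprn_ge0 ?modc_ge0.
Qed.

End Kernel.

(** * Oscillation over a block of partial sums at a good point *)

Section BlockOscillation.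
Context {R : realType}.
Variable l : nat.
Local Notation L := l.+2.
Local Notation C := R[i].
Local Open Scope complex_scope.

(** Convolution with this kernel selects the frequencies [a + 1, ..., a + n]; see [shell_kernel]. *)
Definition block_kernel (a n : nat) (t : 'I_L) : C :=
  L%:R^-1 * \sum_(b < n) chi (a.+1 + b)%N%:Z t.

Lemma modc_block_kernel a n t : modc (block_kernel a n t) <= n%:R / L%:R.
Proof.
rewrite /block_kernel modcM modcV modc_nat mulrC ler_wpM2r ?invr_ge0//.
rewrite (le_trans (modc_sum _ _ _))//.
by under eq_bigr do rewrite modc_chi; rewrite sumr_const card_ord.
Qed.

Definition block_tail (a : nat) (t : 'I_L) : C :=
  L%:R^-1 * chi a.+1%:Z t / (chi 1 t - 1).

(** Summing the geometric progression splits the kernel into a part oscillating with [n] and a part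
    independent of [n]. The second part, convolved with the function away from the point, is the
    constant to subtract. *)
Lemma block_kernelE a n t : t != 0 ->
  block_kernel a n t = block_tail a t * chi n%:Z t - block_tail a t.
Proof.
move=> t0.
have h : chi 1 t - 1 != 0 :> C.
  apply/eqP => h; have := @modc_chiB1 R l t; rewrite h modc0 leNgt => /negP; apply.
  by rewrite divr_gt0 ?mulr_gt0// ltr0n lt0n nrm_eq0.
rewrite -[X in _ = _ - X]mulr1 -mulrBr -dir_geom /block_kernel /block_tail.
rewrite -[RHS]mulrA mulKf// -mulrA; congr (_ * _).
rewrite /dir big_distrr/=; apply: eq_bigr => b _.
by rewrite PoszD chi_freqD.
Qed.

Lemma modc_block_tail a t : modc (block_tail a t) <= (2 * (nrm t)%:R)^-1.
Proof.
rewrite /block_tail !modcM !modcV modc_nat modc_chi mulr1.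
(* At [t = 0] both sides vanish by the convention that the inverse of [0] is [0]. *)
have [->|t0] := eqVneq t 0.
  by rewrite chi0 subrr modc0 invr0 mulr0 nrm0 mulr0 invr0.
have h0 : 0 < 2 * (nrm t)%:R :> R by rewrite mulr_gt0// ltr0n lt0n nrm_eq0.
have h := @modc_chiB1 R l t.
have h1 : 0 < modc (chi 1 t - 1 : C) by rewrite (lt_le_trans _ h)// divr_gt0.
rewrite -invfM lef_pV2 ?posrE//; last by rewrite mulr_gt0 ?ltr0n.
by rewrite [leRHS]mulrC -ler_pdivrMr ?ltr0n.
Qed.

Section Pointwise.
Variables (f : 'I_L -> R) (lambda : R) (B : {set 'I_L}) (delta : 'I_L -> nat).
Hypothesis f0 : forall t, 0 <= f t.
Hypothesis la0 : 0 < lambda.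
Hypothesis ball : forall z, z \notin B -> forall r : nat,
  \sum_(s | (nrm (s - z)%R <= r)%N) f s <= 2 * lambda * r.+1%:R.
Hypothesis delta_near : forall y, exists2 z, z \notin B & (nrm (y - z)%R <= delta y)%N.

(** Bounding [1 / (|t| |s|)] by the mean of [1 / t ^ 2] and [1 / s ^ 2] reduces to a weight in [t]
    only. The sum over [s] is then [kern_sum] about [x - t], at the cost [rho + delta (x - t)]. The
    part with [rho] is again [kern_sum], about [x], and the part with [delta] is the assumed
    Marcinkiewicz sum. *)
Lemma far_sum (x : 'I_L) (rho : nat) : x \notin B -> (0 < rho)%N ->
  \sum_t f (x - t) * (delta (x - t))%:R / (nrm t)%:R ^+ 2 <= lambda ->
  \sum_(t | (rho <= nrm t)%N) \sum_(s | (rho <= nrm s)%N)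
     f (x - t) * f (x - s) / ((nrm t)%:R * (nrm s)%:R) * @kern R l rho (nrm (t - s))
  <= 264 * lambda ^+ 2.
Proof.
move=> xB rho0 hx.
have K0 t s : 0 <= @kern R l rho (nrm (t - s)) := kern_ge0 _ _ _.
pose A t s := f (x - t) * f (x - s) / (nrm t)%:R ^+ 2 * @kern R l rho (nrm (t - s)).
have A0 t s : 0 <= A t s by rewrite /A mulr_ge0// mulr_ge0 ?invr_ge0 ?exprn_ge0 ?mulr_ge0.
pose S := \sum_(t | (rho <= nrm t)%N) \sum_(s | (rho <= nrm s)%N) A t s.
apply: (@le_trans _ _ S).
  have -> : S = \sum_(t | (rho <= nrm t)%N) \sum_(s | (rho <= nrm s)%N)
      (A t s / 2 + A s t / 2).
    under eq_bigr do rewrite big_split/=.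
    rewrite big_split/= [X in _ = _ + X]exchange_big/= -/S.
    under eq_bigr do rewrite -mulr_suml.
    by rewrite -mulr_suml -/S -mulrDl -mulr2n -[_ *+ 2]mulr_natr mulfK.
  apply: ler_sum => t ht; apply: ler_sum => s hs.
  rewrite /A (nrmB s t) invfM -!exprVn.
  set p := (nrm t)%:R^-1; set q := (nrm s)%:R^-1; set k := kern _ _ _.
  have : 0 <= f (x - t) * f (x - s) * k * (p - q) ^+ 2.
    by rewrite mulr_ge0 ?sqr_ge0// mulr_ge0 ?K0// mulr_ge0.
  by rewrite sqrrB => h; lra.
pose d t : R := (delta (x - t))%:R.
apply: (@le_trans _ _ (\sum_(t | (rho <= nrm t)%N)
    f (x - t) / (nrm t)%:R ^+ 2 * (8 * lambda * (rho%:R + d t)))).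
  apply: ler_sum => t ht.
  apply: (@le_trans _ _ (\sum_s A t s)).
    rewrite [leRHS](bigID (fun s => (rho <= nrm s)%N))/= lerDl.
    by apply: sumr_ge0.
  have -> : \sum_s A t s = f (x - t) / (nrm t)%:R ^+ 2 *
      \sum_s f (x - s) * @kern R l rho (nrm (t - s)).
    by rewrite mulr_sumr; apply: eq_bigr => s _; rewrite /A; ring.
  rewrite ler_wpM2l ?mulr_ge0 ?invr_ge0 ?exprn_ge0//.
  have -> : \sum_s f (x - s) * @kern R l rho (nrm (t - s)) =
      \sum_s f s * @kern R l rho (nrm (s - (x - t))).
    rewrite -[RHS](sum_rev _ x); apply: eq_bigr => s _.
    by rewrite opprB [in RHS]addrCA [in RHS]addrAC subrr add0r.
  have [z zB hz] := delta_near (x - t).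
  exact: kern_sum f0 la0 rho0 hz (ball zB).
have hf t : 0 <= f (x - t) / (nrm t)%:R ^+ 2.
  by rewrite mulr_ge0 ?invr_ge0 ?exprn_ge0.
have -> : \sum_(t | (rho <= nrm t)%N)
    f (x - t) / (nrm t)%:R ^+ 2 * (8 * lambda * (rho%:R + d t)) =
  8 * lambda * (rho%:R * \sum_(t | (rho <= nrm t)%N) f (x - t) / (nrm t)%:R ^+ 2 +
    \sum_(t | (rho <= nrm t)%N) f (x - t) * d t / (nrm t)%:R ^+ 2).
  rewrite mulr_sumr -big_split mulr_sumr; apply: eq_bigr => t _ /=.
  by rewrite [f _ * d t]mulrC; ring.
(* The factor [32] is [4] from [kern_ge] times [8] from [kern_sum], and [264 = 8 * (32 + 1)]. *)
have h1 : rho%:R * \sum_(t | (rho <= nrm t)%N) f (x - t) / (nrm t)%:R ^+ 2 <= 32 * lambda.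
  have r0 : 0 < rho%:R :> R by rewrite ltr0n.
  have xx : (nrm (x - x)%R <= 0)%N by rewrite subrr nrm0.
  have := kern_sum f0 la0 rho0 xx (ball xB).
  rewrite -(sum_rev _ x) addr0 => h.
  rewrite -(ler_pM2l r0) mulrA -expr2.
  rewrite (le_trans _ (_ : 4 * (8 * lambda * rho%:R) <= _))//; last by lra.
  rewrite (le_trans _ (ler_wpM2l _ h))// !mulr_sumr.
  rewrite [leRHS](bigID (fun t => (rho <= nrm t)%N))/= -[leLHS]addr0 lerD//.
    apply: ler_sum => t ht.
    have n0 : 0 < (nrm t)%:R :> R by rewrite ltr0n (leq_trans rho0).
    rewrite [leRHS]mulrCA [leLHS]mulrCA ler_wpM2l//.
    rewrite addrAC subrr add0r nrmN; apply: kern_ge => //; first exact: nrm_lt.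
      rewrite divr_ge0 ?exprn_ge0//= ler_pdivrMr ?exprn_gt0// mul1r.
      by rewrite lerXn2r ?nnegrE// ler_nat.
    by rewrite divfK// expf_neq0// gt_eqF.
  by apply: sumr_ge0 => t _; rewrite mulr_ge0// mulr_ge0// kern_ge0.
have h2 : \sum_(t | (rho <= nrm t)%N) f (x - t) * d t / (nrm t)%:R ^+ 2 <= lambda.
  rewrite (le_trans _ hx)// [leRHS](bigID (fun t => (rho <= nrm t)%N))/= lerDl.
  by apply: sumr_ge0 => t _; rewrite mulr_ge0 ?invr_ge0 ?exprn_ge0 ?mulr_ge0.
rewrite (_ : 264 * _ = 8 * lambda * (32 * lambda + lambda)); last by ring.
by rewrite ler_wpM2l ?mulr_ge0 ?(ltW la0)// lerD.
Qed.

(** Near the point the kernel is at most [N / L] on a ball of radius about [L / N], which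
    contributes [8 lambda] for each [n]. The oscillating far part is bounded in mean square by
    [large_sieve] and [far_sum], and [r <= lambda + r ^ 2 / lambda] returns to first powers:
    [8 + 1 + 4 * 264 <= 1100]. Only moduli of the kernel enter, so nothing depends on [a]. *)
Lemma block_oscillation (G : 'I_L -> C) (x : 'I_L) (a N : nat) :
  (forall t, modc (G t) = f t) -> x \notin B -> (0 < N <= L)%N ->
  \sum_t f (x - t) * (delta (x - t))%:R / (nrm t)%:R ^+ 2 <= lambda ->
  exists z, \sum_(n < N) modc (\sum_t G (x - t) * block_kernel a n t - z) <=
    1100 * lambda * N%:R.
Proof.
move=> Gf xB /andP[N0 NL] hx.
(* The scale resolved by [N] frequencies. The successor gives [L <= N rho <= 2 L]. *)
pose rho := (L %/ N).+1.
have rho0 : (0 < rho)%N by [].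
have hL1 : (L <= N * rho)%N by rewrite mulnC ltnW// -ltn_divLR.
have hL2 : (N * rho <= 2 * L)%N.
  by rewrite /rho mulnS mulnC; have := leq_divM L N; lia.
have N0' : 0 < N%:R :> R by rewrite ltr0n.
pose H t : C := if (rho <= nrm t)%N then G (x - t) * block_tail a t else 0.
exists (- \sum_t H t).
pose Rn n : C := \sum_t H t * chi n%:Z t.
have step (n : 'I_N) :
    modc (\sum_t G (x - t) * block_kernel a n t - - \sum_t H t) <=
    8 * lambda + modc (Rn n).
  rewrite opprK -big_split/=.
  have -> : \sum_t (G (x - t) * block_kernel a n t + H t) =
    \sum_(t | (nrm t < rho)%N) G (x - t) * block_kernel a n t + Rn n.
    rewrite [X in _ = X + _]big_mkcond -big_split; apply: eq_bigr => t _ /=; rewrite /H.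
    rewrite ltnNge; case: ifPn => h /=; last by rewrite mul0r !addr0.
    rewrite add0r block_kernelE; last by rewrite -nrm_eq0 -lt0n (leq_trans rho0).
    by rewrite mulrBr subrK mulrA.
  rewrite (le_trans (modcD _ _))// lerD2r.
  rewrite (le_trans (modc_sum _ _ _))//.
  apply: (@le_trans _ _ (\sum_(t | (nrm t < rho)%N) f (x - t) * (N%:R / L%:R))).
    apply: ler_sum => t _; rewrite modcM Gf ler_wpM2l//.
    rewrite (le_trans (modc_block_kernel _ _ _))//.
    by rewrite ler_wpM2r ?invr_ge0// ler_nat ltnW.
  rewrite -mulr_suml.
  have h : \sum_(t | (nrm t < rho)%N) f (x - t) <= 2 * lambda * rho.+1%:R.
    rewrite (le_trans _ (ball xB rho))// [leRHS]big_mkcond [leLHS]big_mkcond/=.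
    rewrite -[leRHS](sum_rev _ x); apply: ler_sum => t _.
    rewrite addrAC subrr add0r nrmN; case: ifP => [h|_]; first by rewrite (ltnW h).
    by case: ifP.
  rewrite (le_trans (ler_wpM2r _ h))// mulrA ler_pdivrMr ?L_gt0//.
  have e : rho.+1%:R * N%:R <= 4 * L%:R :> R.
    by rewrite -!natrM ler_nat; nia.
  have -> : 8 * lambda * L%:R = 2 * lambda * (4 * L%:R) by ring.
  by rewrite -[leLHS]mulrA ler_wpM2l// mulr_ge0 ?(ltW la0).
apply: (le_trans (ler_sum _ (fun n _ => step n))).
rewrite big_split/= sumr_const card_ord.
have sq : \sum_(n < N) modc (Rn n) ^+ 2 <= 1056 * lambda ^+ 2 * N%:R.
  rewrite -(ler_pM2l N0') (le_trans (large_sieve H N))//.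
  apply: (@le_trans _ _ (4 * N%:R ^+ 2 * (264 * lambda ^+ 2))); last by lra.
  rewrite (le_trans _ (ler_wpM2l _ (far_sum xB rho0 hx))) ?mulr_ge0 ?exprn_ge0//.
  rewrite mulr_sumr [leRHS]big_mkcond; apply: ler_sum => t _ /=.
  case: ifPn => ht; last first.
    by rewrite big1// => s _; rewrite /H (negbTE ht) modc0 !mul0r.
  rewrite mulr_sumr [leRHS]big_mkcond; apply: ler_sum => s _ /=.
  case: ifPn => hs; last by rewrite /H (negbTE hs) modc0 mulr0 mul0r.
  rewrite /H ht hs (modcM _ (block_tail a t)) (modcM _ (block_tail a s)) !Gf.
  have D : modc (@dir R l N.*2 (t - s)) ^+ 2 <= 16 * N%:R ^+ 2 * @kern R l rho (nrm (t - s)).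
    have c0 : 0 < 4 * N%:R ^+ 2 :> R by rewrite mulr_gt0// exprn_gt0.
    have := @modc_dir R l N.*2 (t - s); have := @modc_dir_nrm R l N.*2 (t - s).
    have := modc_ge0 (@dir R l N.*2 (t - s)).
    set D := modc _ => D0 hD1 hD2.
    rewrite -mul2n natrM in hD2.
    have hD3 : D * (nrm (t - s))%:R <= N%:R * rho%:R.
      by rewrite (le_trans hD1)// -natrM ler_nat.
    suff : D ^+ 2 / (4 * N%:R ^+ 2) <= 4 * @kern R l rho (nrm (t - s)).
      by rewrite ler_pdivrMr// => h; lra.
    (* Here [x] is [D ^ 2 / (4 N ^ 2)]: it is at most [1] by the trivial bound on the Dirichlet sum
       and decays by [D * |t - s| <= L <= N rho]. *)
    apply: kern_ge => //; first exact: nrm_lt.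
      rewrite divr_ge0 ?exprn_ge0 ?(ltW c0)//= ler_pdivrMr// mul1r.
      by have := lerXn2r 2 (D0 : D \is Num.nneg) (_ : 2 * N%:R \is Num.nneg) hD2;
        rewrite nnegrE mulr_ge0// exprMn => /(_ isT); lra.
    rewrite mulrAC ler_pdivrMr// -exprMn.
    have := lerXn2r 2 (_ : D * (nrm (t - s))%:R \is Num.nneg)
      (_ : N%:R * rho%:R \is Num.nneg) hD3.
    rewrite !nnegrE !mulr_ge0// => /(_ isT isT) h; rewrite (le_trans h)//.
    rewrite exprMn mulrC ler_wpM2l ?exprn_ge0//.
    by rewrite ler_peMl ?exprn_ge0// ler1n.
  set k := kern _ _ _ in D *.
  set T1 := modc (block_tail _ _); set T2 := modc (block_tail _ _).
  have hT1 : T1 <= (2 * (nrm t)%:R)^-1 by exact: modc_block_tail.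
  have hT2 : T2 <= (2 * (nrm s)%:R)^-1 by exact: modc_block_tail.
  have hT : T1 * T2 <= (4 * ((nrm t)%:R * (nrm s)%:R))^-1.
    rewrite (le_trans (ler_pM _ _ hT1 hT2)) ?modc_ge0// -invfM.
    by rewrite le_eqVlt; apply/orP; left; apply/eqP; congr (_^-1); ring.
  rewrite (_ : _ * _ = f (x - t) * f (x - s) * ((T1 * T2) * modc (dir N.*2 (t - s)) ^+ 2)); last by ring.
  rewrite (_ : 4 * _ * _ = f (x - t) * f (x - s) *
    ((4 * ((nrm t)%:R * (nrm s)%:R))^-1 * (16 * N%:R ^+ 2 * k))); last first.
    by field; rewrite !pnatr_eq0 -!lt0n !(leq_trans rho0).
  rewrite ler_wpM2l ?mulr_ge0// ler_pM ?mulr_ge0 ?modc_ge0 ?exprn_ge0 ?modc_ge0//.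
have AG n : modc (Rn n) <= lambda + modc (Rn n) ^+ 2 / lambda.
  rewrite -lerBlDl ler_pdivlMr//.
  have := modc_ge0 (Rn n); set r := modc _ => r0; nra.
apply: (@le_trans _ _ (8 * lambda *+ N + (lambda *+ N + 1056 * lambda * N%:R))).
  rewrite lerD2l; apply: (le_trans (ler_sum _ (fun (n : 'I_N) _ => AG n))).
  rewrite big_split/=.
  rewrite sumr_const card_ord lerD2l -mulr_suml ler_pdivrMr//.
  by rewrite (le_trans sq)//; lra.
rewrite -(mulr_natr (8 * lambda)) -(mulr_natr lambda); have := mulr_gt0 la0 N0'; lra.
Qed.

End Pointwise.
End BlockOscillation.

(** * Weak type (1,1) of block oscillation in one variable *)

Section WeakType.
Context {R : realType}.
Variable l : nat.
Local Notation L := l.+2.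
Local Notation C := R[i].
Local Open Scope complex_scope.

(** By telescoping, as [1 / v ^ 2 <= 2 / v - 2 / (v + 1)]. *)
Lemma sum_inv_sqr d n : (0 < d)%N ->
  \sum_(d <= v < n) (v%:R ^- 2 : R) <= 2 / d%:R.
Proof.
move=> d0.
have [nd|dn] := leqP n d; first by rewrite big_geq// divr_ge0.
suff h : \sum_(d <= v < n) (v%:R ^- 2 : R) <= 2 / d%:R - 2 / n%:R.
  by rewrite (le_trans h)// lerBlDr lerDl divr_ge0.
elim: n dn => // n IH; rewrite ltnS leq_eqVlt => /orP[/eqP <-|dn].
  have d0' : 0 < d%:R :> R by rewrite ltr0n.
  have d1 : 1 <= d%:R :> R by rewrite ler1n.
  rewrite big_nat1 -(natr1 d).
  rewrite (_ : _ - _ = 2 / (d%:R * (d%:R + 1))); last first.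
    by field; rewrite !gt_eqF// addr_gt0.
  rewrite ler_pdivlMr ?mulr_gt0 ?addr_gt0// mulrC ler_pdivrMr ?exprn_gt0//; nra.
rewrite big_nat_recr ?(ltnW dn)//= (le_trans (lerD (IH dn) (lexx _)))//.
have n0 : 0 < n%:R :> R by rewrite ltr0n (ltn_trans d0).
have n1 : 1 <= n%:R :> R by rewrite ler1n (ltn_trans d0).
rewrite -addrA lerD2l -(natr1 n).
have -> : - (2 / (n%:R + 1)) = - (2 / n%:R) + 2 / (n%:R * (n%:R + 1)) :> R.
  by field; rewrite !gt_eqF// addr_gt0.
rewrite lerD2l ler_pdivlMr ?mulr_gt0 ?addr_gt0// mulrC ler_pdivrMr ?exprn_gt0//; nra.
Qed.

Lemma nrm_tail (d : nat) : (0 < d)%N ->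
  \sum_(t : 'I_L | (d <= nrm t)%N) ((nrm t)%:R ^- 2 : R) <= 4 / d%:R.
Proof.
move=> d0.
pose F (v : nat) : R := if (d <= v)%N then v%:R ^- 2 else 0.
have F0 v : 0 <= F v by rewrite /F; case: ifP => // _; rewrite invr_ge0 exprn_ge0.
have S n : \sum_(t < n) F t <= 2 / d%:R.
  rewrite -(big_mkord xpredT F) /F.
  have [Ld|dL] := leqP n d.
    rewrite big_nat_cond big1 ?divr_ge0// => i; rewrite andbT => /andP[_ iL].
    by rewrite ifF//; apply/negbTE; rewrite -ltnNge (leq_trans iL).
  rewrite (@big_cat_nat _ _ _ d)//= ?(ltnW dL)// big_nat_cond big1 ?add0r.
    rewrite big_nat_cond (eq_bigr (fun v => v%:R ^- 2)); last first.
      by move=> i; rewrite andbT => /andP[-> _].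
    by rewrite -big_nat_cond sum_inv_sqr.
  by move=> i; rewrite andbT => /andP[_ iL]; rewrite leqNgt iL.
have S2 : \sum_(t < L) F (L - t)%N <= 2 / d%:R.
  rewrite (reindex_inj rev_ord_inj)/=.
  rewrite (eq_bigr (fun i : 'I_L => F (lift ord0 i))); last first.
    by move=> i _; congr F; rewrite /= /bump/=; have := ltn_ord i; lia.
  by rewrite (le_trans _ (S L.+1))// [leRHS]big_ord_recl lerDr.
rewrite (_ : 4 = 2 + 2); last by ring.
rewrite mulrDl (le_trans _ (lerD (S L) S2))// -big_split/= big_mkcond/=.
apply: ler_sum => t _; rewrite -/(F (nrm t)).
have [->|->] : nrm t = t \/ nrm t = (L - t)%N.
- by rewrite /nrm /minn; case: ifP; [left|right].
- by rewrite lerDl.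
- by rewrite lerDr.
Qed.

(** The Marcinkiewicz integral. After exchanging sums, a mass at [s] is seen only from good points,
    all at distance at least [delta s]; there the inverse squares add up to at most [4 / delta s],
    which cancels the weight [delta s]. *)
Lemma weak_marcinkiewicz (f : 'I_L -> R) (B : {set 'I_L}) (delta : 'I_L -> nat) :
  (forall t, 0 <= f t) ->
  (forall y z, z \notin B -> (delta y <= nrm (y - z)%R)%N) ->
  \sum_(x | x \notin B) \sum_t f (x - t) * (delta (x - t))%:R / (nrm t)%:R ^+ 2 <=
  4 * \sum_t f t.
Proof.
move=> f0 hd.
under eq_bigr => x _.
  rewrite -(sum_rev _ x).
  under eq_bigr do rewrite opprB addrCA subrr addr0.
  over.
rewrite exchange_big/= mulr_sumr; apply: ler_sum => s _.
rewrite -mulr_sumr.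
have [->|d0] := posnP (delta s); first by rewrite mulr0 mul0r mulr_ge0.
have dp : 0 < (delta s)%:R :> R by rewrite ltr0n.
rewrite (le_trans (_ : _ <= f s * (delta s)%:R * (4 / (delta s)%:R)))//.
  rewrite ler_wpM2l ?mulr_ge0// (le_trans _ (nrm_tail d0))//.
  rewrite [leLHS]big_mkcond [leRHS]big_mkcond/= -[leRHS](sum_rev _ s).
  apply: ler_sum => x _; case: ifPn => [xB|_].
    by rewrite hd// nrmB.
  by case: ifP => // _; rewrite invr_ge0 exprn_ge0.
by rewrite -mulrA [_ * (4 / _)]mulrCA divff ?mulr1 ?gt_eqF// mulrC.
Qed.

Section TrigPoly.
Variables (I : finType) (fr : I -> int) (c : I -> C).

Definition trig (t : 'I_L) : C := \sum_i c i * chi (fr i) t.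

Definition shell (a n : nat) (t : 'I_L) : C :=
  \sum_(i | (a%:Z < fr i <= (a + n)%N%:Z)%R) c i * chi (fr i) t.

(** The frequencies [a + 1, ..., a + n] and the [fr i] differ by less than [L], so no aliasing
    occurs. *)
Lemma shell_kernel (D a n : nat) x : (forall i, (`|fr i| <= D)%N) ->
  (a + n + D < L)%N ->
  \sum_t trig (x - t) * block_kernel a n t = shell a n x.
Proof.
move=> frD hL.
under eq_bigr do rewrite /trig big_distrl/=.
rewrite exchange_big/= /shell [RHS]big_mkcond/=; apply: eq_bigr => i _.
have E t : c i * chi (fr i) (x - t) * block_kernel a n t =
    c i * chi (fr i) x * (L%:R^-1 * \sum_(b < n) chi ((a.+1 + b)%N%:Z - fr i) t).
  rewrite chiB /block_kernel -!mulrA; congr (_ * (_ * _)).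
  rewrite mulrCA; congr (_ * _); rewrite big_distrr/=; apply: eq_bigr => b _.
  by rewrite -chi_freqD addrC.
under eq_bigr do rewrite E.
rewrite -mulr_sumr -mulr_sumr exchange_big/=.
have L0 : L%:R != 0 :> C by rewrite pnatr_eq0.
have S (b : 'I_n) : \sum_(t : 'I_L) chi ((a.+1 + b)%N%:Z - fr i) t =
    L%:R *+ ((a.+1 + b)%N%:Z == fr i) :> C.
  rewrite sum_chiE; first by rewrite subr_eq0.
  by have := frD i; have := ltn_ord b; lia.
under eq_bigr do rewrite S.
case: ifPn => h.
  have hb : (`|fr i| - a.+1 < n)%N by lia.
  rewrite (bigD1 (Ordinal hb))//= big1 ?addr0.
    rewrite (_ : (_ == _) = true) ?mulr1n ?mulVf ?mulr1//.
    by apply/eqP; move: hb h; lia.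
  move=> j; rewrite -val_eqE/= => hj.
  by rewrite (_ : (_ == _) = false)//; apply/eqP; move: hj h; lia.
rewrite big1 ?mulr0// => j _; rewrite (_ : (_ == _) = false)//.
by apply/eqP; have := ltn_ord j; move: h; lia.
Qed.

(** The exceptional set joins the set [B] of [maximal] to the good points where the Marcinkiewicz
    sum exceeds [lambda], with [delta] the distance to the complement of [B]; hence [6 = 2 + 4]. It
    is fixed before [a] and [N]. If [B] is everything there is no point left to treat. *)
Theorem weak_block_oscillation (D N1 : nat) (lambda : R) :
  (forall i, (`|fr i| <= D)%N) -> (N1 + D < L)%N -> 0 < lambda ->
  exists B : {set 'I_L}, lambda * #|B|%:R <= 6 * \sum_t modc (trig t) /\
    forall x, x \notin B -> forall a N : nat, (a + N <= N1)%N ->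
      exists z, \sum_(n < N) modc (shell a n x - z) <= 1100 * lambda * N%:R.
Proof.
move=> frD hL la0.
pose f t := modc (trig t).
have f0 t : 0 <= f t by exact: modc_ge0.
have [B [hB ball]] := maximal f0 la0.
have [/existsP[x0 x0B]|noB] := boolP [exists x, x \notin B]; last first.
  exists B; split.
    by rewrite (le_trans hB)// ler_wpM2r ?sumr_ge0//; lra.
  move=> x xB; exfalso; move/negP: noB; apply; apply/existsP; by exists x.
pose near y := [arg min_(z < x0 | z \notin B) nrm (y - z)%R].
pose delta y := nrm (y - near y).
have nearP y : near y \notin B /\ forall z, z \notin B -> (delta y <= nrm (y - z)%R)%N.
  rewrite /delta /near; case: arg_minnP => // z zB hz; split => //.
pose M x := \sum_t f (x - t) * (delta (x - t))%:R / (nrm t)%:R ^+ 2.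
pose B2 := [set x | (x \notin B) && (lambda < M x)]%SET.
exists (B :|: B2)%SET; split.
  have h2 : lambda * #|B2|%:R <= 4 * \sum_t f t.
    rewrite (le_trans _ (weak_marcinkiewicz f0 (fun y => (nearP y).2)))//.
    rewrite [leRHS](bigID (mem B2))/= -[leLHS]addr0 lerD//; last first.
      apply: sumr_ge0 => x _; apply: sumr_ge0 => t _.
      by rewrite mulr_ge0 ?invr_ge0 ?exprn_ge0 ?mulr_ge0.
    rewrite mulr_natr -sumr_const.
    rewrite (eq_bigl (fun x => (x \notin B) && (x \in B2))); last first.
      by move=> x /=; rewrite inE andbA andbb.
    by apply: ler_sum => x; rewrite inE => /and3P[_ _ /ltW].
  have hc : #|B :|: B2|%:R <= #|B|%:R + #|B2|%:R :> R.
    by rewrite -natrD ler_nat cardsU leq_subr.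
  rewrite (le_trans (ler_wpM2l (ltW la0) hc))// mulrDr.
  by rewrite (le_trans (lerD hB h2))// /f; lra.
move=> x; rewrite inE negb_or => /andP[xB]; rewrite inE xB/= -leNgt => Mx a N aN.
have [->|N0] := posnP N.
  by exists 0; rewrite big_ord0 mulr0.
have dn y : exists2 z, z \notin B & (nrm (y - z)%R <= delta y)%N.
  by exists (near y) => //; exact: (nearP y).1.
have NL : (0 < N <= L)%N by lia.
have [z hz] := @block_oscillation R l f lambda B delta f0 la0 ball dn trig x a N
  (fun=> erefl) xB NL Mx.
exists z; rewrite (le_trans _ hz)//; apply: ler_sum => n _.
by rewrite (@shell_kernel D)//; have := ltn_ord n; lia.
Qed.

End TrigPoly.
End WeakType.

(** * Exponential integrability of the conjugate function *)

Section Zygmund.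
Context {R : realType}.
Local Notation C := R[i].
Local Open Scope complex_scope.

Lemma young_logp (a b : R) : 0 <= a -> 0 <= b -> a * b <= a * logp a + expR b.
Proof.
move=> a0 b0; rewrite /logp; have ex := expR_ge1Dx.
case: ifPn => [a1|]; last first.
  rewrite -leNgt => a1; rewrite mulr0 add0r (le_trans (ler_wpM2r b0 a1))// mul1r.
  by rewrite (le_trans _ (ex _ _))// lerDr.
have ap : 0 < a by exact: lt_trans a1.
have -> : expR b = a * expR (b - ln a) by rewrite expRD expRN lnK ?posrE// mulrCA divff ?mulr1 ?gt_eqF.
rewrite -lerBlDl -mulrBr ler_wpM2l// (le_trans _ (ex _ _))//; lra.
Qed.

Lemma expR_le_inv (x : R) : x < 1 -> expR x <= (1 - x)^-1.
Proof.
move=> x1; rewrite -[expR x]invrK lef_pV2 ?posrE ?invr_gt0 ?expR_gt0//; last by lra.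
by rewrite -expRN (le_trans _ (expR_ge1Dx _)).
Qed.

Lemma pow1D_expR (x : R) n : 0 <= 1 + x -> (1 + x) ^+ n <= expR (n%:R * x).
Proof.
by move=> x0; rewrite expRM_natl lerXn2r ?nnegrE ?expR_ge0// expR_ge1Dx.
Qed.

Lemma expR_half_pow (x : R) n : 0 <= x <= 1 -> expR (n%:R * x / 2) <= (1 + x) ^+ n.
Proof.
move=> /andP[x0 x1]; rewrite -mulrA expRM_natl lerXn2r ?nnegrE ?expR_ge0 ?addr_ge0//.
rewrite (le_trans (expR_le_inv _))//; first by lra.
rewrite -div1r ler_pdivrMr; last by lra.
nra.
Qed.

(** With [s = t / a], the [n]-th power of [1 + i s] differs from [1] by at most [(1 + |s|) ^ n - 1],
    which is at most [exp(1/4) - 1 <= 1/3]. *)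
Lemma Re_pow_ge (a t : R) n : (0 < n)%N -> 0 < a -> `|t| <= a / (4 * n%:R) ->
  2 / 3 * a ^+ n <= complex.Re ((a +i* t) ^+ n).
Proof.
move=> n0 a0 ht; have n0' : 0 < n%:R :> R by rewrite ltr0n.
pose s := t / a; have hs : `|s| <= (4 * n%:R)^-1.
  by rewrite normrM normfV (gtr0_norm a0) ler_pdivrMr// mulrC.
pose z : C := 1 +i* s.
have -> : a +i* t = a%:C * z.
  by apply: complexP; rewrite /= !(mul0r, mulr0, mulr1, subr0, addr0)// mulrC divfK ?gt_eqF.
rewrite exprMn -rmorphXn/= ReZ mulrC ler_wpM2l ?exprn_ge0 ?(ltW a0)//.
have zB : modc (z - 1) = `|s|.
  by rewrite /modc /z /= subrr oppr0 addr0 expr0n/= add0r sqrtr_sqr.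
have zn : modc z <= 1 + `|s|.
  by rewrite -[z](subrK 1) (le_trans (modcD _ _))// zB modc1 addrC.
have H : modc (z ^+ n - 1) <= (1 + `|s|) ^+ n - 1.
  rewrite subrX1 [leRHS]subrX1 modcM zB addrAC subrr add0r ler_wpM2l//.
  rewrite (le_trans (modc_sum _ _ _))//; apply: ler_sum => i _.
  by rewrite modcX lerXn2r ?nnegrE ?modc_ge0 ?addr_ge0.
have H2 : (1 + `|s|) ^+ n <= 4 / 3.
  rewrite (le_trans (pow1D_expR _ _)) ?addr_ge0// (le_trans (_ : _ <= expR (1 / 4)))//.
    rewrite ler_expR (le_trans (ler_wpM2l _ hs))//.
    by rewrite [leLHS](_ : _ = 1 / 4)//; field; rewrite gt_eqF.
  have h4 : 1 / 4 < 1 :> R by lra.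
  apply: (le_trans (expR_le_inv h4)).
  have -> : 1 - 1 / 4 = 3 / 4 :> R by field.
  by rewrite invf_div.
move: (le_trans (Re_modc _) H); rewrite ReD ReN [complex.Re 1]/=.
move: H2; set P := _ ^+ n; set Q := complex.Re _ => H2 /ler_normlP[h _].
by lra.
Qed.

Variable l : nat.
Local Notation L := l.+2.

Lemma dir_sqr_expand K (t : 'I_L) :
  modc (@dir R l K t) ^+ 2 =
  K%:R + \sum_(1 <= b < K) (K - b)%:R * (2 * complex.Re (@chi R l b%:Z t)).
Proof.
elim: K => [|K IH].
  by rewrite /dir big_ord0 modc0 expr0n/= big_geq// addr0.
have -> : modc (@dir R l K.+1 t) ^+ 2 = modc (@dir R l K t) ^+ 2 + 1 +
    \sum_(1 <= b < K.+1) 2 * complex.Re (@chi R l b%:Z t).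
  rewrite {1}/dir big_ord_recr -/(dir K t).
  have -> : forall z w : C, modc (z + w) ^+ 2 =
      modc z ^+ 2 + modc w ^+ 2 + 2 * complex.Re (w * conjc z).
    move=> z w; rewrite !modc_sqr; case: z w => [a b] [c d] /=; ring.
  rewrite modc_chi expr1n; congr (_ + _).
  rewrite -mulr_sumr. rewrite -Re_sum; congr (2 * complex.Re _).
  rewrite /dir rmorph_sum mulr_sumr big_nat_rev big_add1 add1n big_mkord.
  apply: eq_bigr => b _.
  rewrite -[RHS](_ : chi K%:Z t * conjc (chi b%:Z t) = _)//.
  rewrite -chi_freqN -chi_freqD; congr (chi _ _).
  by rewrite !subSS subzn// ltnW// (ltn_ord b).
rewrite IH -!addrA -(natr1 K) -addrA; congr (_ + _); rewrite addrCA; congr (_ + _).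
have -> : \sum_(1 <= b < K) (K - b)%:R * (2 * complex.Re (@chi R l b%:Z t)) =
    \sum_(1 <= b < K.+1) (K - b)%:R * (2 * complex.Re (@chi R l b%:Z t)).
  have [->|K0] := posnP K; first by rewrite !big_geq.
  by rewrite [RHS]big_nat_recr//= subnn mul0r addr0.
rewrite -big_split/=; apply: eq_big_nat => b /andP[b1 bK].
by rewrite subSn// -(natr1 (K - b)%N); ring.
Qed.

(** The discrete mean value property: the [L]-th roots of unity average every power from [1] to
    [L - 1] to zero. *)
Lemma mean_horner (p : {poly C}) : (size p <= L)%N ->
  \sum_(t : 'I_L) p.[chi 1 t] = L%:R * p`_0.
Proof.
move=> pL.
under eq_bigr => t _ do rewrite (horner_coef_wide _ pL).
rewrite exchange_big/= big_ord_recl/= [X in _ + X]big1 ?addr0.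
  by under eq_bigr do rewrite expr0 mulr1; rewrite sumr_const card_ord mulr_natl.
move=> i _; rewrite -mulr_sumr.
under eq_bigr do rewrite -chi_freqX.
rewrite sum_chi ?mulr0//=.
by have := ltn_ord i; rewrite /bump/=; lia.
Qed.

Section Duality.
Variables (D : nat) (phi : 'I_L -> R).
Hypothesis D0 : (0 < D)%N.
Hypothesis DL : (8 * D ^ 2 <= L)%N.
Hypothesis phi1 : forall t, `|phi t| <= 1.

(** De la Vallée Poussin weights. The truncated subtractions make them equal to [1] up to [D],
    linear from [D] to [2 D], and [0] beyond. *)
Definition vp (b : nat) : R := ((D.*2 - b) - (D - b))%:R / D%:R.

Lemma vp_itv b : 0 <= vp b <= 1.
Proof.
clear DL phi1.
rewrite /vp divr_ge0//= ler_pdivrMr ?ltr0n// mul1r ler_nat; lia.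
Qed.

Lemma vp1 b : (b <= D)%N -> vp b = 1.
Proof.
clear DL phi1.
by move=> bD; rewrite /vp (_ : (_ - _)%N = D) ?divff ?pnatr_eq0 -?lt0n//; lia.
Qed.

Definition coef (b : nat) : C := L%:R^-1 * \sum_t (phi t)%:C * chi (- b%:Z) t.

Lemma modc_coef b : modc (coef b) <= 1.
Proof.
rewrite modcM modcV modc_nat ler_pdivrMl ?ltr0n// mulr1.
rewrite (le_trans (modc_sum _ _ _))// (le_trans (_ : _ <= \sum_(t : 'I_L) 1))//.
  by apply: ler_sum => t _; rewrite modcM modcR modc_chi mulr1.
by rewrite sumr_const card_ord.
Qed.

Definition analytic (s : 'I_L) : C :=
  \sum_(1 <= b < D.*2) (vp b)%:C * coef b * chi b%:Z s.

Definition vpk (t : 'I_L) : R :=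
  (modc (@dir R l D.*2 t) ^+ 2 - modc (@dir R l D t) ^+ 2) / D%:R.

Lemma vpkE t : vpk t = 1 + \sum_(1 <= b < D.*2) vp b * (2 * complex.Re (@chi R l b%:Z t)).
Proof.
have Dn0 : D%:R != 0 :> R by rewrite pnatr_eq0 -lt0n.
rewrite /vpk !dir_sqr_expand.
have -> : \sum_(1 <= b < D) (D - b)%:R * (2 * complex.Re (@chi R l b%:Z t)) =
    \sum_(1 <= b < D.*2) (D - b)%:R * (2 * complex.Re (@chi R l b%:Z t)).
  rewrite [RHS](@big_cat_nat _ _ _ D)//=; last by lia.
  rewrite [X in _ = _ + X]big_nat_cond [X in _ = _ + X]big1 ?addr0// => b.
  by rewrite andbT => /andP[Db _]; rewrite (_ : D - b = 0)%N ?mul0r//; lia.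
rewrite opprD addrACA -sumrB mulrDl; congr (_ + _).
  by rewrite -mul2n natrM; field.
rewrite mulr_suml; apply: eq_big_nat => b /andP[b1 bD].
by rewrite -mulrBl -natrB ?leq_sub2r -?addnn ?leq_addr// addnn /vp mulrAC.
Qed.

Lemma sum_vpk : \sum_(t : 'I_L) `|vpk t| <= 3 * L%:R.
Proof.
have D0' : 0 < D%:R :> R by rewrite ltr0n.
have S K : (K.*2 <= L)%N -> \sum_(t : 'I_L) modc (@dir R l K t) ^+ 2 = (L * K)%:R.
  move=> KL; apply: (@complexI R); rewrite rmorph_sum rmorph_nat/=.
  have := @fejer_coef R l K 0 KL isT; rewrite subn0 => <-.
  by apply: eq_bigr => t _; rewrite chi_freq0 mulr1.
apply: (@le_trans _ _ (\sum_(t : 'I_L)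
   (modc (@dir R l D.*2 t) ^+ 2 + modc (@dir R l D t) ^+ 2) / D%:R)).
  apply: ler_sum => t _; rewrite /vpk normrM normfV (gtr0_norm D0') ler_wpM2r ?invr_ge0 ?(ltW D0')//.
  by rewrite (le_trans (ler_normB _ _))// !ger0_norm ?exprn_ge0 ?modc_ge0.
rewrite -mulr_suml big_split/= !S; [|nia|nia].
by rewrite -natrD ler_pdivrMr// -!natrM ler_nat; lia.
Qed.

(** A polynomial in [chi 1 s] whose real part is the de la Vallée Poussin mean of [phi], bounded by
    [3], and whose imaginary part is the conjugate function to be estimated. *)
Definition holo (s : 'I_L) : C := coef 0 + 2 * analytic s.

Lemma Re_holo s : `|complex.Re (holo s)| <= 3.
Proof.
have Ln0 : L%:R != 0 :> R by rewrite pnatr_eq0.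
have -> : complex.Re (holo s) = L%:R^-1 * \sum_t phi t * vpk (s - t).
  have ReL (z : C) : complex.Re (L%:R^-1 * z) = L%:R^-1 * complex.Re z.
    by rewrite -(rmorph_nat (real_complex R)) -fmorphV ReZ.
  rewrite /holo ReD.
  have -> : complex.Re (2 * analytic s) = 2 * complex.Re (analytic s).
    by rewrite -(rmorph_nat (real_complex R)) ReZ.
  rewrite /coef ReL Re_sum.
  have -> : \sum_t complex.Re ((phi t)%:C * chi (- 0) t) = \sum_t phi t.
    by apply: eq_bigr => t _; rewrite oppr0 chi_freq0 mulr1.
  under [X in _ = _ * X]eq_bigr do rewrite vpkE mulrDr mulr1.
  rewrite big_split mulrDr; congr (_ + _).
  under [X in _ = _ * X]eq_bigr do rewrite mulr_sumr.
  rewrite exchange_big mulr_sumr /analytic Re_sum mulr_sumr; apply: eq_bigr => b _.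
  have -> : (vp b)%:C * coef b * chi b%:Z s =
      (vp b)%:C * (L%:R^-1 * \sum_t (phi t)%:C * chi b%:Z (s - t)).
    rewrite /coef -!mulrA big_distrl; congr (_ * (_ * _)); apply: eq_bigr => t _.
    by rewrite /= -mulrA (mulrC (chi _ _)) -chiB.
  rewrite ReZ ReL Re_sum !mulr_sumr; apply: eq_bigr => t _.
  by rewrite ReZ; ring.
rewrite normrM normfV normr_nat ler_pdivrMl ?ltr0n//.
rewrite (le_trans (ler_norm_sum _ _ _))// mulrC (le_trans _ sum_vpk)//.
rewrite -[leRHS](sum_rev _ s); apply: ler_sum => t _.
by rewrite normrM ler_piMl.
Qed.

Definition conj_fun (s : 'I_L) : R := complex.Im (holo s).

Lemma conj_fun_le s : `|conj_fun s| <= (4 * D)%:R.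
Proof.
have c0 : complex.Im (coef 0) = 0.
  rewrite /coef -(rmorph_nat (real_complex R)) -fmorphV ImZ Im_sum big1 ?mulr0//.
  by move=> t _; rewrite oppr0 chi_freq0 mulr1.
rewrite /conj_fun /holo ImD c0 add0r (le_trans (Im_modc _))// modcM modc_nat.
rewrite (_ : (4 * D)%N = (2 * D.*2)%N) ?natrM ?ler_wpM2l//; last by lia.
rewrite (le_trans (modc_sum _ _ _))//.
rewrite (le_trans (_ : _ <= \sum_(1 <= b < D.*2) 1))//.
  apply: ler_sum => b _.
  rewrite (modcM (_ * coef b)) (modcM _ (coef b)) modcR modc_chi mulr1.
  have /andP[v0 v1] := vp_itv b.
  by rewrite ger0_norm// -[leRHS]mulr1 ler_pM ?modc_ge0 ?modc_coef.
by rewrite sumr_const_nat ler_nat; lia.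
Qed.

(** The base is a polynomial of degree at most [2 D - 1] in [chi 1 s], so its power has degree at
    most [(2 D - 1) * 4 D < L], and the mean value property applies. This is why [L] has to be
    quadratic in [D]. *)
Lemma sum_pow_holo (k : R) (n : nat) : n = (4 * D)%N ->
  \sum_s (1 - 'i * k%:C * holo s) ^+ n = L%:R * (1 - 'i * k%:C * coef 0) ^+ n.
Proof.
move=> nD.
pose p : {poly C} := (1 - 'i * k%:C * coef 0)%:P +
  \sum_(1 <= b < D.*2) (- 'i * k%:C * 2 * (vp b)%:C * coef b) *: 'X^b.
have ps : (size p <= D.*2)%N.
  rewrite (leq_trans (size_polyD _ _))// geq_max (leq_trans (size_polyC_leq1 _))/=; last by lia.
  rewrite (leq_trans (size_sum _ _ _))//; apply/bigmax_leqP_seq => b.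
  rewrite mem_index_iota => /andP[b1 bD] _.
  by rewrite (leq_trans (size_scale_leq _ _))// size_polyXn.
have pE s : p.[chi 1 s] = 1 - 'i * k%:C * holo s.
  rewrite /p hornerD hornerC horner_sum /holo [in RHS]mulrDr [in RHS]opprD addrA; congr (_ + _).
  rewrite /analytic !mulr_sumr -sumrN; apply: eq_bigr => b _.
  by rewrite hornerZ hornerXn chi_freqX; ring.
under eq_bigr do rewrite -pE -horner_exp.
rewrite mean_horner.
  rewrite -!horner_coef0 horner_exp; congr (_ * _ ^+ n).
  rewrite /p hornerD hornerC horner_sum big_nat_cond big1 ?addr0// => b.
  by rewrite andbT => /andP[b1 _]; rewrite hornerZ hornerXn expr0n gtn_eqF// mulr0.
rewrite (leq_trans (size_poly_exp_leq _ _))// nD.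
have : ((size p).-1 * (4 * D) <= D.*2.-1 * (4 * D))%N by rewrite leq_mul2r; lia.
nia.
Qed.

(** Zygmund's argument, with the exponential of a holomorphic function replaced by a power
    [(1 - i k holo) ^ n], which stays a polynomial. Its mean is its value at the origin, and
    [Re_pow_ge] recovers the power of [1 + k * conj_fun] from the real part. The two signs of [k]
    cover the two signs of [conj_fun], whence [6 = 3 + 3]. *)
Lemma exp_conj_fun : \sum_s expR (`|conj_fun s| / 48) <= 6 * L%:R.
Proof.
(* By [conj_fun_le] the conjugate function is at most [n], so [|k| = 1 / (24 n)] keeps the base
   within [1/24] of [1]. *)
pose n := (4 * D)%N; have n0 : (0 < n)%N by rewrite muln_gt0.
have n0' : 0 < n%:R :> R by rewrite ltr0n.
have key (k : R) : `|k| = (24 * n%:R)^-1 ->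
    (forall s, 0 <= 1 + k * conj_fun s) /\ \sum_s (1 + k * conj_fun s) ^+ n <= 3 * L%:R.
  move=> hk.
  have k0 : 0 <= (24 * n%:R)^-1 :> R by rewrite invr_ge0 mulr_ge0.
  have kn : (24 * n%:R)^-1 * n%:R = 24^-1 :> R by rewrite invfM -mulrA mulVf ?mulr1 ?gt_eqF.
  have hpsi s : `|k * conj_fun s| <= 24^-1.
    by rewrite normrM hk -kn ler_wpM2l// conj_fun_le.
  have pos s : 1 / 2 <= 1 + k * conj_fun s.
    have /ler_normlP[] := hpsi s; lra.
  split; first by move=> s; rewrite (le_trans _ (pos s))//; lra.
  have wE s : 1 - 'i * k%:C * holo s =
      (1 + k * conj_fun s) +i* (- (k * complex.Re (holo s))).
    by rewrite /conj_fun; case: (holo s) => x y; apply: complexP => /=; ring.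
  have H : \sum_s 2 / 3 * (1 + k * conj_fun s) ^+ n <= L%:R * 2.
    apply: (@le_trans _ _ (complex.Re (\sum_s (1 - 'i * k%:C * holo s) ^+ n))).
      rewrite Re_sum; apply: ler_sum => s _; rewrite wE Re_pow_ge//.
        by rewrite (lt_le_trans _ (pos s))//; lra.
      rewrite normrN normrM hk ler_pdivlMr ?mulr_gt0//.
      rewrite (le_trans _ (pos s))//.
      rewrite [leLHS](_ : _ = (24 * n%:R)^-1 * n%:R * 4 * `|complex.Re (holo s)|); last by ring.
      by rewrite kn; have := Re_holo s; lra.
    rewrite sum_pow_holo// -(rmorph_nat (real_complex R)) ReZ ler_wpM2l//.
    rewrite (le_trans (ler_norm _))// (le_trans (Re_modc _))// modcX.
    have i1 : modc ('i : C) = 1 by rewrite /modc/= expr0n expr1n add0r sqrtr1.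
    apply: (@le_trans _ _ ((1 + (24 * n%:R)^-1) ^+ n)).
      rewrite lerXn2r ?nnegrE ?modc_ge0 ?addr_ge0// (le_trans (modcB _ _))// modc1 lerD2l.
      by rewrite (modcM _ (coef 0)) (modcM _ k%:C) i1 mul1r modcR hk ler_piMr// modc_coef.
    rewrite (le_trans (pow1D_expR _ _)) ?addr_ge0// mulrC kn.
    have h24 : 24^-1 < 1 :> R by lra.
    apply: (le_trans (expR_le_inv h24)).
    have -> : 1 - 24^-1 = 23 / 24 :> R by field.
    by rewrite invf_div; lra.
  by move: H; rewrite -mulr_sumr; lra.
have h1 : `|(24 * n%:R)^-1| = (24 * n%:R)^-1 :> R.
  by rewrite ger0_norm// invr_ge0 mulr_ge0.
have [p1 s1] := key _ h1.
have [p2 s2] := key (- (24 * n%:R)^-1) (etrans (normrN _) h1).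
rewrite (_ : 6 * _ = 3 * L%:R + 3 * L%:R); last by ring.
rewrite (le_trans _ (lerD s1 s2))// -big_split/=; apply: ler_sum => s _.
have q1 := exprn_ge0 n (p1 s); have q2 := exprn_ge0 n (p2 s).
pose x := (24 * n%:R)^-1 * `|conj_fun s|.
have hx : expR (`|conj_fun s| / 48) <= (1 + x) ^+ n.
  rewrite (_ : _ / 48 = n%:R * x / 2); last by rewrite /x; field; rewrite gt_eqF.
  apply: expR_half_pow; rewrite mulr_ge0 ?invr_ge0 ?mulr_ge0//=.
  rewrite ler_pdivrMl ?mulr_gt0// mulr1 (le_trans (conj_fun_le _))//.
  by rewrite ler_peMl//; lra.
apply: (le_trans hx); rewrite /x.
have [h|h] := ger0P (conj_fun s); first by rewrite lerDl.
by rewrite mulrN -mulNr lerDr.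
Qed.

End Duality.
End Zygmund.

(** * Zygmund's theorem by duality *)

Section ZygmundTheorem.
Context {R : realType}.
Variable l : nat.
Local Notation L := l.+2.
Local Notation C := R[i].
Local Open Scope complex_scope.

Section Dual.
Variables (D : nat) (phi : 'I_L -> R).
Hypothesis D0 : (0 < D)%N.
Hypothesis DL : (8 * D ^ 2 <= L)%N.
Hypothesis phi1 : forall t, `|phi t| <= 1.
Local Notation A := (analytic D phi).
Let L0 : L%:R != 0 :> C. Proof. by rewrite pnatr_eq0. Qed.

Lemma Im_coef0 : complex.Im (coef phi 0) = 0.
Proof.
rewrite /coef -(rmorph_nat (real_complex R)) -fmorphV ImZ Im_sum big1 ?mulr0//.
by move=> t _; rewrite oppr0 chi_freq0 mulr1.
Qed.

Lemma modc_analyticB s : modc (conjc (A s) - A s) = `|conj_fun D phi s|.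
Proof.
rewrite /conj_fun /holo ImD Im_coef0 add0r -(rmorph_nat (real_complex R)) ImZ.
case: (A s) => x y /=; rewrite /modc/= subrr expr0n/= add0r sqrtr_sqr.
by rewrite -opprD normrN -mulr2n mulr_natl.
Qed.

Lemma sum_phi_chi b : \sum_t (phi t)%:C * chi b%:Z t = L%:R * conjc (coef phi b).
Proof.
rewrite /coef rmorphM fmorphV rmorph_nat mulVKf// rmorph_sum; apply: eq_bigr => t _.
rewrite rmorphM; congr (_ * _); first by rewrite /= oppr0.
by rewrite chi_freqN; apply/esym; exact: conjcK.
Qed.

Lemma sum_phi_chiN b : \sum_t (phi t)%:C * chi (- b%:Z) t = L%:R * coef phi b.
Proof. by rewrite /coef mulVKf. Qed.

Lemma sum_chi_analytic m : (`|m| <= D)%N ->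
  \sum_s chi m s * A s = if m < 0 then L%:R * coef phi `|m| else 0.
Proof.
move=> mD; rewrite /analytic.
have DD : (D <= D ^ 2)%N by rewrite -[X in (X <= _)%N]expn1 leq_pexp2l.
under eq_bigr do rewrite big_distrr/=.
rewrite exchange_big/=.
have E b : (1 <= b < D.*2)%N ->
    \sum_(s : 'I_L) chi m s * ((vp D b)%:C * coef phi b * chi b%:Z s) =
    (vp D b)%:C * coef phi b * (L%:R *+ (m + b%:Z == 0)).
  move=> hb; under eq_bigr do rewrite mulrCA -chi_freqD.
  by rewrite -mulr_sumr (@sum_chiE R l)//; lia.
rewrite (eq_big_nat _ _ E); case: ifPn => hm.
  have hb : `|m|%N \in index_iota 1 D.*2 by rewrite mem_index_iota; lia.
  rewrite (bigD1_seq _ hb (iota_uniq _ _))/= big1_seq ?addr0.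
    by rewrite vp1// mul1r (_ : (_ == _) = true) ?mulr1n ?(mulrC L%:R)//; lia.
  move=> b /andP[bm _]; rewrite (_ : (_ == _) = false) ?mulr0//; lia.
rewrite big_nat_cond big1// => b; rewrite andbT => /andP[b1 _].
by rewrite (_ : (_ == _) = false) ?mulr0//; lia.
Qed.

Lemma sum_chi_conj m (F : 'I_L -> C) :
  \sum_s chi m s * conjc (F s) = conjc (\sum_s chi (- m) s * F s).
Proof.
rewrite rmorph_sum; apply: eq_bigr => s _.
by rewrite rmorphM; congr (_ * _); rewrite chi_freqN; apply/esym; exact: conjcK.
Qed.

(** The transpose of the sign multiplier, applied to [phi]: the analytic part carries its positive
    frequencies and, [phi] being real, the conjugate carries the negative ones. The weights [vp] are
    [1] up to [D], so frequencies [|m| <= D] are treated exactly. *)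
Lemma dual_chi m : (`|m| <= D)%N ->
  (sgz m)%:~R * \sum_t (phi t)%:C * chi m t = \sum_s chi m s * (conjc (A s) - A s).
Proof.
move=> mD; under [RHS]eq_bigr do rewrite mulrBr.
rewrite sumrB sum_chi_conj !sum_chi_analytic ?abszN//.
case: (ltrgtP m 0) => [m0|m0|->].
- rewrite (_ : (- m < 0) = false); last by apply/negbTE; rewrite oppr_lt0 -leNgt ltW.
  rewrite (rmorph0 conjc) sub0r ltr0_sgz// rmorphN1 mulN1r -sum_phi_chiN; congr (- _).
  by rewrite (_ : - `|m|%:Z = m)//; lia.
- rewrite oppr_lt0 m0 subr0 gtr0_sgz// mul1r (rmorphM conjc) rmorph_nat -sum_phi_chi.
  by rewrite (_ : `|m|%:Z = m)//; lia.
- by rewrite oppr0 ltxx (rmorph0 conjc) subrr sgz0 mul0r.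
Qed.

End Dual.

Section TrigPoly.
Variables (I : finType) (fr : I -> int) (c : I -> C).

(** The Hilbert transform without its factor [-i]. *)
Definition hilbert (t : 'I_L) : C := trig fr (fun i => (sgz (fr i))%:~R * c i) t.

(** After transposition the other factor is bounded by [|conj_fun|]; [young_logp] is applied to
    [|conj_fun| / 48], and [288 = 48 * 6] by [exp_conj_fun]. *)
Lemma hilbert_dual D (phi : 'I_L -> R) : (0 < D)%N -> (8 * D ^ 2 <= L)%N ->
  (forall t, `|phi t| <= 1) -> (forall i, (`|fr i| <= D)%N) ->
  modc (\sum_(t : 'I_L) (phi t)%:C * hilbert t) <=
    48 * \sum_(t : 'I_L) modc (trig fr c t) * logp (modc (trig fr c t)) + 288 * L%:R.
Proof.
move=> D0 DL phi1 frD.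
have -> : \sum_(t : 'I_L) (phi t)%:C * hilbert t = \sum_(s : 'I_L) trig fr c s *
    (conjc (analytic D phi s) - analytic D phi s).
  rewrite /hilbert /trig.
  under eq_bigr do rewrite big_distrr/=.
  under [RHS]eq_bigr do rewrite big_distrl/=.
  rewrite exchange_big [RHS]exchange_big/=; apply: eq_bigr => i _.
  under [RHS]eq_bigr do rewrite -mulrA.
  rewrite -mulr_sumr -(dual_chi phi D0 DL (frD i)) mulrA mulr_sumr.
  by apply: eq_bigr => t _; ring.
apply: (le_trans (modc_sum _ _ _)).
apply: (@le_trans _ _ (\sum_(s : 'I_L) 48 * (modc (trig fr c s) * logp (modc (trig fr c s)) +
    expR (`|conj_fun D phi s| / 48)))).
  apply: ler_sum => s _; rewrite modcM modc_analyticB.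
  have := young_logp (modc_ge0 (trig fr c s)) (_ : 0 <= `|conj_fun D phi s| / 48).
  move=> /(_ (divr_ge0 (normr_ge0 _) (ler0n _ _))) h.
  rewrite (le_trans _ (ler_wpM2l _ h))// le_eqVlt; apply/orP; left; apply/eqP.
  by field.
rewrite -mulr_sumr big_split/= mulrDr lerD2l.
have := exp_conj_fun D0 DL phi1; lra.
Qed.

(** The norm is attained by pairing with a phase. As the test functions of [hilbert_dual] are real,
    its real and imaginary parts are used separately, which doubles the constants. *)
Theorem zygmund D : (0 < D)%N -> (8 * D ^ 2 <= L)%N -> (forall i, (`|fr i| <= D)%N) ->
  \sum_(t : 'I_L) modc (hilbert t) <=
    96 * \sum_(t : 'I_L) modc (trig fr c t) * logp (modc (trig fr c t)) + 576 * L%:R.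
Proof.
move=> D0 DL frD.
have /choice[u hu] : forall t : 'I_L, exists u : C, modc u <= 1 /\
    u * hilbert t = (modc (hilbert t))%:C.
  by move=> t; have [u u1 uh] := modc_phase (hilbert t); exists u.
have h1 (t : 'I_L) : `|complex.Re (u t)| <= 1 := le_trans (Re_modc _) (hu t).1.
have h2 (t : 'I_L) : `|complex.Im (u t)| <= 1 := le_trans (Im_modc _) (hu t).1.
have k1 := hilbert_dual D0 DL h1 frD; have k2 := hilbert_dual D0 DL h2 frD.
have E : (\sum_(t : 'I_L) modc (hilbert t))%:C = \sum_(t : 'I_L) (complex.Re (u t))%:C * hilbert t +
    'i * \sum_(t : 'I_L) (complex.Im (u t))%:C * hilbert t.
  rewrite rmorph_sum mulr_sumr -big_split; apply: eq_bigr => t _ /=.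
  by rewrite -(hu t).2 {1}[u t]complexE mulrDl mulrA.
have : modc (\sum_(t : 'I_L) modc (hilbert t))%:C <= modc (\sum_(t : 'I_L) (complex.Re (u t))%:C * hilbert t)
    + modc (\sum_(t : 'I_L) (complex.Im (u t))%:C * hilbert t).
  rewrite E (le_trans (modcD _ _))// lerD2l modcM.
  by rewrite (_ : modc 'i = 1) ?mul1r// /modc/= expr0n expr1n add0r sqrtr1.
rewrite modcR ger0_norm; last by apply: sumr_ge0 => t _; exact: modc_ge0.
by move=> h; rewrite (le_trans h)// (le_trans (lerD k1 k2))//; lra.
Qed.

End TrigPoly.
End ZygmundTheorem.

(** * Resolvents of the jump generator with symbol [max(|m|, |k|)] *)

Section Resolvent.
Context {R : realType}.
Variable l : nat.
Local Notation L := l.+2.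
Local Notation C := R[i].
Local Notation X := ('I_L * 'I_L)%type.
Local Open Scope complex_scope.
Variables (I : finType) (fm fk : I -> int).

Definition pol (c : I -> C) (j : X) : C :=
  \sum_i c i * (chi (fm i) j.1 * chi (fk i) j.2).

Definition freq i : nat := maxn `|fm i| `|fk i|.

Lemma polZ (z : C) c j : pol (fun i => z * c i) j = z * pol c j.
Proof. by rewrite /pol mulr_sumr; apply: eq_bigr => i _; rewrite !mulrA. Qed.

Lemma polD c d j : pol (fun i => c i + d i) j = pol c j + pol d j.
Proof. by rewrite /pol -big_split/=; apply: eq_bigr => i _; rewrite mulrDl. Qed.

Definition resolvent (a : R) (c : I -> C) : X -> C :=
  pol (fun i => ((a + (freq i)%:R)^-1)%:C * c i).

Lemma freq_diag i : (freq i).*2 = (`|(fm i + fk i)%R| + `|(fm i - fk i)%R|)%N.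
Proof. rewrite /freq; lia. Qed.

(** Since the Fejér coefficients are [L * (2 D - |m|)], summing [1 - chi m] against this kernel
    gives exactly [L |m|] for [|m| <= 2 D]. Jumps along the two diagonals see the frequencies
    [m + k] and [m - k], and their rates are nonnegative. *)
Lemma pol_laplace D c (j : X) : (forall i, freq i <= D)%N -> (4 * D <= L)%N ->
  \sum_(s : bool * 'I_L) (modc (@dir R l D.*2 s.2) ^+ 2 / (2 * L%:R))%:C *
     (pol c j - pol c (j.1 + s.2, j.2 + (if s.1 then s.2 else - s.2))) =
  pol (fun i => (freq i)%:R * c i) j.
Proof.
move=> hD hL.
have L0 : L%:R != 0 :> C by rewrite pnatr_eq0.
have Ew (x : R) : (x / (2 * L%:R))%:C = (2 * L%:R)^-1 * x%:C.
  by rewrite (rmorphM (real_complex R)) (fmorphV (real_complex R)) (rmorphM (real_complex R)) !(rmorph_nat (real_complex R)) mulrC.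
pose F (m : int) : C := \sum_(t : 'I_L) (modc (@dir R l D.*2 t) ^+ 2)%:C * (1 - chi m t).
have FE m : (`|m| <= D.*2)%N -> F m = L%:R * `|m|%:R.
  move=> mD; rewrite /F; under eq_bigr do rewrite mulrBr mulr1.
  rewrite sumrB fejer_coef//; last by lia.
  have -> : \sum_(t : 'I_L) (modc (@dir R l D.*2 t) ^+ 2)%:C = (L * D.*2)%:R.
    have := @fejer_coef R l D.*2 0 _ isT; rewrite subn0 => <-; last by lia.
    by apply: eq_bigr => t _; rewrite chi_freq0 mulr1.
  by rewrite -natrB ?leq_mul2l ?leq_subr// -mulnBr natrM subKn.
transitivity (\sum_i c i * (chi (fm i) j.1 * chi (fk i) j.2) *
    ((2 * L%:R)^-1 * (F (fm i + fk i) + F (fm i - fk i)))).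
  rewrite (eq_bigr (fun s : bool * 'I_L => \sum_i c i * (chi (fm i) j.1 * chi (fk i) j.2) *
      ((2 * L%:R)^-1 * ((modc (@dir R l D.*2 s.2) ^+ 2)%:C *
         (1 - chi (fm i + (if s.1 then fk i else - fk i)) s.2))))); last first.
    move=> [b t] _ /=; rewrite /pol -sumrB mulr_sumr; apply: eq_bigr => i _ /=.
    rewrite Ew chiD (chiD (fk i)) chi_freqD.
    have -> : chi (fk i) (if b then t else - t) =
        chi (if b then fk i else - fk i) t :> C by case: b; rewrite // chiN.
    by ring.
  rewrite exchange_big/=; apply: eq_bigr => i _; rewrite -mulr_sumr; congr (_ * _).
  rewrite -mulr_sumr; congr (_ * _).
  rewrite -(pair_big xpredT xpredT (fun b t => (modc (@dir R l D.*2 t) ^+ 2)%:C *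
    (1 - chi (fm i + (if b then fk i else - fk i)) t)))/=.
  by rewrite big_bool.
rewrite /pol; apply: eq_bigr => i _.
have := hD i; have := freq_diag i => h1 h2.
rewrite !FE; [|lia|lia].
rewrite -mulrDr -natrD -h1 -mul2n natrM invfM -[_ * (L%:R * _)]mulrA.
by rewrite (mulKf L0) mulKf ?pnatr_eq0// mulrC -[RHS]mulrA.
Qed.

(** The generator maps [u a] to the real part of the polynomial minus [a] times the real part of the
    resolvent, and the latter exceeds [lambda] exactly where [u a] is positive. This is the
    hypothesis of [garsia], which treats all parameters [a] at once; the constant [lambda / a] is
    killed by the generator. *)
Lemma resolvent_weak_Re D N (c : I -> C) (lambda : R) :
  (forall i, freq i <= D)%N -> (4 * D <= L)%N -> 0 < lambda ->
  exists B : {set X}, lambda * #|B|%:R <= \sum_j modc (pol c j) /\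
    forall j, j \notin B -> forall n, (n <= N)%N ->
      n.+1%:R * complex.Re (resolvent n.+1%:R c j) <= lambda.
Proof.
move=> hD hL la0.
pose w (s : bool * 'I_L) : R := modc (@dir R l D.*2 s.2) ^+ 2 / (2 * L%:R).
pose sh (s : bool * 'I_L) (j : X) : X := (j.1 + s.2, j.2 + (if s.1 then s.2 else - s.2)).
pose u (a : 'I_N.+1) (j : X) : R := complex.Re (resolvent a.+1%:R c j) - lambda / a.+1%:R.
pose U j := \big[Num.max/0]_(a : 'I_N.+1) u a j.
have uU a j : u a j <= U j by exact: (le_bigmax _ (u^~ j)).
have w0 s : 0 <= w s by rewrite divr_ge0 ?exprn_ge0 ?modc_ge0 ?mulr_ge0.
have shI s : injective (sh s).
  move=> [a b] [a' b'] e; move: (congr1 fst e) (congr1 snd e); rewrite /sh [X in X -> _]/= [X in _ -> X -> _]/=.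
  by move=> /addIr -> /addIr ->.
have key a j : 0 < u a j -> \sum_s w s * (u a j - U (sh s j)) <=
    complex.Re (pol c j) - lambda.
  move=> uj.
  have a0 : 0 < a.+1%:R :> R by rewrite ltr0n.
  apply: (@le_trans _ _ (\sum_s w s * (u a j - u a (sh s j)))).
    by apply: ler_sum => s _; rewrite ler_wpM2l// lerD2l lerN2.
  have E : \sum_s w s * (u a j - u a (sh s j)) =
      complex.Re (pol (fun i => (freq i)%:R * (((a.+1%:R + (freq i)%:R)^-1)%:C * c i)) j).
    rewrite -(pol_laplace _ _ hD hL) Re_sum; apply: eq_bigr => s _.
    by rewrite ReZ ReD ReN /u opprD opprK addrACA addNr addr0.
  rewrite E.
  have -> : pol (fun i => (freq i)%:R * (((a.+1%:R + (freq i)%:R)^-1)%:C * c i)) j =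
      pol c j - (a.+1%:R)%:C * resolvent a.+1%:R c j.
    rewrite /resolvent -polZ -mulN1r -polZ -polD; apply: eq_bigr => i _; congr (_ * _).
    have af : a.+1%:R + (freq i)%:R != 0 :> R by rewrite gt_eqF// ltr_wpDr.
    have e : (freq i)%:R * ((a.+1%:R + (freq i)%:R)^-1)%:C =
        1 - (a.+1%:R)%:C * ((a.+1%:R + (freq i)%:R)^-1)%:C :> C.
      rewrite -(rmorph_nat (real_complex R) (freq i)).
      move: af; set p := a.+1%:R; set q := (freq i)%:R => af.
      by apply: complexP => /=; [field|ring].
    by rewrite mulrA e; ring.
  rewrite ReD ReN ReZ lerD2l lerN2 mulrC -ler_pdivrMr//.
  by rewrite ltW// -subr_gt0.
have := @garsia R X 'I_N.+1 (bool * 'I_L)%type w sh u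
  (fun j => complex.Re (pol c j) - lambda) w0 shI key.
rewrite -/U sumrB => H.
exists [set j | 0 < U j]%SET; split.
  rewrite -subr_ge0; apply: (le_trans H).
  rewrite lerB//.
    rewrite [leRHS](bigID (fun j => 0 < U j))/= -[leLHS]addr0 lerD//.
      by apply: ler_sum => j _; rewrite (le_trans (ler_norm _))// Re_modc.
    by apply: sumr_ge0 => j _; rewrite modc_ge0.
  by rewrite mulr_natr -sumr_const; under eq_bigl do rewrite inE.
move=> j; rewrite inE -leNgt => Uj n nN.
have := le_trans (uU (Ordinal (nN : (n < N.+1)%N)) j) Uj; rewrite /u/= subr_le0 => h.
by rewrite mulrC -ler_pdivlMr ?ltr0n.
Qed.

(** The one-sided bound on real parts is applied after multiplication by [1], [-1], [i] and [-i]. *)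
Lemma resolvent_weak D N (c : I -> C) (lambda : R) :
  (forall i, freq i <= D)%N -> (4 * D <= L)%N -> 0 < lambda ->
  exists B : {set X}, lambda * #|B|%:R <= 4 * \sum_j modc (pol c j) /\
    forall j, j \notin B -> forall n, (n <= N)%N ->
      modc (n.+1%:R * resolvent n.+1%:R c j) <= 2 * lambda.
Proof.
move=> hD hL la0.
have H (z : C) : modc z = 1 ->
    exists B : {set X}, lambda * #|B|%:R <= \sum_j modc (pol c j) /\
    forall j, j \notin B -> forall n, (n <= N)%N ->
      n.+1%:R * complex.Re (z * resolvent n.+1%:R c j) <= lambda.
  move=> z1.
  have [B [hB h]] := resolvent_weak_Re N (fun i => z * c i) hD hL la0.
  exists B; split.
    rewrite (le_trans hB)//; apply: ler_sum => j _.
    by rewrite polZ modcM z1 mul1r.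
  move=> j jB n nN; rewrite (le_trans _ (h j jB n nN))//.
  rewrite /resolvent -polZ (_ : pol (fun i => z * _) j =
    pol (fun i => ((n.+1%:R + (freq i)%:R)^-1)%:C * (z * c i)) j)//.
  by apply: eq_bigr => i _; rewrite [z * (_ * _)]mulrCA.
have i1 : modc ('i : C) = 1 by rewrite /modc/= expr0n expr1n add0r sqrtr1.
have [B1 [hB1 h1]] := H 1 modc1.
have [B2 [hB2 h2]] := H (- 1) (etrans (modcN _) modc1).
have [B3 [hB3 h3]] := H 'i i1.
have [B4 [hB4 h4]] := H (- 'i) (etrans (modcN _) i1).
exists (B1 :|: B2 :|: (B3 :|: B4))%SET; split.
  have hU (A A' : {set X}) : #|A :|: A'|%:R <= #|A|%:R + #|A'|%:R :> R.
    by rewrite -natrD ler_nat cardsU leq_subr.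
  have := le_trans (hU _ _) (lerD (hU B1 B2) (hU B3 B4)).
  move=> /(ler_wpM2l (ltW la0)) h; rewrite (le_trans h)// !mulrDr; lra.
move=> j; rewrite !inE !negb_or => /andP[/andP[n1 n2] /andP[n3 n4]] n nN.
move: (h1 j n1 n nN) (h2 j n2 n nN) (h3 j n3 n nN) (h4 j n4 n nN).
move: (resolvent _ _ _) => z; rewrite mul1r !mulNr mul1r !ReN !mulrN.
have -> : complex.Re ('i * z) = - complex.Im z by case: z => x y /=; rewrite mul0r mul1r sub0r.
rewrite mulrN opprK => k1 k2 k3 k4.
rewrite (le_trans (modc_ReIm _))//.
rewrite -(rmorph_nat (real_complex R)) ReZ ImZ.
have r1 : `|n.+1%:R * complex.Re z| <= lambda by rewrite ler_norml; lra.
have r2 : `|n.+1%:R * complex.Im z| <= lambda by rewrite ler_norml; lra.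
by lra.
Qed.

End Resolvent.

(** * Comparison of arithmetic means with resolvent means *)

Section MeanBound.
Context {R : realType}.
Local Notation C := R[i].
Local Open Scope complex_scope.

Definition avg (S : nat -> C) (M : nat) : C := (M%:R)^-1 * \sum_(k < M) S k.

(** The difference [a / (a + k) - a / (a + k.+1)]: summation by parts turns the multiplier
    [a / (a + max(|m|, |k|))] into a mean of partial sums with these weights. *)
Definition wt (a : R) (k : nat) : R := a / ((a + k%:R) * (a + k.+1%:R)).

Lemma sum_wt (a : R) M K : 0 < a -> (M <= K)%N ->
  a / (a + M%:R) = \sum_(M <= k < K) wt a k + a / (a + K%:R).
Proof.
move=> a0 MK; rewrite (eq_bigr (fun k => (- (a / (a + k.+1%:R))) - (- (a / (a + k%:R))))).
  by rewrite telescope_sumr// opprK [RHS]addrC addrA subrr add0r.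
move=> k _; rewrite /wt; have h n : a + n%:R != 0 by rewrite gt_eqF// ltr_wpDr.
have := h k; have := h k.+1; rewrite -(natr1 k) => h1 h2.
by field; rewrite h2 h1.
Qed.

Lemma avg_dist (S : nat -> C) (z : C) (M : nat) (E : R) : (0 < M)%N ->
  \sum_(k < M) modc (S k - z) <= E * M%:R -> modc (avg S M - z) <= E.
Proof.
move=> M0 h; have M0' : 0 < M%:R :> R by rewrite ltr0n.
have -> : avg S M - z = (M%:R)^-1 * \sum_(k < M) (S k - z).
  rewrite sumrB sumr_const card_ord mulrBr /avg -[z *+ M]mulr_natl mulKf//.
  by rewrite pnatr_eq0 -lt0n.
rewrite modcM modcV modc_nat ler_pdivrMl// mulrC.
by rewrite (le_trans (modc_sum _ _ _)).
Qed.

(** Averages over consecutive dyadic blocks differ by at most [2 O], so the drift from the first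
    average grows linearly in [i], while the weights on the [i]-th block add up to about [2 ^- i].
    The total is a convergent series. Beyond [K] the sequence is constant and the remaining weight
    sits on [P]. *)
Lemma mean_bound (S : nat -> C) (P : C) (O : R) (n D e : nat) :
  let K := (2 ^ e * n.+1)%N in
  (forall i, (i <= e)%N -> let M := (2 ^ i * n.+1)%N in
     \sum_(k < M) modc (S k - avg S M) <= O * M%:R) ->
  (forall k, (D <= k)%N -> S k = P) -> (D.*2 <= K)%N ->
  modc (\sum_(k < K) (wt n.+1%:R k)%:C * S k + (n.+1%:R / (n.+1%:R + K%:R))%:C * P
        - avg S n.+1) <= 21 * O.
Proof.
move=> K hO hP DK.
pose a : R := n.+1%:R; have a0 : 0 < a by rewrite ltr0n.
pose M i := (2 ^ i * n.+1)%N.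
have M0 i : (0 < M i)%N by rewrite muln_gt0 expn_gt0.
have MR i : (M i)%:R = 2 ^+ i * a :> R by rewrite natrM natrX.
pose s := avg S n.+1.
have sM0 : s = avg S (M 0%N) by rewrite /M expn0 mul1n.
have O0 : 0 <= O.
  have := hO 0%N isT => /=; rewrite -/(M 0%N) => h.
  have := le_trans (sumr_ge0 _ (fun k _ => modc_ge0 _)) h.
  by rewrite pmulr_lge0// ltr0n.
have hs i : (i <= e)%N -> modc (avg S (M i) - s) <= 2 * i%:R * O.
  elim: i => [|i IH] ie; first by rewrite sM0 subrr modc0 mulr0 mul0r.
  rewrite (le_trans (modc_triangle (avg S (M i)) _ _))//.
  rewrite -(natr1 i) mulrDr mulr1 mulrDl addrC lerD ?IH ?(ltnW ie)//.
  rewrite modcBC; apply: avg_dist => //.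
  have := hO _ ie => /=; rewrite -/(M i.+1) => h.
  apply: le_trans (le_trans _ h) _; last by rewrite !MR exprS; lra.
  have MM : (M i <= M i.+1)%N by rewrite leq_mul2r leq_exp2l// leqnSn orbT.
  rewrite -(big_mkord xpredT (fun k => modc (S k - avg S (M i.+1)))).
  rewrite -[leRHS](big_mkord xpredT (fun k => modc (S k - avg S (M i.+1)))).
  rewrite [leRHS](@big_cat_nat _ _ _ (M i))//= lerDl.
  by apply: sumr_ge0 => k _; exact: modc_ge0.
have hsum i : (i <= e)%N ->
    \sum_(0 <= k < M i) modc (S k - s) <= (1 + 2 * i%:R) * O * (M i)%:R.
  move=> ie; have := hO _ ie => /=; rewrite -/(M i) => h.
  rewrite big_mkord.
  apply: (@le_trans _ _ (\sum_(k < M i) (modc (S k - avg S (M i)) + 2 * i%:R * O))).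
    apply: ler_sum => k _; rewrite (le_trans (modc_triangle (avg S (M i)) _ _))//.
    by rewrite lerD2l hs.
  rewrite big_split/= sumr_const card_ord -[_ *+ M i]mulr_natr.
  apply: (le_trans (lerD h (lexx _))); rewrite le_eqVlt; apply/orP; left; apply/eqP; ring.
have wt0 k : 0 <= wt a k by rewrite /wt divr_ge0 ?mulr_ge0 ?addr_ge0 ?(ltW a0).
(* The subtracted term is chosen so that its decrease from [i] to [i.+1] is exactly the bound
   [2 * (3 + 2 * i) * 2 ^- i] on the new block; at [i = 0] the constant is [1]. *)
have hT i : (i <= e)%N -> \sum_(0 <= k < M i) wt a k * modc (S k - s) <=
    (21 - 2 * (10 + 4 * i%:R) * 2 ^- i) * O.
  elim: i => [|i IH] ie.
    rewrite expr0 invr1 mulr0 addr0 (_ : 21 - _ = 1); last by ring.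
    have := hsum 0%N isT; rewrite mulr0 addr0 !mul1r MR expr0 mul1r => h.
    apply: (@le_trans _ _ (a^-1 * \sum_(0 <= k < M 0%N) modc (S k - s))); last first.
      by rewrite ler_pdivrMl// mulrC.
    rewrite mulr_sumr; apply: ler_sum => k _; rewrite ler_wpM2r ?modc_ge0//.
    rewrite /wt -(natr1 k) ler_pdivrMr ?mulr_gt0 ?ltr_wpDr ?addr_ge0//.
    by rewrite ler_pdivlMl//; have : 0 <= k%:R :> R by []; nra.
  have MM : (M i <= M i.+1)%N by rewrite leq_mul2r leq_exp2l// leqnSn orbT.
  rewrite (@big_cat_nat _ _ _ (M i))//=.
  have step : \sum_(M i <= k < M i.+1) wt a k * modc (S k - s) <=
      2 * (3 + 2 * i%:R) * 2 ^- i * O.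
    have p0 : 0 < 2 ^+ i :> R by rewrite exprn_gt0.
    have hw k : (M i <= k)%N -> wt a k <= (2 ^+ i * 2 ^+ i * a)^-1.
      move=> Mk; have hk : 2 ^+ i * a <= k%:R by rewrite -MR ler_nat.
      rewrite /wt -(natr1 k) ler_pdivrMr ?mulr_gt0 ?ltr_wpDr ?addr_ge0//.
      rewrite ler_pdivlMl ?mulr_gt0//.
      rewrite [leLHS](_ : _ = (2 ^+ i * a) * (2 ^+ i * a)); last by ring.
      by apply: ler_pM; rewrite ?mulr_ge0 ?(ltW p0) ?(ltW a0)//; lra.
    apply: (@le_trans _ _ ((2 ^+ i * 2 ^+ i * a)^-1 *
        \sum_(0 <= k < M i.+1) modc (S k - s))).
      rewrite [in leRHS](@big_cat_nat _ _ _ (M i))//= mulrDr -[leLHS]add0r lerD//.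
        rewrite mulr_ge0 ?invr_ge0 ?mulr_ge0 ?(ltW p0) ?(ltW a0)//.
        by apply: sumr_ge0 => k _; exact: modc_ge0.
      rewrite mulr_sumr big_nat_cond [leRHS]big_nat_cond; apply: ler_sum => k.
      by rewrite andbT => /andP[Mk _]; rewrite ler_wpM2r ?modc_ge0 ?hw.
    rewrite ler_pdivrMl ?mulr_gt0// (le_trans (hsum _ ie))// MR exprS -(natr1 i).
    rewrite le_eqVlt; apply/orP; left; apply/eqP.
    by field; rewrite gt_eqF.
  rewrite (le_trans (lerD (IH (ltnW ie)) step))// -(natr1 i) exprS.
  rewrite le_eqVlt; apply/orP; left; apply/eqP.
  by field; rewrite expf_neq0.
have W1 : \sum_(k < K) wt a k + a / (a + K%:R) = 1.
  by have := sum_wt a0 (leq0n K); rewrite addr0 divff ?gt_eqF// big_mkord => <-.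
have W1c : \sum_(k < K) (wt a k)%:C + (a / (a + K%:R))%:C = 1 :> C.
  by rewrite -(rmorph_sum (real_complex R)) -(rmorphD (real_complex R)) W1.
have -> : \sum_(k < K) (wt n.+1%:R k)%:C * S k + (n.+1%:R / (n.+1%:R + K%:R))%:C * P - s =
    \sum_(k < K) (wt a k)%:C * (S k - s) + (a / (a + K%:R))%:C * (P - s).
  under [in RHS]eq_bigr do rewrite mulrBr.
  rewrite sumrB -mulr_suml mulrBr addrACA -opprD -mulrDl W1c mul1r.
  by [].
have K0 : 0 < K%:R :> R by rewrite ltr0n (M0 e).
have hPs : modc (P - s) <= (2 + 2 * e%:R) * O.
  rewrite (le_trans (modc_triangle (avg S K) _ _))// mulrDl lerD ?hs//.
  have := hO e (leqnn e) => /=; rewrite -/K => h.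
  (* At least half of the terms of the last block equal [P], so [P] is within [2 O] of its
     average. *)
  have h2 : (K - D)%:R * modc (P - avg S K) <= O * K%:R.
    apply: le_trans h; rewrite -(big_mkord xpredT (fun k => modc (S k - avg S K))).
    rewrite [leRHS](@big_cat_nat _ _ _ D)//=; last by lia.
    rewrite -[leLHS]add0r lerD//; first by apply: sumr_ge0 => k _; exact: modc_ge0.
    rewrite (eq_big_nat _ _ (F2 := fun=> modc (P - avg S K))); last first.
      by move=> k /andP[Dk _]; rewrite hP.
    by rewrite sumr_const_nat mulr_natl.
  have h3 : K%:R <= 2 * (K - D)%:R :> R by rewrite -natrM ler_nat; lia.
  have := modc_ge0 (P - avg S K); rewrite -(ler_pM2r K0); set x := modc _ in h2 * => x0.
  nra.
rewrite (le_trans (modcD _ _))//.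
have aK : a / (a + K%:R) <= 2 ^- e.
  rewrite ler_pdivrMr ?addr_gt0// ler_pdivlMl ?exprn_gt0// -MR -/K lerDr ltW//.
have aK0 : 0 <= a / (a + K%:R) by rewrite divr_ge0 ?addr_ge0 ?(ltW a0).
have t1 : modc (\sum_(k < K) (wt a k)%:C * (S k - s)) <=
    (21 - 2 * (10 + 4 * e%:R) * 2 ^- e) * O.
  rewrite (le_trans _ (hT e (leqnn e)))// (le_trans (modc_sum _ _ _))//.
  rewrite big_mkord; apply: ler_sum => k _; rewrite modcM modcR ger0_norm//.
have t2 : modc ((a / (a + K%:R))%:C * (P - s)) <= 2 ^- e * ((2 + 2 * e%:R) * O).
  rewrite modcM modcR ger0_norm// ler_pM ?modc_ge0//.
rewrite (le_trans (lerD t1 t2))//.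
have e0 : 0 <= e%:R :> R by [].
have p0 : 0 <= 2 ^- e :> R by rewrite invr_ge0 exprn_ge0.
have : 0 <= 2 ^- e * (18 + 6 * e%:R) * O by rewrite !mulr_ge0// addr_ge0// mulr_ge0.
lra.
Qed.

End MeanBound.

(** * One-variable strips in the plane *)

Section Strips.
Context {R : realType}.
Variable l : nat.
Local Notation L := l.+2.
Local Notation C := R[i].
Local Notation X := ('I_L * 'I_L)%type.
Local Open Scope complex_scope.

Definition strip (I : finType) (fm fk g : I -> int) (c : I -> C) (a n : nat) (j : X) : C :=
  \sum_(i | (a%:Z < g i <= (a + n)%N%:Z)%R) c i * (chi (fm i) j.1 * chi (fk i) j.2).

Definition strip_bounded (I : finType) (fm fk g : I -> int) (c : I -> C)
    (N1 : nat) (lambda : R) (j : X) :=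
  forall a N : nat, (a + N <= N1)%N ->
    exists z, \sum_(n < N) modc (strip fm fk g c a n j - z) <= 1100 * lambda * N%:R.

(** On each horizontal line the other variable only changes the coefficients, and the exceptional
    sets of the lines are put together. *)
Lemma weak_strip (I : finType) (fm fk : I -> int) c D N1 (lambda : R) :
  (forall i, (`|fm i| <= D)%N) -> (N1 + D < L)%N -> 0 < lambda ->
  exists B : {set X}, lambda * #|B|%:R <= 6 * \sum_(j : X) modc (pol fm fk c j) /\
    forall j, j \notin B -> strip_bounded fm fk fm c N1 lambda j.
Proof.
move=> hD hL la0.
have /choice[B hB] := fun y : 'I_L =>
  @weak_block_oscillation R l I fm (fun i => c i * chi (fk i) y) D N1 lambda hD hL la0.
exists [set j | j.1 \in B j.2]%SET; split.
  have -> : #|[set j : X | j.1 \in B j.2]%SET|%:R = \sum_y #|B y|%:R :> R.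
    rewrite -sum1_card natr_sum.
    rewrite (eq_bigl (fun j : X => j.1 \in B j.2)); last by move=> j; rewrite inE.
    transitivity (\sum_y \sum_x ((x \in B y)%:R : R)).
      rewrite exchange_big pair_bigA/= big_mkcond; apply: eq_bigr => j _ /=.
      by case: ifP.
    apply: eq_bigr => y _; rewrite -sum1_card natr_sum [RHS]big_mkcond.
    by apply: eq_bigr => x _; case: ifP.
  rewrite mulr_sumr.
  have -> : \sum_(j : X) modc (pol fm fk c j) = \sum_(y : 'I_L) \sum_(x : 'I_L) modc (pol fm fk c (x, y)).
    by rewrite exchange_big pair_bigA; apply: eq_bigr => -[].
  rewrite mulr_sumr; apply: ler_sum => y _; rewrite (le_trans (hB y).1)//.
  rewrite ler_wpM2l// le_eqVlt; apply/orP; left; apply/eqP/eq_bigr => x _.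
  by congr modc; apply: eq_bigr => i _ /=; rewrite -mulrA [chi (fk i) y * _]mulrC.
move=> [x y]; rewrite inE/= => xB a N aN.
have [z hz] := (hB y).2 x xB a N aN.
exists z; apply: le_trans hz; rewrite le_eqVlt; apply/orP; left; apply/eqP.
apply: eq_bigr => n _; congr (modc (_ - _)); apply: eq_bigr => i _ /=.
by rewrite -[RHS]mulrA [chi (fk i) y * _]mulrC.
Qed.

(** Complex conjugation exchanges positive and negative frequencies and preserves all moduli. *)
Lemma weak_stripN (I : finType) (fm fk : I -> int) c D N1 (lambda : R) :
  (forall i, (`|fm i| <= D)%N) -> (N1 + D < L)%N -> 0 < lambda ->
  exists B : {set X}, lambda * #|B|%:R <= 6 * \sum_(j : X) modc (pol fm fk c j) /\
    forall j, j \notin B -> strip_bounded fm fk (fun i => - fm i) c N1 lambda j.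
Proof.
move=> hD hL la0.
have hD' i : (`|(- fm i)%R| <= D)%N by rewrite abszN.
have [B [hB H]] := @weak_strip I (fun i => - fm i) (fun i => - fk i)
  (fun i => conjc (c i)) D N1 lambda hD' hL la0.
have cE i j : conjc (c i) * (chi (- fm i) j.1 * chi (- fk i) j.2) =
    conjc (c i * (chi (fm i) j.1 * chi (fk i) j.2)) :> C.
  by rewrite !chi_freqN !rmorphM.
exists B; split.
  rewrite (le_trans hB)// ler_wpM2l// le_eqVlt; apply/orP; left; apply/eqP.
  apply: eq_bigr => j _; rewrite -[RHS]modcJ /pol rmorph_sum; congr modc.
  by apply: eq_bigr => i _; exact: cE.
move=> j jB a N aN; have [z hz] := H j jB a N aN.
exists (conjc z); apply: le_trans hz; rewrite le_eqVlt; apply/orP; left; apply/eqP.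
apply: eq_bigr => n _; rewrite -[LHS]modcJ rmorphB; congr (modc (_ - _)); last exact: conjcK.
by rewrite /strip rmorph_sum; apply: eq_bigr => i _; apply: esym; exact: cE.
Qed.

Lemma pol_swap (I : finType) (fm fk : I -> int) (c : I -> C) (j : X) :
  pol fm fk c (j.2, j.1) = pol fk fm c j.
Proof. by apply: eq_bigr => i _ /=; rewrite [chi _ _ * chi _ _]mulrC. Qed.

Lemma strip_swap (I : finType) (fm fk g : I -> int) (c : I -> C) N1 (lambda : R) (j : X) :
  strip_bounded fm fk g c N1 lambda (j.2, j.1) -> strip_bounded fk fm g c N1 lambda j.
Proof.
move=> H a N aN; have [z hz] := H a N aN.
exists z; apply: le_trans hz; rewrite le_eqVlt; apply/orP; left; apply/eqP.
apply: eq_bigr => n _; congr (modc (_ - _)).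
by apply: eq_bigr => i _ /=; rewrite [chi _ _ * chi _ _]mulrC.
Qed.

Lemma weak_strips (I : finType) (fm fk : I -> int) c D N1 (lambda : R) :
  (forall i, (freq fm fk i <= D)%N) -> (N1 + D < L)%N -> 0 < lambda ->
  exists B : {set X}, lambda * #|B|%:R <= 12 * \sum_(j : X) modc (pol fm fk c j) /\
    forall j, j \notin B -> strip_bounded fm fk fm c N1 lambda j /\
      strip_bounded fm fk (fun i => - fm i) c N1 lambda j.
Proof.
move=> hD hL la0.
have hm i : (`|fm i| <= D)%N by have := hD i; rewrite /freq; lia.
have [B1 [hB1 h1]] := weak_strip fk c hm hL la0.
have [B2 [hB2 h2]] := weak_stripN fk c hm hL la0.
exists (B1 :|: B2)%SET; split.
  have hU : #|B1 :|: B2|%:R <= #|B1|%:R + #|B2|%:R :> R.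
    by rewrite -natrD ler_nat cardsU leq_subr.
  rewrite (le_trans (ler_wpM2l (ltW la0) hU))// mulrDr; lra.
by move=> j; rewrite !inE !negb_or => /andP[/h1 ? /h2 ?].
Qed.

Lemma weak_strips2 (I : finType) (fm fk : I -> int) c d D N1 (lambda : R) :
  (forall i, (freq fm fk i <= D)%N) -> (N1 + D < L)%N -> 0 < lambda ->
  exists B : {set X}, lambda * #|B|%:R <= 
     12 * (\sum_(j : X) modc (pol fm fk c j) + \sum_(j : X) modc (pol fm fk d j)) /\
    forall j, j \notin B -> 
    [/\ strip_bounded fm fk fm c N1 lambda j,
      strip_bounded fm fk (fun i => - fm i) c N1 lambda j,
      strip_bounded fm fk fk d N1 lambda j &
      strip_bounded fm fk (fun i => - fk i) d N1 lambda j].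
Proof.
move=> hD hL la0.
have [B1 [hB1 h1]] := weak_strips c hD hL la0.
have hD' i : (freq fk fm i <= D)%N by have := hD i; rewrite /freq maxnC.
have [B2 [hB2 h2]] := weak_strips d hD' hL la0.
pose sw (j : X) := (j.2, j.1).
have swI : injective sw by move=> [a b] [a' b'] [-> ->].
have c2 : #|sw @^-1: B2|%SET = #|B2|.
  by apply: on_card_preimset; exists sw => [] [a b] _.
exists (B1 :|: sw @^-1: B2)%SET; split.
  have hU : #|B1 :|: sw @^-1: B2|%:R <= #|B1|%:R + #|B2|%:R :> R.
    by rewrite -natrD ler_nat cardsU c2 leq_subr.
  rewrite (le_trans (ler_wpM2l (ltW la0) hU))// mulrDr mulrDr lerD// (le_trans hB2)//.
  rewrite (reindex_inj swI) ler_wpM2l//; apply: ler_sum => j _.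
  by rewrite /sw pol_swap.
move=> j; rewrite !inE !negb_or => /andP[/h1[a1 a2] /h2[a3 a4]]; split => //; exact: strip_swap.
Qed.

End Strips.

(** * Cutting square rings along the diagonals *)

Section SignIdentity.

Lemma sgz_cases (x : int) : [\/ x < 0 /\ sgz x = -1, x = 0 /\ sgz x = 0 | 0 < x /\ sgz x = 1].
Proof.
by case: (ltrgtP x 0) => [h|h|->]; [constructor 1; rewrite ltr0_sgz|constructor 3; rewrite gtr0_sgz|constructor 2; rewrite sgz0].
Qed.

(* The ring [a < max(|m|, |k|) <= b] is cut into four strips, each in one
   variable, by the diagonals. *)
Lemma ring_strips (m k : int) (a b : nat) : (a <= b)%N ->
  ((maxn `|m| `|k| <= b)%N%:Z - (maxn `|m| `|k| <= a)%N%:Z) * 2 =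
  (sgz (m + k) + sgz (m - k)) *
     ((a%:Z < m <= b%:Z)%R%:Z - (a%:Z < - m <= b%:Z)%R%:Z) +
  (sgz (m + k) - sgz (m - k)) *
     ((a%:Z < k <= b%:Z)%R%:Z - (a%:Z < - k <= b%:Z)%R%:Z).
Proof.
move=> ab.
by case: (sgz_cases (m + k)) => -[h1 ->]; case: (sgz_cases (m - k)) => -[h2 ->]; lia.
Qed.

End SignIdentity.

(** Young's inequality with second factor [1], together with [e <= 4]. *)
Lemma le_logp (R : realType) (a : R) : 0 <= a -> a <= a * logp a + 4.
Proof.
move=> a0; have e4 : expR 1 <= 4 :> R.
  have h : 1 / 2 < 1 :> R by lra.
  have := expR_le_inv h; have -> : 1 - 1 / 2 = 2^-1 :> R by field.
  rewrite invrK => h2.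
  have -> : 1 = 1 / 2 + 1 / 2 :> R by field.
  rewrite expRD; have := expR_ge0 (1 / 2 : R); nra.
by have := young_logp a0 ler01; rewrite mulr1 => h; rewrite (le_trans h)// lerD2l.
Qed.

(** * Hilbert transforms along the diagonals *)

Section DiagonalHilbert.
Context {R : realType}.
Variable l : nat.
Local Notation L := l.+2.
Local Notation C := R[i].
Local Notation X := ('I_L * 'I_L)%type.
Local Open Scope complex_scope.
Variables (I : finType) (fm fk : I -> int) (D : nat).
Hypothesis D0 : (0 < D)%N.
Hypothesis DL : (32 * D ^ 2 <= L)%N.
Hypothesis hD : forall i, (freq fm fk i <= D)%N.

Definition llogl_sum (c : I -> C) : R :=
  \sum_(j : X) modc (pol fm fk c j) * logp (modc (pol fm fk c j)).

Lemma sum_diag (V : zmodType) (F : X -> V) (b : bool) :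
  \sum_j F j = \sum_(u : 'I_L) \sum_(t : 'I_L) F (t, u + (if b then t else - t)).
Proof.
transitivity (\sum_(t : 'I_L) \sum_(u : 'I_L) F (t, u)).
  by rewrite pair_bigA; apply: eq_bigr => -[].
rewrite [RHS]exchange_big; apply: eq_bigr => t _ /=.
by rewrite (reindex_inj (@addIr _ (if b then t else - t))).
Qed.

(** On the line [(t, u + t)] or [(t, u - t)] the polynomial has frequencies [m + k] or [m - k], at
    most [2 D] in size, and the multiplier is the one-variable sign. Zygmund's theorem is applied on
    each of the [L] lines; [8 * (2 D) ^ 2] gives the condition on [L]. *)
Lemma sum_hilbert_diag (b : bool) (c : I -> C) :
  \sum_(j : X) modc (pol fm fk
     (fun i => (sgz (fm i + (if b then fk i else - fk i)))%:~R * c i) j) <=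
  96 * llogl_sum c + 576 * (L ^ 2)%:R.
Proof.
pose fr i := fm i + (if b then fk i else - fk i).
have hfr i : (`|fr i| <= 2 * D)%N by have := hD i; rewrite /freq /fr; case: (b); lia.
rewrite (sum_diag _ b) /llogl_sum (sum_diag _ b).
have E (d : I -> C) (u t : 'I_L) :
    pol fm fk d (t, u + (if b then t else - t)) = trig fr (fun i => d i * chi (fk i) u) t.
  apply: eq_bigr => i _ /=; rewrite chiD.
  have -> : chi (fk i) (if b then t else - t) = chi (if b then fk i else - fk i) t :> C.
    by case: (b); rewrite // chiN.
  by rewrite /fr chi_freqD; ring.
have D0' : (0 < 2 * D)%N by lia.
have DL' : (8 * (2 * D) ^ 2 <= L)%N by rewrite expnMn; lia.
have -> : 576 * (L ^ 2)%:R = \sum_(u : 'I_L) 576 * L%:R :> R.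
  by rewrite sumr_const card_ord -[RHS]mulr_natr natrX; ring.
rewrite mulr_sumr -big_split; apply: ler_sum => u _.
have := @zygmund R l I fr (fun i => c i * chi (fk i) u) (2 * D) D0' DL' hfr.
under eq_bigr do rewrite /hilbert.
under [X in 96 * X]eq_bigr do rewrite -E.
apply: le_trans; rewrite le_eqVlt; apply/orP; left; apply/eqP.
apply: eq_bigr => t _; rewrite E; congr modc; apply: eq_bigr => i _.
by rewrite [in RHS]mulrA.
Qed.

Lemma sum_modc_pol (c : I -> C) :
  \sum_(j : X) modc (pol fm fk c j) <= llogl_sum c + 4 * (L ^ 2)%:R.
Proof.
have -> : 4 * (L ^ 2)%:R = \sum_(j : X) 4 :> R.
  by rewrite sumr_const card_prod card_ord -[RHS]mulr_natr.
rewrite -big_split; apply: ler_sum => j _ /=.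
exact: le_logp (modc_ge0 _).
Qed.

End DiagonalHilbert.

(** * Oscillation of the square partial sums *)

Section RingSums.
Context {R : realType}.
Variable l : nat.
Local Notation L := l.+2.
Local Notation C := R[i].
Local Notation X := ('I_L * 'I_L)%type.
Local Open Scope complex_scope.
Variables (I : finType) (fm fk : I -> int) (c : I -> C).

Definition ring_sum (n : nat) (j : X) : C :=
  \sum_(i | (freq fm fk i <= n)%N) c i * (chi (fm i) j.1 * chi (fk i) j.2).

Let sp i : int := sgz (fm i + fk i) + sgz (fm i - fk i).
Let sm i : int := sgz (fm i + fk i) - sgz (fm i - fk i).
Let cp i : C := (sp i)%:~R * c i.
Let cm i : C := (sm i)%:~R * c i.

Lemma ring_sum_strips a n j :
  (ring_sum (a + n) j - ring_sum a j) * 2 =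
  strip fm fk fm cp a n j - strip fm fk (fun i => - fm i) cp a n j +
  (strip fm fk fk cm a n j - strip fm fk (fun i => - fk i) cm a n j).
Proof.
pose e i : C := chi (fm i) j.1 * chi (fk i) j.2.
have S (g : I -> int) (d : I -> C) : strip fm fk g d a n j =
    \sum_i ((a%:Z < g i <= (a + n)%N%:Z)%R%:Z)%:~R * (d i * e i).
  by rewrite /strip big_mkcond; apply: eq_bigr => i _; case: ifP => _; rewrite ?mul1r ?mul0r.
have Q n' : ring_sum n' j = \sum_i ((freq fm fk i <= n')%N%:Z)%:~R * (c i * e i).
  by rewrite /ring_sum big_mkcond; apply: eq_bigr => i _; case: ifP => _; rewrite ?mul1r ?mul0r.
rewrite !S !Q -!sumrB -big_split mulr_suml; apply: eq_bigr => i _ /=.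
have h := ring_strips (fm i) (fk i) (leq_addr n a).
have {h} := congr1 (fun z : int => z%:~R : C) h.
rewrite -/(freq fm fk i) -/(sp i) -/(sm i) rmorphD !rmorphM !rmorphB/= => h.
rewrite -mulrBl mulrAC h /cp /cm /e /sm rmorphB; ring.
Qed.

(** Four strips contribute [1100] each and the identity carries a factor [2]: [2200 = 4 * 1100 / 2].
    The sum up to [a] goes into the constant. *)
Lemma ring_sum_osc N1 (lambda : R) j :
  strip_bounded fm fk fm cp N1 lambda j ->
  strip_bounded fm fk (fun i => - fm i) cp N1 lambda j ->
  strip_bounded fm fk fk cm N1 lambda j ->
  strip_bounded fm fk (fun i => - fk i) cm N1 lambda j ->
  forall a N, (a + N <= N1)%N ->
    exists z, \sum_(n < N) modc (ring_sum (a + n) j - z) <= 2200 * lambda * N%:R.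
Proof.
move=> H1 H2 H3 H4 a N aN.
have [z1 h1] := H1 a N aN; have [z2 h2] := H2 a N aN.
have [z3 h3] := H3 a N aN; have [z4 h4] := H4 a N aN.
exists (ring_sum a j + (z1 - z2 + (z3 - z4)) / 2).
rewrite (_ : 2200 * lambda * N%:R = (1100 * lambda * N%:R + 1100 * lambda * N%:R +
  (1100 * lambda * N%:R + 1100 * lambda * N%:R)) / 2); last by field.
rewrite ler_pdivlMr//.
rewrite (le_trans _ (lerD (lerD h1 h2) (lerD h3 h4)))// -!big_split mulr_suml.
apply: ler_sum => n _ /=; rewrite -[X in _ * X](@modc_nat R 2) -modcM.
set s1 := strip _ _ _ _ _ _ _; set s2 := strip _ _ _ _ _ _ _.
set s3 := strip _ _ _ _ _ _ _; set s4 := strip _ _ _ _ _ _ _.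
have -> : (ring_sum (a + n) j - (ring_sum a j + (z1 - z2 + (z3 - z4)) / 2)) * 2 =
   ((s1 - z1) - (s2 - z2)) + ((s3 - z3) - (s4 - z4)).
  rewrite opprD addrA mulrBl ring_sum_strips divfK ?pnatr_eq0//.
  by rewrite -/s1 -/s2 -/s3 -/s4; ring.
by rewrite (le_trans (modcD _ _))// lerD// modcB.
Qed.

End RingSums.

(** * The weak type estimate on the grid *)

Section GridWeakType.
Context {R : realType}.
Variable l : nat.
Local Notation L := l.+2.
Local Notation C := R[i].
Local Notation X := ('I_L * 'I_L)%type.
Local Open Scope complex_scope.
Variables (I : finType) (fm fk : I -> int) (c : I -> C) (D : nat).
Hypothesis hD : forall i, (freq fm fk i <= D)%N.

Lemma ring_sum_ge k (j : X) : (D <= k)%N -> ring_sum fm fk c k j = ring_sum fm fk c D j.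
Proof.
by move=> Dk; apply: eq_bigl => i; rewrite hD (leq_trans (hD i)).
Qed.

(** Summation by parts: a frequency enters the partial sums from the index [freq] on, and the
    weights from there on add up to [a / (a + freq)]. *)
Lemma sum_wt_ring_sum (a : R) K (j : X) : 0 < a -> (D <= K)%N ->
  \sum_(k < K) (wt a k)%:C * ring_sum fm fk c k j +
    (a / (a + K%:R))%:C * ring_sum fm fk c D j = a%:C * resolvent fm fk a c j.
Proof.
move=> a0 DK; pose e i : C := c i * (chi (fm i) j.1 * chi (fk i) j.2).
have Q n : ring_sum fm fk c n j = \sum_i (freq fm fk i <= n)%N%:R * e i.
  by rewrite /ring_sum big_mkcond; apply: eq_bigr => i _; case: ifP => _; rewrite ?mul1r ?mul0r.
under eq_bigr do rewrite Q mulr_sumr.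
rewrite exchange_big Q mulr_sumr -big_split /resolvent -polZ; apply: eq_bigr => i _ /=.
rewrite hD mul1r -!mulrA -/(e i) mulrA -rmorphM (sum_wt a0 (leq_trans (hD i) DK)).
rewrite rmorphD mulrDl; congr (_ + _).
rewrite rmorph_sum mulr_suml -(big_mkord xpredT (fun k => (wt a k)%:C * ((freq fm fk i <= k)%N%:R * e i))).
rewrite (@big_cat_nat _ _ _ (freq fm fk i))//=; last exact: leq_trans (hD i) DK.
rewrite big_nat_cond big1 ?add0r; last first.
  by move=> k; rewrite andbT => /andP[_ h]; rewrite leqNgt h mul0r mulr0.
by apply: eq_big_nat => k /andP[-> _]; rewrite mul1r.
Qed.

(** Oscillation is needed on blocks of length up to [2 ^ (2 D) * N], because [mean_bound] doubles
    [n + 1] until the partial sums have become constant. This only makes [L] large: the constants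
    depend on neither [D] nor [N]. *)
Theorem grid_weak_type (N : nat) (lambda : R) : (0 < D)%N ->
  (2 ^ D.*2 * N + 32 * D ^ 2 < L)%N -> 0 < lambda ->
  exists B : {set X},
    lambda * #|B|%:R <= 30 * 1000 * (llogl_sum l fm fk c + (L ^ 2)%:R) /\
    forall j : X, j \notin B ->
    (forall a J, (a + J <= N)%N -> exists z,
       \sum_(n < J) modc (ring_sum fm fk c (a + n) j - z) <= 2200 * lambda * J%:R) /\
    (forall n, (n < N)%N ->
       modc (avg (fun k => ring_sum fm fk c k j) n.+1) <= 100 * (1000 * lambda)).
Proof.
move=> D0 hL la0; pose N1 := (2 ^ D.*2 * N)%N.
have DD : (D <= D ^ 2)%N by rewrite -[X in (X <= _)%N]expn1 leq_pexp2l.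
have NN : (N <= N1)%N by rewrite leq_pmull// expn_gt0.
have hL1 : (N1 + D < L)%N by rewrite /N1; lia.
have hL2 : (32 * D ^ 2 <= L)%N by lia.
have hL4 : (4 * D <= L)%N by lia.
set cp := fun i => (sgz (fm i + fk i) + sgz (fm i - fk i))%:~R * c i.
set cm := fun i => (sgz (fm i + fk i) - sgz (fm i - fk i))%:~R * c i.
have [B1 [hB1 h1]] := weak_strips2 cp cm hD hL1 la0.
have [B2 [hB2 h2]] := resolvent_weak N c hD hL4 la0.
set Lam := llogl_sum l fm fk c.
have Hp := sum_hilbert_diag D0 hL2 hD true c.
have Hm := sum_hilbert_diag D0 hL2 hD false c.
rewrite -/Lam /= in Hp Hm.
have hcp : \sum_(j : X) modc (pol fm fk cp j) <= 192 * Lam + 1152 * (L ^ 2)%:R.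
  have hj (j : X) : modc (pol fm fk cp j) <=
      modc (pol fm fk (fun i => (sgz (fm i + fk i))%:~R * c i) j) +
      modc (pol fm fk (fun i => (sgz (fm i - fk i))%:~R * c i) j).
    rewrite (_ : pol fm fk cp j =
      pol fm fk (fun i => (sgz (fm i + fk i))%:~R * c i) j +
      pol fm fk (fun i => (sgz (fm i - fk i))%:~R * c i) j); first exact: modcD.
    by rewrite -polD; apply: eq_bigr => i _; rewrite /cp rmorphD -mulrDl.
  rewrite (le_trans (ler_sum _ (fun (j : X) _ => hj j)))// big_split.
  by rewrite (le_trans (lerD Hp Hm))//; lra.
have hcm : \sum_(j : X) modc (pol fm fk cm j) <= 192 * Lam + 1152 * (L ^ 2)%:R.
  have hj (j : X) : modc (pol fm fk cm j) <=
      modc (pol fm fk (fun i => (sgz (fm i + fk i))%:~R * c i) j) +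
      modc (pol fm fk (fun i => (sgz (fm i - fk i))%:~R * c i) j).
    rewrite (_ : pol fm fk cm j =
      pol fm fk (fun i => (sgz (fm i + fk i))%:~R * c i) j -
      pol fm fk (fun i => (sgz (fm i - fk i))%:~R * c i) j); first exact: modcB.
    by rewrite -mulN1r -polZ -polD; apply: eq_bigr => i _; rewrite /cm rmorphB; ring.
  rewrite (le_trans (ler_sum _ (fun (j : X) _ => hj j)))// big_split.
  by rewrite (le_trans (lerD Hp Hm))//; lra.
have hc := sum_modc_pol l fm fk c; rewrite -/Lam in hc.
have Lam0 : 0 <= Lam.
  apply: sumr_ge0 => j _; rewrite mulr_ge0 ?modc_ge0//.
  by rewrite /logp; case: ifP => // h; rewrite ln_ge0// ltW.
have L20 : 0 <= (L ^ 2)%:R :> R by [].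
exists (B1 :|: B2)%SET; split.
  have hU : #|B1 :|: B2|%:R <= #|B1|%:R + #|B2|%:R :> R.
    by rewrite -natrD ler_nat cardsU leq_subr.
  rewrite (le_trans (ler_wpM2l (ltW la0) hU))// mulrDr.
  by rewrite (le_trans (lerD hB1 hB2))//; lra.
move=> j; rewrite inE negb_or => /andP[jB1 jB2].
have [s1 s2 s3 s4] := h1 j jB1.
have osc := ring_sum_osc s1 s2 s3 s4.
split=> [a J aJ|n nN]; first exact: osc (leq_trans aJ NN).
pose K := (2 ^ D.*2 * n.+1)%N.
have KD : (D.*2 <= K)%N.
  by rewrite (leq_trans (ltnW (ltn_expl D.*2 (isT : 1 < 2)%N)))// leq_pmulr.
have mb := @mean_bound R (fun k => ring_sum fm fk c k j) (ring_sum fm fk c D j)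
  (4400 * lambda) n D D.*2.
have {}mb := mb _ (fun k Dk => ring_sum_ge j Dk) KD.
have DK : (D <= K)%N by rewrite (leq_trans _ KD)// -addnn leq_addr.
have E := sum_wt_ring_sum j (ltr0Sn R n) DK.
move: mb; rewrite -/K; move: (K) DK E => K' DK E mb.
rewrite {}E (rmorph_nat (real_complex R)) in mb.
rewrite (le_trans (_ : _ <= modc (n.+1%:R * resolvent fm fk n.+1%:R c j) +
  modc (n.+1%:R * resolvent fm fk n.+1%:R c j - avg (fun k => ring_sum fm fk c k j) n.+1)))//.
  set x := _ * _; set y := avg _ _.
  by rewrite -[y in leLHS](subKr x) (le_trans (modcB _ _)).
set x := n.+1%:R * resolvent _ _ _ _ _ in mb *; set y := avg _ n.+1 in mb *.
(* Oscillation about the block average instead of [z] turns [2200] into [4400], and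
   [21 * 4400 + 2 <= 100 * 1000]. *)
suff prem : modc (x - y) <= 21 * (4400 * lambda).
  have hx : modc x <= 2 * lambda := h2 j jB2 n (ltnW nN).
  by clear - hx prem la0; lra.
apply: mb => i ie; set M := (2 ^ i * n.+1)%N; cbv zeta.
have MN1 : (M <= N1)%N.
  by rewrite leq_mul// leq_exp2l.
have [z hz] := osc 0%N M MN1.
have M0 : (0 < M)%N by rewrite muln_gt0 expn_gt0.
have hav := @avg_dist R (fun k => ring_sum fm fk c k j) z M _ M0 hz.
apply: (@le_trans _ _ (\sum_(k < M) (modc (ring_sum fm fk c (0 + k) j - z) + 2200 * lambda))).
  apply: ler_sum => k _; rewrite (le_trans (modc_triangle z _ _))// lerD2l.
  by rewrite modcBC.
rewrite big_split/= sumr_const card_ord -[_ *+ M]mulr_natr (le_trans (lerD hz (lexx _)))//.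
rewrite -mulrDl ler_wpM2r//; lra.
Qed.

End GridWeakType.

(** * Translation invariance of the plane measure *)

Section Translation.
Context {R : realType}.
Local Notation mu := (@lebesgue_measure R).
Local Notation T := (measurableTypeR R).

Lemma mu2_setX (A B : set T) : measurable A -> measurable B ->
  mu2 (A `*` B) = (mu A * mu B)%E.
Proof. exact: product_measure1E. Qed.

Lemma measurable_translate (v : R) :
  measurable_fun setT ((fun x => x + v) : T -> T).
Proof. exact: measurable_funD. Qed.

Lemma lebesgue_measure_translate (v : R) (A : set T) : measurable A ->
  mu ((fun x => x + v) @^-1` A) = mu A.
Proof.
move=> mA.
rewrite -[LHS]/(pushforward mu ((fun x => x + v) : T -> T) A).
apply/esym/lebesgue_measure_unique => //=; first exact: measurable_translate.
move=> _ _ [[a b]] _ <-.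
rewrite /pushforward/=.
rewrite (_ : ((fun x => x + v) : T -> T) @^-1` _ = `]a - v, b - v]%classic).
  rewrite !lebesgue_measure_itv/= !lte_fin ltrD2r.
  by case: ifP => // _; rewrite -!EFinB; congr EFin; ring.
by apply/seteqP; split=> x /=; rewrite !in_itv/= ltrBlDr lerBrDr.
Qed.

Definition shift2 (v p : plane R) : plane R := (p.1 + v.1, p.2 + v.2).

Lemma measurable_shift2 v : measurable_fun setT (shift2 v).
Proof.
by apply/measurable_fun_pairP; split; apply: measurable_funD.
Qed.

Lemma mu2_shift2 (v : plane R) (A : set (plane R)) : measurable A ->
  mu2 (shift2 v @^-1` A) = mu2 A.
Proof.
move=> mA.
rewrite -[LHS]/(pushforward mu2 (shift2 v) A) /mu2.
apply/esym/product_measure_unique => //; first exact: measurable_shift2.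
move=> mshift A1 A2 mA1 mA2.
rewrite -[LHS]/(mu2 (((fun x : T => x + v.1) @^-1` A1) `*` ((fun x : T => x + v.2) @^-1` A2))).
have m1 : measurable ((fun x : T => x + v.1) @^-1` A1).
  by rewrite -[X in measurable X]setTI; exact: measurable_translate.
have m2 : measurable ((fun x : T => x + v.2) @^-1` A2).
  by rewrite -[X in measurable X]setTI; exact: measurable_translate.
by rewrite mu2_setX// !lebesgue_measure_translate.
Qed.

Lemma integral_shift2 (v : plane R) (f : plane R -> \bar R) :
  measurable_fun setT f -> (forall p, (0 <= f p)%E) ->
  (\int[mu2]_p f (shift2 v p) = \int[mu2]_p f p)%E.
Proof.
move=> mf f0.
have E := @ge0_integral_pushforward _ _ _ _ R (shift2 v) (measurable_shift2 v) mu2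
  setT f measurableT mf (fun p _ => f0 p).
rewrite preimage_setT in E; apply: etrans (esym E) _.
apply: eq_measure_integral; first exact: measurable_shift2.
move=> mshift A mA _; exact: mu2_shift2 mA.
Qed.

End Translation.

(** * Transfer from the grid to the torus *)

Section GridCells.
Context {R : realType}.
Variable l : nat.
Local Notation L := l.+2.
Local Notation X := ('I_L * 'I_L)%type.
Local Notation h := (pi *+ 2 / L%:R : R).

Definition node (j : X) : plane R := (ang j.1, ang j.2).

Definition cell : set (plane R) :=
  [set p : plane R | (- pi <= p.1 < - pi + h) && (- pi <= p.2 < - pi + h)].

Lemma measurable_cell : measurable cell.
Proof.
have -> : cell = `[- pi, - pi + h[ `*` `[- pi, - pi + h[.
  by apply/seteqP; split => p /=; rewrite /cell /= !in_itv/=; [move=> /andP[]|move=> [-> ->]].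
exact: measurableX.
Qed.

Lemma mu2_cell : mu2 cell = (h ^+ 2)%:E.
Proof.
have -> : cell = `[- pi, - pi + h[ `*` `[- pi, - pi + h[.
  by apply/seteqP; split => p /=; rewrite /cell /= !in_itv/=; [move=> /andP[]|move=> [-> ->]].
have h0 : 0 < h by rewrite divr_gt0 ?ltr0n// pmulrn_lgt0// pi_gt0.
rewrite mu2_setX// !lebesgue_measure_itv/= lte_fin ltrDl h0.
by rewrite -EFinD -EFinM addrAC subrr add0r expr2.
Qed.

Lemma cell_cover (p : plane R) : torus2 p ->
  exists j, cell (p.1 - (node j).1, p.2 - (node j).2).
Proof.
have h0 : 0 < h by rewrite divr_gt0 ?ltr0n// pmulrn_lgt0// pi_gt0.
have H (x : R) : - pi <= x < pi -> exists i : 'I_L, - pi <= x - ang i < - pi + h.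
  move=> /andP[x1 x2].
  have y0 : 0 <= (x + pi) / h by rewrite divr_ge0 ?(ltW h0)//; lra.
  have /andP[t1 t2] := truncn_itv y0.
  have tL : (Num.truncn ((x + pi) / h) < L)%N.
    rewrite -(ltr_nat R) (le_lt_trans t1)// ltr_pdivrMr//.
    have -> : L%:R * h = pi *+ 2 by rewrite mulrC divfK// pnatr_eq0.
    by rewrite mulr2n; lra.
  exists (Ordinal tL); rewrite /ang/=.
  have -> : pi *+ 2 * (Num.truncn ((x + pi) / h))%:R / L%:R = (Num.truncn ((x + pi) / h))%:R * h by ring.
  move: t1 t2; rewrite ler_pdivlMr// ltr_pdivrMr// -(natr1 (Num.truncn _)) (mulrDl _ 1) mul1r.
  set q := _ * h; move: (q) => {}q; set hh := pi *+ 2 / L%:R; move: (hh) => {}hh t1 t2.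
  by rewrite lerBrDl ltrBlDr -addrA; apply/andP; split; lra.
case: p => x y [/= hx hy]; rewrite !in_itv/= in hx hy.
have [i hi] := H _ hx; have [k hk] := H _ hy.
by exists (i, k); rewrite /cell/= hi hk.
Qed.

Lemma grid_integral (g : plane R -> \bar R) : measurable_fun setT g ->
  (forall p, (0 <= g p)%E) ->
  (\int[mu2]_(p in torus2) g p <=
   \int[mu2]_(p in cell) \sum_(j : X) g (shift2 (node j) p))%E.
Proof.
move=> mg g0.
have mt : measurable (torus2 : set (plane R)) by exact: measurableX.
pose k p := (g \_ cell) p.
pose gc (j : X) := (fun p => g p * (\1_cell (shift2 (- (node j).1, - (node j).2) p))%:E)%E.
have m1 (v : plane R) : measurable_fun setT (fun p : plane R => (\1_cell (shift2 v p) : R)%:E).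
  apply/measurable_EFinP; apply: (measurableT_comp _ (measurable_shift2 v)).
  exact: measurable_indic measurable_cell.
have mgc j : measurable_fun setT (gc j) by apply: emeasurable_funM.
have gc0 j p : (0 <= gc j p)%E by rewrite /gc mule_ge0// lee_fin.
apply: (@le_trans _ _ (\int[mu2]_p \sum_(j : X) gc j p)%E).
  rewrite integral_mkcond; apply: ge0_le_integral => //.
  - by move=> p _; apply: erestrict_ge0.
  - by apply/(measurable_restrictT _ _).1 => //; exact: measurable_funS mg.
  - exact: emeasurable_sum.
  move=> p _; rewrite patchE; case: ifPn => [|_]; last by apply: sume_ge0.
  rewrite inE => /cell_cover[j hj].
  rewrite (bigD1 j)//= [X in (X + _)%E](_ : _ = g p) ?leeDl ?sume_ge0//.
  by rewrite /gc indicE mem_set ?mule1// /shift2.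
rewrite ge0_integral_sum// [leRHS]ge0_integral_sum//; last 2 first.
- exact: measurable_cell.
- move=> j; apply: (@measurable_funS _ _ _ _ setT) => //.
  by apply: measurableT_comp => //; exact: measurable_shift2.
rewrite le_eqVlt; apply/orP; left; apply/eqP; apply: eq_bigr => j _.
rewrite -(integral_shift2 (node j))// [RHS]integral_mkcond.
apply: eq_integral => p _; rewrite patchE /gc.
have -> : shift2 (- (node j).1, - (node j).2) (shift2 (node j) p) = p.
  by case: p => x y; rewrite /shift2/= !addrK.
by rewrite indicE; case: ifP => _; rewrite ?mule1 ?mule0.
Qed.

(** Averaging over translates of the grid: the measure is at most the integral, over one cell, of
    the number of points of the translated grid lying in [E]. A bound on this number uniform in the
    translation is multiplied by the area of the cell. *)
Lemma measure_grid (E : set (plane R)) (M : R) : measurable E -> 0 <= M ->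
  (forall p, (#|[set j : X | shift2 (node j) p \in E]%SET|)%:R <= M) ->
  (mu2 (E `&` torus2) <= (h ^+ 2 * M)%:E)%E.
Proof.
move=> mE M0 H.
have mt : measurable (torus2 : set (plane R)) by exact: measurableX.
have m1 : measurable_fun setT (fun p : plane R => (\1_E p : R)%:E).
  by apply/measurable_EFinP; exact: measurable_indic.
have -> : mu2 (E `&` torus2) = (\int[mu2]_(p in torus2) (\1_E p)%:E)%E.
  by rewrite integral_indic.
apply: (le_trans (grid_integral m1 _)).
  by move=> p; rewrite lee_fin.
apply: (@le_trans _ _ (\int[mu2]_(p in cell) M%:E)%E).
  apply: ge0_le_integral => //.
  - exact: measurable_cell.
  - by move=> p _; apply: sume_ge0 => j _; rewrite lee_fin.
  - apply: (@measurable_funS _ _ _ _ setT) => //.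
    apply: emeasurable_sum => j.
    exact: (measurableT_comp m1 (measurable_shift2 _)).
  move=> p _; rewrite sumEFin lee_fin (le_trans _ (H p))//.
  rewrite -sum1_card natr_sum [leRHS]big_mkcond/=.
  by apply: ler_sum => j _; rewrite indicE inE; case: (_ \in E).
by rewrite integral_cst ?mu2_cell -?EFinM 1?mulrC//; exact: measurable_cell.
Qed.

End GridCells.

(** * Mean oscillation of complex functions *)

Section Oscillation.
Context {R : realType}.
Local Notation mu := (@lebesgue_measure R).
Local Notation C := R[i].
Local Open Scope complex_scope.

Lemma measurable_modc d (T : measurableType d) (D : set T) (g : T -> C) :
  measurable_fun D (fun t => complex.Re (g t)) ->
  measurable_fun D (fun t => complex.Im (g t)) ->
  measurable_fun D (fun t => modc (g t)).
Proof.
move=> mRe mIm.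
have -> : (fun t => modc (g t)) =
    Num.sqrt \o (fun t => complex.Re (g t) ^+ 2 + complex.Im (g t) ^+ 2).
  by apply/funext => t; rewrite /modc /=; case: (g t).
have ms : measurable_fun setT (Num.sqrt : R -> R).
  exact: continuous_measurable_fun (@sqrt_continuous R).
by apply: measurableT_comp => //; apply: measurable_funD; exact: measurable_funX.
Qed.

(** The factor [2] comes from bounding the real and imaginary parts separately. *)
Lemma modc_cintegral d (T : measurableType d) (nu : {measure set T -> \bar R})
    (D : set T) (g : T -> C) : measurable D ->
  nu.-integrable D (EFin \o (fun t => complex.Re (g t))) ->
  nu.-integrable D (EFin \o (fun t => complex.Im (g t))) ->
  ((modc (cintegral nu D g))%:E <= 2%:E * \int[nu]_(t in D) (modc (g t))%:E)%E.
Proof.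
move=> mD iRe iIm.
have mm : measurable_fun D (fun t => modc (g t)).
  by apply: measurable_modc; [move/integrableP: iRe => [/measurable_EFinP]|
    move/integrableP: iIm => [/measurable_EFinP]].
have key (u : T -> R) : nu.-integrable D (EFin \o u) -> (forall t, `|u t| <= modc (g t)) ->
    ((`|\int[nu]_(t in D) u t|)%:E <= \int[nu]_(t in D) (modc (g t))%:E)%E.
  move=> iu hu; rewrite EFin_normr_Rintegral//.
  rewrite (le_trans (le_abse_integral _ _ _))//; first by case/integrableP: iu.
  apply: ge0_le_integral => //.
  - by apply: measurableT_comp => //; case/integrableP: iu.
  - by apply/measurable_EFinP.
  - by move=> t _; rewrite lee_fin hu.
rewrite (le_trans (_ : _ <= (`|\int[nu]_(t in D) complex.Re (g t)|)%:E +
    (`|\int[nu]_(t in D) complex.Im (g t)|)%:E)%E)//.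
  by rewrite -EFinD lee_fin; exact: modc_ReIm.
have -> : (2%:E * \int[nu]_(t in D) (modc (g t))%:E = \int[nu]_(t in D) (modc (g t))%:E +
   \int[nu]_(t in D) (modc (g t))%:E :> \bar R)%E by rewrite mule_natl mule2n.
by apply: leeD; apply: key => // t; [exact: Re_modc|exact: Im_modc].
Qed.

(** Any constant may replace the mean: the mean is within [2 * E] of [z] by [modc_cintegral], so the
    constant is [1 + 2]. *)
Lemma oscillation_le (g : R -> C) (I : interval R) (z : C) (E : R) :
  0 < len I ->
  mu.-integrable [set` I] (EFin \o (fun t => complex.Re (g t))) ->
  mu.-integrable [set` I] (EFin \o (fun t => complex.Im (g t))) ->
  (\int[mu]_(t in [set` I]) (modc (g t - z))%:E <= (E * len I)%:E)%E ->
  (oscillation g I <= (3 * E)%:E)%E.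
Proof.
move=> I0 iRe iIm hE.
have mI : measurable ([set` I] : set (measurableTypeR R)) by exact: measurable_itv.
have muI : mu [set` I] = (len I)%:E.
  rewrite /len fineK// ge0_fin_numE// ltNge leye_eq; apply/eqP => h.
  by move: I0; rewrite /len h/= ltxx.
have fI : (mu [set` I] < +oo)%E by rewrite muI ltry.
have icst (r : R) : mu.-integrable [set` I] (EFin \o (fun=> r)).
  apply: measurable_bounded_integrable => //; exists `|r|; split; first exact: normr_real.
  by move=> x rx t _ /=; exact: ltW.
set W := (\int[mu]_(t in _) _)%E in hE.
have mRe : measurable_fun [set` I] (fun t : measurableTypeR R => complex.Re (g t)) by case/integrableP: iRe => /measurable_EFinP.
have mIm : measurable_fun [set` I] (fun t : measurableTypeR R => complex.Im (g t)) by case/integrableP: iIm => /measurable_EFinP.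
have mB (w : C) : measurable_fun [set` I] (fun t : measurableTypeR R => modc (g t - w)).
  apply: measurable_modc.
    rewrite (_ : (fun t => _) = (fun t => complex.Re (g t) - complex.Re w)).
      exact: measurable_funB.
    by apply/funext => t; rewrite ReD ReN.
  rewrite (_ : (fun t => _) = (fun t => complex.Im (g t) - complex.Im w)).
    exact: measurable_funB.
  by apply/funext => t; rewrite ImD ImN.
have hz : modc (mean g I - z) <= 2 * E.
  have -> : mean g I - z = ((len I)^-1)%:C * cintegral mu [set` I] (fun t => g t - z).
    apply: complexP.
      rewrite ReD ReN !ReZ /=; under [in RHS]eq_Rintegral do rewrite ReD ReN.
      by rewrite RintegralB// Rintegral_cst// -/(len I) mulrBr [in X in _ = _ - X]mulrCA mulVf ?mulr1// gt_eqF.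
    rewrite ImD ImN !ImZ /=; under [in RHS]eq_Rintegral do rewrite ImD ImN.
    by rewrite RintegralB// Rintegral_cst// -/(len I) mulrBr [in X in _ = _ - X]mulrCA mulVf ?mulr1// gt_eqF.
  rewrite modcM modcR gtr0_norm ?invr_gt0// ler_pdivrMl//.
  have i1 : mu.-integrable [set` I] (EFin \o (fun t => complex.Re (g t - z))).
    have -> : (EFin \o (fun t => complex.Re (g t - z))) = ((EFin \o (fun t => complex.Re (g t))) \- (EFin \o (fun=> complex.Re z)))%E.
      by apply/funext => t /=; rewrite ReD ReN.
    exact: integrableB.
  have i2 : mu.-integrable [set` I] (EFin \o (fun t => complex.Im (g t - z))).
    have -> : (EFin \o (fun t => complex.Im (g t - z))) = ((EFin \o (fun t => complex.Im (g t))) \- (EFin \o (fun=> complex.Im z)))%E.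
      by apply/funext => t /=; rewrite ImD ImN.
    exact: integrableB.
  have := modc_cintegral mI i1 i2; rewrite -/W => h.
  rewrite -lee_fin (le_trans h)// (le_trans (lee_wpmul2l _ hE))//.
  by rewrite -EFinM lee_fin [leRHS]mulrC mulrA.
rewrite /oscillation.
have : (\int[mu]_(t in [set` I]) (modc (g t - mean g I))%:E <= (3 * E * len I)%:E)%E.
  apply: (@le_trans _ _ (\int[mu]_(t in [set` I]) ((modc (g t - z))%:E + (2 * E)%:E))%E).
    have E0 : 0 <= 2 * E by exact: le_trans (modc_ge0 _) hz.
    apply: ge0_le_integral => //.
    - by move=> t _; rewrite lee_fin modc_ge0.
    - by apply/measurable_EFinP; exact: mB.
    - by apply: emeasurable_funD => //; apply/measurable_EFinP; exact: mB.
    move=> t _; rewrite -EFinD lee_fin (le_trans (modc_triangle z _ _))// lerD2l.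
    by rewrite modcBC.
  rewrite ge0_integralD//; last 3 first.
  - by move=> t _; rewrite lee_fin modc_ge0.
  - by apply/measurable_EFinP; exact: mB.
  - by move=> t _; rewrite lee_fin (le_trans (modc_ge0 _) hz).
  rewrite integral_cst// [X in (_ + _ * X)%E](_ : _ = (len I)%:E); last exact: muI.
  rewrite -EFinM (le_trans (leeD hE (lexx _)))// -EFinD lee_fin; lra.
move=> h.
rewrite (le_trans (lee_wpmul2l _ h))// ?lee_fin ?invr_ge0 ?(ltW I0)//.
by rewrite mulrC mulfK// gt_eqF.
Qed.

End Oscillation.

(** * Step functions on the unit interval *)

Section StepFunctions.
Context {R : realType}.
Local Notation mu := (@lebesgue_measure R).
Local Notation T := (measurableTypeR R).
Local Notation C := R[i].
Local Open Scope complex_scope.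
Variables (n : nat).
Local Notation M := n.+1.
Implicit Types (r w : nat -> R) (xi : nat -> C) (t : R).

Definition rstep r (t : R) : R := \sum_(k < M) r k * \1_(delta n k) t.

Lemma measurable_delta k : measurable (delta n k : set T).
Proof. exact: measurable_itv. Qed.

Lemma mu_delta k : mu (delta n k) = (M%:R^-1)%:E.
Proof.
have M0 : 0 < M%:R :> R by rewrite ltr0n.
rewrite /delta lebesgue_measure_itv/= lte_fin ltr_pM2r ?invr_gt0// ltr_nat ltnSn.
by rewrite -EFinB -mulrBl -natrB// subSnn mul1r.
Qed.

Lemma delta01 k : (k < M)%N -> (delta n k : set R) `<=` `[0%R, 1%R].
Proof.
move=> kM t; rewrite /delta/= !in_itv/= => /andP[t1 t2]; apply/andP; split.
  by rewrite (le_trans _ t1)// divr_ge0.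
by rewrite (le_trans t2)// ler_pdivrMr ?ltr0n// mul1r ler_nat.
Qed.

Lemma measurable_rstep r : measurable_fun setT (rstep r : T -> R).
Proof.
apply: measurable_sum => k; apply: measurable_funM => //.
exact: measurable_indic (measurable_delta k).
Qed.

Lemma integrable_rstep r (D : set T) : measurable D -> (mu D < +oo)%E ->
  mu.-integrable D (EFin \o rstep r).
Proof.
move=> mD fD; apply: measurable_bounded_integrable => //.
  exact: measurable_funS (measurable_rstep r).
exists (\sum_(k < M) `|r k|); split; first exact: num_real.
move=> x hx t _ /=; rewrite (le_trans _ (ltW hx))// (le_trans (ler_norm_sum _ _ _))//.
apply: ler_sum => k _; rewrite normrM ler_piMr// indicE.
by case: (_ \in _); rewrite ?normr1 ?normr0.
Qed.

Lemma Rintegral_rstep r : \int[mu]_(t in `[0%R, 1%R]) rstep r t = M%:R^-1 * \sum_(k < M) r k.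
Proof.
have m01 : measurable (`[0%R, 1%R]%classic : set T) by exact: measurable_itv.
have i1 (k : 'I_M) : mu.-integrable `[0%R, 1%R] (EFin \o (\1_(delta n k) : T -> R)).
  apply: measurable_bounded_integrable => //.
  - by change (mu `[0%R, 1%R] < +oo)%E; rewrite lebesgue_measure_itv/= lte01 oppr0 adde0 ltry.
  - exact: measurable_indic (measurable_delta k).
  - exists 1; split; first exact: num_real.
    by move=> x hx t _ /=; rewrite (le_trans _ (ltW hx))// indicE; case: (_ \in _); rewrite ?normr1 ?normr0.
rewrite /Rintegral.
transitivity (fine (\sum_(k < M) \int[mu]_(t in `[0%R, 1%R]) ((r k)%:E * (\1_(delta n k) t)%:E))%E).
  rewrite -integral_sum//; last by move=> k; exact: integrableZl (i1 k).
  congr fine; apply: eq_integral => t _; rewrite /rstep -sumEFin.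
  by apply: eq_bigr => k _; rewrite EFinM.
rewrite (eq_bigr (fun k : 'I_M => (r k / M%:R)%:E)).
  by rewrite sumEFin/= mulr_sumr; apply: eq_bigr => k _; rewrite mulrC.
move=> k _; rewrite integralZl//; last exact: i1.
rewrite integral_indic//; last exact: measurable_delta.
rewrite setIidl; last exact: delta01.
by rewrite [X in (_ * X)%E](_ : _ = (M%:R^-1)%:E) ?EFinM//; exact: mu_delta.
Qed.

Lemma integral_rstep_le w (D : set T) : measurable D -> (forall k, 0 <= w k) ->
  (\int[mu]_(t in D) (rstep w t)%:E <= (M%:R^-1 * \sum_(k < M) w k)%:E)%E.
Proof.
move=> mD w0.
rewrite (eq_integral (fun t : T => \sum_(k < M) ((w k)%:E * (\1_(delta n k) t)%:E)%E)%E); last first.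
  by move=> t _; rewrite /rstep -sumEFin; apply: eq_bigr => k _; rewrite EFinM.
have mI k : measurable_fun D (fun t : T => (\1_(delta n k) t : R)%:E).
  by apply/measurable_EFinP; exact: measurable_indic (measurable_delta k).
rewrite ge0_integral_sum//; last 2 first.
- by move=> k; apply: emeasurable_funM.
- by move=> k t _; rewrite mule_ge0 ?lee_fin.
rewrite mulr_sumr -sumEFin; apply: lee_sum => k _.
rewrite ge0_integralZl//; last by rewrite lee_fin.
rewrite mulrC EFinM lee_wpmul2l ?lee_fin// integral_indic//; last exact: measurable_delta.
rewrite -(mu_delta k); apply: le_measure; rewrite ?inE//.
- by apply: measurableI => //; exact: measurable_delta.
- exact: measurable_delta.
Qed.

Lemma Re_step xi t : complex.Re (step_fun xi n t) = rstep (fun k => complex.Re (xi k)) t.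
Proof.
by rewrite /step_fun Re_sum; apply: eq_bigr => k _; rewrite mulrC ReZ mulrC.
Qed.

Lemma Im_step xi t : complex.Im (step_fun xi n t) = rstep (fun k => complex.Im (xi k)) t.
Proof.
by rewrite /step_fun Im_sum; apply: eq_bigr => k _; rewrite mulrC ImZ mulrC.
Qed.

Lemma cintegral_step xi : cintegral mu `[0%R, 1%R] (step_fun xi n) = avg xi M.
Proof.
rewrite /cintegral; under eq_Rintegral do rewrite Re_step.
under [X in _ +i* X]eq_Rintegral do rewrite Im_step.
rewrite !Rintegral_rstep /avg -(rmorph_nat (real_complex R)) -fmorphV.
by apply: complexP; rewrite ?ReZ ?ImZ ?Re_sum ?Im_sum.
Qed.

(** At these points closed neighbouring cells overlap and [step_fun] adds two values. They form a
    null set; away from it a point [t] of the unit interval lies only in the cell numbered by the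
    integer part of [t * M], and [t = 1] is excluded. *)
Definition nodes : set T := range (fun k : nat => k%:R / M%:R).

Lemma countable_nodes : countable nodes.
Proof. exact: card_image_le. Qed.

Lemma indic_delta t k : 0 <= t -> ~ nodes t ->
  \1_(delta n k) t = (k == Num.truncn (t * M%:R))%:R :> R.
Proof.
move=> t0 tN; have M0 : 0 < M%:R :> R by rewrite ltr0n.
have t0M : 0 <= t * M%:R by rewrite mulr_ge0// ltW.
have /andP[h1 h2] := truncn_itv t0M; set q := Num.truncn _ in h1 h2 *.
rewrite indicE; congr ((nat_of_bool _)%:R); apply/idP/idP.
  rewrite inE /delta/= in_itv/= ler_pdivrMr// ler_pdivlMr// => /andP[k1 k2].
  have k3 : t * M%:R < k.+1%:R.
    rewrite lt_neqAle k2 andbT; apply/eqP => h; apply: tN; exists k.+1 => //.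
    by rewrite -h mulfK// gt_eqF.
  have qk : (q < k.+1)%N by rewrite -(ltr_nat R) (le_lt_trans h1).
  have kq : (k < q.+1)%N by rewrite -(ltr_nat R) (le_lt_trans k1).
  by apply/eqP; lia.
move=> /eqP ->; rewrite inE /delta/= in_itv/= ler_pdivrMr// ler_pdivlMr//.
by rewrite h1 ltW.
Qed.

Lemma truncn_lt t : 0 <= t <= 1 -> ~ nodes t -> (Num.truncn (t * M%:R) < M)%N.
Proof.
move=> /andP[t0 t1] tN; rewrite truncn_lt_nat ?mulr_ge0//.
rewrite gtr_pMl ?ltr0n// lt_neqAle t1 andbT; apply/eqP => h; apply: tN.
by exists M => //; rewrite h divff.
Qed.

Lemma step_funE xi t : 0 <= t <= 1 -> ~ nodes t ->
  step_fun xi n t = xi (Num.truncn (t * M%:R)).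
Proof.
move=> t01 tN; have /andP[t0 _] := t01; have q := truncn_lt t01 tN.
rewrite /step_fun (bigD1 (Ordinal q))//= big1 ?addr0; last first.
  move=> k; rewrite -val_eqE/= => hk.
  by rewrite indic_delta// (negbTE hk) mulr0.
by rewrite indic_delta// eqxx mulr1.
Qed.

Lemma rstepE r t : 0 <= t <= 1 -> ~ nodes t -> rstep r t = r (Num.truncn (t * M%:R)).
Proof.
move=> t01 tN; have /andP[t0 _] := t01; have q := truncn_lt t01 tN.
rewrite /rstep (bigD1 (Ordinal q))//= big1 ?addr0; last first.
  move=> k; rewrite -val_eqE/= => hk.
  by rewrite indic_delta// (negbTE hk) mulr0.
by rewrite indic_delta// eqxx mulr1.
Qed.

End StepFunctions.

(** * From block oscillations to the BMO norm *)

Section BMOStep.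
Context {R : realType}.
Local Notation mu := (@lebesgue_measure R).
Local Notation T := (measurableTypeR R).
Local Notation C := R[i].
Local Open Scope complex_scope.
Variables (n : nat) (xi : nat -> C) (lambda : R).
Local Notation M := n.+1.
Hypothesis la0 : 0 <= lambda.
Hypothesis blocks : forall a J, (a + J <= M)%N ->
  exists z, \sum_(b < J) modc (xi (a + b)%N - z) <= lambda * J%:R.

Lemma itv_endpoints (I : interval R) : [set` I] `<=` `[0%R, 1%R] -> 0 < len I ->
  exists a b : R, [/\ 0 <= a, a < b, b <= 1, len I = b - a &
    forall t, [set` I] t -> a <= t <= b].
Proof.
move=> I01; rewrite /len lebesgue_measure_itv.
case: I I01 => -[b1 a|[]] [b2 b|[]] I01 /=; rewrite ?ltxx//=; case: ifP => //=; rewrite ?ltxx//.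
rewrite lte_fin => ab _.
have inI t : a < t < b -> [set` Interval (BSide b1 a) (BSide b2 b)] t.
  move=> /andP[t1 t2]; rewrite /= in_itv/=.
  by case: (b1); case: (b2); rewrite /= ?t1 ?t2 ?(ltW t1) ?(ltW t2).
exists a, b; split => //.
- rewrite leNgt; apply/negP => a0.
  have h : a < (a + Num.min 0 b) / 2 < b.
    by rewrite /Num.min; case: ifP => h0; apply/andP; split; lra.
  have := I01 _ (inI _ h); rewrite /= in_itv/= => /andP[+ _].
  by rewrite /Num.min; case: ifP => h0; lra.
- rewrite leNgt; apply/negP => b1'.
  have h : a < (b + Num.max 1 a) / 2 < b.
    by rewrite /Num.max; case: ifP => h0; apply/andP; split; lra.
  have := I01 _ (inI _ h); rewrite /= in_itv/= => /andP[_ +].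
  by rewrite /Num.max; case: ifP => h0; lra.
- move=> t; rewrite /= in_itv/= => /andP[t1 t2]; apply/andP; split.
    by move: t1; case: (b1) => // /ltW.
  by move: t2; case: (b2) => // /ltW.
Qed.

(** The interval meets a block of [J <= M |I| + 2] cells. If [M |I| >= 1] then [J <= 3 M |I|] and
    the sum over the block suffices. Otherwise [J <= 2], and the bound on the block sum bounds each
    of its terms by [2 * lambda]. *)
Lemma integral_step_le (I : interval R) : [set` I] `<=` `[0%R, 1%R] -> 0 < len I ->
  exists z, (\int[mu]_(t in [set` I]) (modc (step_fun xi n t - z))%:E <=
    (3 * lambda * len I)%:E)%E.
Proof.
move=> I01 I0; have M0 : 0 < M%:R :> R by rewrite ltr0n.
have [al [be [al0 ab be1 lenE hI]]] := itv_endpoints I01 I0.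
pose a := Num.truncn (al * M%:R); pose q := Num.truncn (be * M%:R).
(* The minimum with [M] matters when the right endpoint is [1], where [q = M] is not the index of a
   cell. *)
pose J := (minn M q.+1 - a)%N.
have alM : 0 <= al * M%:R by rewrite mulr_ge0// ltW.
have beM : 0 <= be * M%:R by rewrite mulr_ge0// ltW// (le_lt_trans al0).
have aq : (a <= q)%N by apply: le_truncn; rewrite ler_pM2r// ltW.
have aM : (a < M)%N.
  by rewrite truncn_lt_nat// gtr_pMl// (lt_le_trans ab).
have aJ : (a + J = minn M q.+1)%N by rewrite /J; lia.
have aJM : (a + J <= M)%N by rewrite aJ geq_minl.
have [z hz] := blocks aJM; exists z.
have Jle : J%:R <= M%:R * len I + 2.
  have /andP[h1 h2] := truncn_itv alM; have /andP[h3 h4] := truncn_itv beM.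
  rewrite -/a -/q in h1 h2 h3 h4.
  have : J%:R <= q%:R + 1 - a%:R :> R.
    by rewrite natr1 -natrB ?(leq_trans aq)// ler_nat; exact: leq_sub2r (geq_minr _ _).
  rewrite lenE mulrBr; move: h2; rewrite -(natr1 a); lra.
have hw t : [set` I] t -> ~ nodes n t ->
    (a <= Num.truncn (t * M%:R) < a + J)%N.
  move=> It tN; have /andP[t1 t2] := hI _ It.
  have t01 : 0 <= t <= 1 by rewrite (le_trans al0)//= (le_trans t2).
  have tM := truncn_lt t01 tN.
  rewrite aJ leq_min tM /a le_truncn ?ler_pM2r//= ltnS.
  by apply: le_truncn; rewrite ler_pM2r.
have mN : measurable (nodes n : set T).
  by apply: countable_measurable; [exact: measurable_set1|exact: countable_nodes].
have N0 : mu (nodes n) = 0%E by exact/countable_lebesgue_measure0/countable_nodes.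
have mI : measurable ([set` I] : set T) by exact: measurable_itv.
have mg : measurable_fun setT (fun t : T => modc (step_fun xi n t - z)).
  apply: measurable_modc.
    rewrite (_ : (fun t => _) = (fun t => rstep n (fun k => complex.Re (xi k)) t - complex.Re z)).
      by apply: measurable_funB => //; exact: measurable_rstep.
    by apply/funext => t; rewrite ReD ReN Re_step.
  rewrite (_ : (fun t => _) = (fun t => rstep n (fun k => complex.Im (xi k)) t - complex.Im z)).
    by apply: measurable_funB => //; exact: measurable_rstep.
  by apply/funext => t; rewrite ImD ImN Im_step.
have mgE (D : set T) : measurable_fun D (fun t : T => (modc (step_fun xi n t - z))%:E).
  by apply/measurable_EFinP; exact: measurable_funS mg.
rewrite (@ge0_negligible_integral _ _ _ mu _ (nodes n))//; last first.
  by move=> t _; rewrite lee_fin modc_ge0.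
have mD : measurable ([set` I] `\` nodes n : set T) by exact: measurableD.
have t01 t : [set` I] t -> 0 <= t <= 1.
  by move=> /hI /andP[t1 t2]; rewrite (le_trans al0)//= (le_trans t2).
have [h|h] := leP 1 (M%:R * len I).
  pose w k : R := if (a <= k < a + J)%N then modc (xi k - z) else 0.
  have w0 k : 0 <= w k by rewrite /w; case: ifP => // _; rewrite modc_ge0.
  apply: (@le_trans _ _ (\int[mu]_(t in [set` I] `\` nodes n) (rstep n w t)%:E)%E).
    rewrite le_eqVlt; apply/orP; left; apply/eqP; apply: eq_integral => t.
    rewrite inE => -[It tN]; rewrite step_funE ?rstepE ?t01//.
    by rewrite /w hw.
  rewrite (le_trans (integral_rstep_le n mD w0))// lee_fin ler_pdivrMl//.
  have -> : \sum_(k < M) w k = \sum_(b < J) modc (xi (a + b)%N - z).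
    rewrite -(big_mkord xpredT w) (@big_cat_nat _ _ _ a)//=; last exact: ltnW.
    rewrite big_nat_cond big1 ?add0r; last first.
      by move=> k; rewrite andbT /w => /andP[_ ka]; rewrite leqNgt ka.
    rewrite (@big_cat_nat _ _ _ (a + J)%N)//= ?leq_addr//.
    rewrite [X in _ + X]big_nat_cond [X in _ + X]big1 ?addr0; last first.
      by move=> k; rewrite andbT /w => /andP[ka _]; rewrite [(k < _)%N]ltnNge ka andbF.
    rewrite (eq_big_nat _ _ (F2 := fun k => modc (xi k - z))); last first.
      by move=> k hk; rewrite /w hk.
    rewrite -{1}[a]add0n big_addn addKn big_mkord.
    by apply: eq_bigr => b _; rewrite addnC.
  rewrite (le_trans hz)// (_ : M%:R * _ = lambda * (3 * (M%:R * len I))); last by ring.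
  by rewrite ler_wpM2l// (le_trans Jle)//; lra.
have J2 : (J <= 2)%N.
  by rewrite -ltnS -(ltr_nat R) (le_lt_trans Jle)// -[X in _ < X]natr1; lra.
apply: (@le_trans _ _ (\int[mu]_(t in [set` I] `\` nodes n) (2 * lambda)%:E)%E).
  apply: ge0_le_integral => //.
  - by move=> t _; rewrite lee_fin modc_ge0.
  move=> t [It tN]; rewrite step_funE ?t01// lee_fin.
  have /andP[k1 k2] := hw t It tN; set k := Num.truncn _ in k1 k2 *.
  have kJ : (k - a < J)%N by rewrite ltn_subLR.
  rewrite (le_trans (_ : _ <= \sum_(b < J) modc (xi (a + b)%N - z)))//.
    rewrite (bigD1 (Ordinal kJ))//= subnKC// lerDl.
    by apply: sumr_ge0 => b _; exact: modc_ge0.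
  by rewrite (le_trans hz)// mulrC ler_wpM2r// ler_nat.
rewrite integral_cst//.
apply: (@le_trans _ _ ((2 * lambda)%:E * mu [set` I])%E).
  rewrite lee_wpmul2l ?lee_fin ?mulr_ge0//.
  by apply: le_measure; rewrite ?inE//; move=> t [].
rewrite (_ : mu [set` I] = (len I)%:E).
  by rewrite -EFinM lee_fin; apply: ler_wpM2r; [exact: ltW|rewrite ler_wpM2r// ler_nat].
rewrite /len fineK// ge0_fin_numE// ltNge leye_eq; apply/eqP => h'.
by move: I0; rewrite /len h'/= ltxx.
Qed.

Lemma BMO_step : (BMO_norm (step_fun xi n) <= (9 * lambda + modc (avg xi M))%:E)%E.
Proof.
rewrite /BMO_norm cintegral_step EFinD leeD2r//.
apply: ge_ereal_sup => _ [I [I01 I0] <-].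
have [z hz] := integral_step_le I01 I0.
rewrite (_ : 9 * lambda = 3 * (3 * lambda)); last by ring.
have fI : (mu [set` I] < +oo)%E.
  by rewrite ltNge leye_eq; apply/eqP => h; move: I0; rewrite /len h/= ltxx.
have mI : measurable ([set` I] : set T) by exact: measurable_itv.
apply: oscillation_le hz => //.
- rewrite (_ : (EFin \o _) = (EFin \o rstep n (fun k => complex.Re (xi k)))).
    exact: integrable_rstep.
  by apply/funext => t /=; rewrite Re_step.
- rewrite (_ : (EFin \o _) = (EFin \o rstep n (fun k => complex.Im (xi k)))).
    exact: integrable_rstep.
  by apply/funext => t /=; rewrite Im_step.
Qed.

End BMOStep.

(** * Integrals and null sets without measurability *)

Section NullSets.
Local Open Scope ereal_scope.
Context d (T : measurableType d) (R : realType) (mu : {measure set T -> \bar R}).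
Variables (N : set T) (mN : measurable N) (N0 : mu N = 0).

Import HBNNSimple.

(* No measurability is required of the integrand: every simple function below
   it may be set to [0] on the null set. *)
Lemma ge0_integral_null (f : T -> \bar R) : (forall x, 0 <= f x) ->
  \int[mu]_x f x = \int[mu]_x (f \_ (~` N)) x.
Proof.
move=> f0.
have mNC : measurable (~` N) by exact: measurableC.
have r0 x : 0 <= (f \_ (~` N)) x by apply: erestrict_ge0.
apply/eqP; rewrite eq_le; apply/andP; split; rewrite !ge0_integralTE//; last first.
  apply: ereal_sup_le => _ [h /= hf <-]; exists h => //= x.
  rewrite (le_trans (hf x))// patchE; case: ifP => // _; exact: f0.
apply: ge_ereal_sup => _ [h /= hf <-].
apply: ereal_sup_ubound; exists (proj_nnsfun h mNC) => /=.
  move=> x; rewrite -[X in X%:E]/(proj_nnsfun h mNC x) -mrestrict !patchE.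
  by case: ifP => // _; exact: hf.
rewrite -!integralT_nnsfun.
under eq_integral do rewrite -mrestrict.
rewrite [RHS](ge0_negligible_integral mN measurableT)//; last 2 first.
- by apply/measurable_EFinP.
- by move=> x _; rewrite lee_fin.
rewrite setTD [RHS]integral_mkcond; apply: eq_integral => x _.
by rewrite !patchE; case: ifP.
Qed.

Lemma integral_null (f : T -> \bar R) : \int[mu]_x f x = \int[mu]_x (f \_ (~` N)) x.
Proof.
rewrite integralE [RHS]integralE funepos_restrict funeneg_restrict.
by congr (_ - _); exact: ge0_integral_null.
Qed.

Lemma integral_null_in (D : set T) (f g : T -> \bar R) :
  (forall x, ~ N x -> f x = g x) -> \int[mu]_(x in D) f x = \int[mu]_(x in D) g x.
Proof.
move=> fg; rewrite [LHS]integral_mkcond [RHS]integral_mkcond [LHS]integral_null [RHS]integral_null.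
apply: eq_integral => x _; rewrite !patchE; case: ifP => //; rewrite inE => Nx.
by case: ifP => // _; exact: fg.
Qed.

End NullSets.

(** * Borel representatives *)

Section BorelVersion.
Context d (T : measurableType d) (R : realType) (mu : {measure set T -> \bar R}).

Definition off {V : zmodType} (N : set T) (g : T -> V) : T -> V := g \_ (~` N).

(** For each rational [q] the set where [g > q] is Borel up to a null set, and countably many null
    sets are discarded. Off them the set where [g > x] is a countable union over rationals [q > x].
    Enlarging the discarded set is allowed, so that real and imaginary parts can be cut off on one
    common set. *)
Lemma borel_version (g : T -> R) :
  (forall Y : set R, measurable Y -> completed_algebra_gen mu (g @^-1` Y)) ->
  exists N : set T, [/\ measurable N, mu N = 0 &
    forall N', measurable N' -> N `<=` N' -> measurable_fun setT (off N' g)].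
Proof.
move=> mg.
have /choice[A hA] : forall q : rat, exists A : set T * set T,
    [/\ measurable A.1, measurable A.2, mu A.2 = 0 &
     forall p, ~ A.2 p -> (A.1 p <-> ratr q < g p)].
  move=> q; have mq : measurable (`]ratr q, +oo[%classic : set R) by exact: measurable_itv.
  have [B mB [Z [M [mM M0 ZM]]] E] := mg _ mq.
  exists (B, M); split => //= p Mp.
  have -> : (ratr q < g p) <-> (g @^-1` `]ratr q, +oo[%classic) p.
    by rewrite /= in_itv/= andbT.
  by rewrite -E; split; [left|case => // /ZM].
pose N := \bigcup_q (A (odflt 0%Q (unpickle q))).2.
have mN : measurable N by apply: bigcup_measurable => q _; case: (hA (odflt 0%Q (unpickle q))).
exists N; split => //.
  apply/eqP; rewrite -measure_le0.
  apply: le_trans (measure_sigma_subadditive _ _ mN (@subset_refl _ _)) _.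
    by move=> q; case: (hA (odflt 0%Q (unpickle q))).
  by rewrite eseries0// => q _ _; case: (hA (odflt 0%Q (unpickle q))).
move=> N' mN' NN'.
have hAq q p : ~ N' p -> ((A q).1 p <-> ratr q < g p).
  move=> Np; case: (hA q) => _ _ _; apply => Aq; apply: Np; apply: NN'.
  by exists (pickle q) => //; rewrite pickleK.
apply: (measurability (@RGenOInfty.G R)); first exact: RGenOInfty.measurableE.
move=> _ [_ [x ->] <-]; rewrite setTI.
(* The last term is there because the modified function is [0] on [N']. *)
have -> : off N' g @^-1` `]x, +oo[ =
    (\bigcup_q (if x < ratr (odflt 0%Q (unpickle q)) then (A (odflt 0%Q (unpickle q))).1 else set0) `\` N')
    `|` (if x < 0 then N' else set0).
  apply/seteqP; split => p; rewrite /= /off patchE in_itv/= andbT.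
    case: ifPn; rewrite ?inE ?notin_setE/=.
      move=> Np /rat_in_itvoo[q]; rewrite in_itv/= => /andP[q1 q2].
      left; split => //; exists (pickle q) => //.
      by rewrite pickleK/= q1; apply/hAq.
    by move=> /contrapT Np ->; right.
  case=> [[[q _]]|].
    case: ifP => // xq Aq Np; rewrite mem_set//.
    exact: lt_trans xq ((hAq _ _ Np).1 Aq).
  by case: ifP => // x0 Np; rewrite memNset//= => /(_ Np).
apply: measurableU; last by case: ifP.
apply: measurableD => //; apply: bigcup_measurable => q _; case: ifP => // _.
by case: (hA (odflt 0%Q (unpickle q))).
Qed.

End BorelVersion.

Section BorelRepresentative.
Context {R : realType}.
Local Notation plane := (plane R).
Local Open Scope complex_scope.

(** The partial sums depend on [f] only through its Fourier coefficients, so these and the [L log L]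
    integral are all that has to be preserved. *)
Lemma exists_borel (f : plane -> R[i]) : LlogL f -> exists g : plane -> R[i],
  [/\ measurable_fun setT (fun p => complex.Re (g p)),
      measurable_fun setT (fun p => complex.Im (g p)),
      fourier_coef f = fourier_coef g & LlogL_integral f = LlogL_integral g].
Proof.
case=> _ _ mRe mIm _.
have [N1 [mN1 N10 h1]] := borel_version mRe.
have [N2 [mN2 N20 h2]] := borel_version mIm.
pose N := N1 `|` N2.
have mN : measurable N by exact: measurableU.
have N0 : mu2 N = 0%E by exact/null_set_setU.
pose g := off N f.
have fg p : ~ N p -> f p = g p by move=> Np; rewrite /g /off patchE mem_set.
exists g; split.
- rewrite (_ : (fun p => _) = off N (fun p => complex.Re (f p))); first by apply: h1 => //; exact: subsetUl.
  by apply/funext => p; rewrite /g /off !patchE; case: ifP.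
- rewrite (_ : (fun p => _) = off N (fun p => complex.Im (f p))); first by apply: h2 => //; exact: subsetUr.
  by apply/funext => p; rewrite /g /off !patchE; case: ifP.
- apply/funext => m; apply/funext => k; rewrite /fourier_coef; congr (_ * _).
  rewrite /cintegral; congr (_ +i* _); rewrite /Rintegral; congr fine;
    by apply: (integral_null_in mN N0) => p /fg ->.
- by apply: (integral_null_in mN N0) => p /fg ->.
Qed.

End BorelRepresentative.

(** * Fejér and de la Vallée Poussin kernels on the torus *)

Section TorusKernel.
Context {R : realType}.
Local Notation C := R[i].
Local Open Scope complex_scope.
Implicit Types (x y : R) (K N : nat).

Definition fdir K x : C := \sum_(b < K) expi (b%:R * x).

Lemma fdir_sqr K x :
  (modc (fdir K x) ^+ 2)%:C = \sum_(b < K) \sum_(b' < K) expi ((b%:Z - b'%:Z)%:~R * x).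
Proof.
rewrite -mulcJ /fdir rmorph_sum big_distrl/=; apply: eq_bigr => b _.
rewrite big_distrr/=; apply: eq_bigr => b' _.
transitivity (expi (b%:R * x) * expi (- (b'%:R * x))); first by rewrite expiN.
by rewrite -expiD rmorphB/= mulrBl.
Qed.

(** The differences [b - b'] are below [L] in size, so only the diagonal survives summation over the
    grid, whatever its shift [x]. *)
Lemma sum_fdir_sqr l K x : (K <= l.+2)%N ->
  \sum_(t : 'I_l.+2) modc (fdir K (x + ang t)) ^+ 2 = (l.+2 * K)%:R.
Proof.
move=> KL; apply: (@complexI R); rewrite rmorph_sum rmorph_nat/=.
under eq_bigr do rewrite fdir_sqr.
rewrite exchange_big/=; under eq_bigr do rewrite exchange_big/=.
transitivity (\sum_(b < K) \sum_(b' < K) (l.+2%:R *+ (b == b')) : C).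
  apply: eq_bigr => b _; apply: eq_bigr => b' _.
  under eq_bigr do rewrite mulrDr expiD.
  rewrite -mulr_sumr [X in _ * X](@sum_chiE R l); last by have := ltn_ord b; have := ltn_ord b'; lia.
  rewrite subr_eq0 eqz_nat -val_eqE/=; case: eqVneq => [->|_]; last by rewrite mulr0.
  by rewrite subrr mul0r expi0 mul1r.
transitivity (\sum_(b < K) (l.+2%:R : C)).
  apply: eq_bigr => b _; rewrite (bigD1 b)//= eqxx big1 ?addr0// => b' hb.
  by rewrite eq_sym (negbTE hb).
by rewrite sumr_const card_ord natrM mulr_natr.
Qed.

Lemma modc_fdirN K x : modc (fdir K (- x)) = modc (fdir K x).
Proof.
rewrite -[RHS]modcJ /fdir rmorph_sum; congr modc; apply: eq_bigr => b _.
by rewrite mulrN expiN.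
Qed.

(** The de la Vallée Poussin kernel with its minus sign replaced by a plus: a positive majorant of
    mean [3]. *)
Definition kplus N x : R :=
  (modc (fdir N.*2 x) ^+ 2 + modc (fdir N x) ^+ 2) / N%:R.

Lemma kplus_ge0 N x : 0 <= kplus N x.
Proof. by rewrite divr_ge0// addr_ge0// exprn_ge0 ?modc_ge0. Qed.

Lemma kplusN N x : kplus N (- x) = kplus N x.
Proof. by rewrite /kplus !modc_fdirN. Qed.

Lemma sum_kplus l N x : (0 < N)%N -> (N.*2 <= l.+2)%N ->
  \sum_(t : 'I_l.+2) kplus N (x + ang t) = 3 * l.+2%:R.
Proof.
move=> N0 NL; rewrite /kplus -mulr_suml big_split/= !sum_fdir_sqr//; last first.
  by rewrite (leq_trans _ NL)// -addnn leq_addr.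
rewrite -natrD -mulnDr -addnn -addnA !natrM !natrD.
by field; rewrite pnatr_eq0 -lt0n.
Qed.

(** The de la Vallée Poussin kernel as a weighted sum over pairs, in which the frequency [s.1 - s.2]
    occurs with repetition. The weights of all pairs of difference [m] add up to the multiplier at
    [m], which is [1] for [|m| <= N]. *)
Definition vpw N (s : 'I_N.*2 * 'I_N.*2) : R :=
  (1 - ((s.1 < N)%N && (s.2 < N)%N)%:R) / N%:R.

Lemma vpw_sum N x :
  \sum_(s : 'I_N.*2 * 'I_N.*2) (vpw s)%:C * expi ((s.1%:Z - s.2%:Z)%:~R * x) =
  ((modc (fdir N.*2 x) ^+ 2 - modc (fdir N x) ^+ 2) / N%:R)%:C.
Proof.
rewrite rmorphM rmorphB/= !fdir_sqr.
have W (F : nat -> nat -> C) : \sum_(b < N) \sum_(b' < N) F b b' =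
    \sum_(b < N.*2) \sum_(b' < N.*2) ((b < N) && (b' < N))%N%:R * F b b'.
  have NN : (N <= N.*2)%N by rewrite -addnn leq_addr.
  rewrite (big_ord_widen _ (fun b => \sum_(b' < N) F b b') NN) big_mkcond.
  apply: eq_bigr => b _; case: ifP => bN; last by rewrite big1// => b' _; rewrite mul0r.
  rewrite (big_ord_widen _ (fun b' => F b b') NN) big_mkcond; apply: eq_bigr => b' _.
  by case: ifP => _; rewrite ?mul1r ?mul0r.
rewrite (W (fun b b' => expi ((b%:Z - b'%:Z)%:~R * x))) -sumrB big_distrl/=.
under [RHS]eq_bigr do rewrite -sumrB big_distrl/=.
rewrite pair_bigA/=; apply: eq_bigr => -[b b'] _ /=.
by rewrite /vpw/= rmorphM rmorphB/= rmorph1 rmorph_nat; ring.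
Qed.

Lemma vpw_count N (m : int) : (0 < N)%N -> (`|m| <= N)%N ->
  \sum_(s : 'I_N.*2 * 'I_N.*2) vpw s * (s.1%:Z - s.2%:Z == m)%:R = 1.
Proof.
move=> N0 mN.
have H K : (`|m| <= K)%N ->
    \sum_(b < K) \sum_(b' < K) ((b%:Z - b'%:Z == m)%:R : R) = (K - `|m|)%N%:R.
  move=> mK; have := @count_diff K (- m); rewrite abszN => /(_ mK) <-.
  rewrite natr_sum; apply: eq_bigr => b _; rewrite natr_sum; apply: eq_bigr => b' _.
  by rewrite subr_eq0.
have W (F : nat -> nat -> R) : \sum_(b < N) \sum_(b' < N) F b b' =
    \sum_(b < N.*2) \sum_(b' < N.*2) ((b < N) && (b' < N))%N%:R * F b b'.
  have NN : (N <= N.*2)%N by rewrite -addnn leq_addr.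
  rewrite (big_ord_widen _ (fun b => \sum_(b' < N) F b b') NN) big_mkcond.
  apply: eq_bigr => b _; case: ifP => bN; last by rewrite big1// => b' _; rewrite mul0r.
  rewrite (big_ord_widen _ (fun b' => F b b') NN) big_mkcond; apply: eq_bigr => b' _.
  by case: ifP => _; rewrite ?mul1r ?mul0r.
have h1 := H N mN.
have NN : (N <= N.*2)%N by rewrite -addnn leq_addr.
have h2 := H N.*2 (leq_trans mN NN).
rewrite (W (fun b b' => (b%:Z - b'%:Z == m)%:R)) in h1.
transitivity (((N.*2 - `|m|)%N%:R - (N - `|m|)%N%:R) / N%:R : R); last first.
  rewrite -natrB ?leq_sub2r// -?addnn ?leq_addr//.
  rewrite (_ : (_ - _)%N = N) ?divff ?pnatr_eq0 -?lt0n//; lia.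
rewrite -h1 -h2 -sumrB big_distrl/=.
under [RHS]eq_bigr do rewrite -sumrB big_distrl/=.
by rewrite pair_bigA/=; apply: eq_bigr => -[b b'] _ /=; rewrite /vpw/=; ring.
Qed.

End TorusKernel.

(** * Linearity of the complex integral *)

Section ComplexIntegral.
Context d (T : measurableType d) (R : realType).
Variables (nu : {measure set T -> \bar R}) (D : set T) (mD : measurable D).
Local Notation C := R[i].
Local Open Scope complex_scope.
Implicit Types (g h : T -> C) (z : C).

Definition cintegrable g :=
  nu.-integrable D (EFin \o (fun t => complex.Re (g t))) /\
  nu.-integrable D (EFin \o (fun t => complex.Im (g t))).

Let integrableZ (r : R) (u : T -> R) : nu.-integrable D (EFin \o u) ->
  nu.-integrable D (EFin \o (fun t => r * u t)).
Proof.
move=> iu; rewrite (_ : _ \o _ = (fun t => r%:E * (EFin \o u) t)%E).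
  exact: integrableZl.
by apply/funext => t /=; rewrite EFinM.
Qed.

Let integrableD' (u v : T -> R) : nu.-integrable D (EFin \o u) ->
  nu.-integrable D (EFin \o v) -> nu.-integrable D (EFin \o (fun t => u t + v t)).
Proof.
move=> iu iv; rewrite (_ : _ \o _ = (EFin \o u) \+ (EFin \o v))%E//.
exact: integrableD.
Qed.

Let integrableB' (u v : T -> R) : nu.-integrable D (EFin \o u) ->
  nu.-integrable D (EFin \o v) -> nu.-integrable D (EFin \o (fun t => u t - v t)).
Proof.
move=> iu iv; rewrite (_ : _ \o _ = (EFin \o u) \- (EFin \o v))%E//.
exact: integrableB.
Qed.

Lemma cintegrableZ z g : cintegrable g -> cintegrable (fun t => z * g t).
Proof.
move=> [iRe iIm]; split.
  rewrite (_ : (fun t => _) = (fun t => complex.Re z * complex.Re (g t) -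
     complex.Im z * complex.Im (g t))); first by apply: integrableB'; exact: integrableZ.
  by apply/funext => t; rewrite ReM.
rewrite (_ : (fun t => _) = (fun t => complex.Re z * complex.Im (g t) +
     complex.Im z * complex.Re (g t))); first by apply: integrableD'; exact: integrableZ.
by apply/funext => t; rewrite ImM.
Qed.

Lemma cintegrableD g h : cintegrable g -> cintegrable h -> cintegrable (fun t => g t + h t).
Proof.
move=> [iRe iIm] [jRe jIm]; split.
  rewrite (_ : (fun t => _) = (fun t => complex.Re (g t) + complex.Re (h t))).
    exact: integrableD'.
  by apply/funext => t; rewrite ReD.
rewrite (_ : (fun t => _) = (fun t => complex.Im (g t) + complex.Im (h t))).
  exact: integrableD'.
by apply/funext => t; rewrite ImD.
Qed.

Lemma cintegrable0 : cintegrable (fun=> 0).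
Proof. by split; apply: integrable0. Qed.

Lemma cintegrable_sum I (r : seq I) (F : I -> T -> C) :
  (forall i, cintegrable (F i)) -> cintegrable (fun t => \sum_(i <- r) F i t).
Proof.
move=> hF; elim: r => [|i r IH].
  by under eq_fun do rewrite big_nil; exact: cintegrable0.
by under eq_fun do rewrite big_cons; exact: cintegrableD.
Qed.

Lemma cintegralZ z g : cintegrable g ->
  cintegral nu D (fun t => z * g t) = z * cintegral nu D g.
Proof.
move=> [iRe iIm]; apply: complexP; rewrite /=.
  under eq_Rintegral do rewrite ReM.
  rewrite RintegralB//; [|exact: integrableZ|exact: integrableZ].
  by rewrite !RintegralZl// ReM.
under eq_Rintegral do rewrite ImM.
rewrite RintegralD//; [|exact: integrableZ|exact: integrableZ].
by rewrite !RintegralZl// ImM.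
Qed.

Lemma cintegralD g h : cintegrable g -> cintegrable h ->
  cintegral nu D (fun t => g t + h t) = cintegral nu D g + cintegral nu D h.
Proof.
move=> [iRe iIm] [jRe jIm]; apply: complexP; rewrite /=.
  by under eq_Rintegral do rewrite ReD; rewrite RintegralD.
by under eq_Rintegral do rewrite ImD; rewrite RintegralD.
Qed.

Lemma cintegral_sum I (r : seq I) (F : I -> T -> C) :
  (forall i, cintegrable (F i)) ->
  cintegral nu D (fun t => \sum_(i <- r) F i t) = \sum_(i <- r) cintegral nu D (F i).
Proof.
move=> hF; elim: r => [|i r IH].
  rewrite (_ : (fun t => _) = (fun t => 0 * (0 : C))).
    by rewrite (cintegralZ 0 cintegrable0) mul0r big_nil.
  by apply/funext => t; rewrite big_nil mul0r.
rewrite big_cons -IH -cintegralD//; last exact: cintegrable_sum.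
by congr cintegral; apply/funext => t; rewrite big_cons.
Qed.

End ComplexIntegral.

(** * The tangent inequality for [u log+ u] *)

Section Tangent.
Context {R : realType}.

(** The graph of [u ln u] lies above its tangent at [w]; integrating this gives Jensen's
    inequality. *)
Lemma logp_tangent (u w : R) : 0 <= u -> 1 < w -> (1 + ln w) * u <= u * logp u + w.
Proof.
move=> u0 w1; have w0 : 0 < w by exact: lt_trans w1.
have lnB (x : R) : 0 < x -> ln x <= x - 1.
  move=> x0; have := expR_ge1Dx (ln x); rewrite lnK ?posrE//; lra.
have lw := lnB _ w0.
have lw0 : 0 < ln w by exact: ln_gt0.
rewrite /logp; case: ifPn => [u1|]; last first.
  by rewrite -leNgt => u1; rewrite mulr0 add0r; nra.
have up : 0 < u by exact: lt_trans u1.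
have wu : 0 < w / u by exact: divr_gt0.
have := lnB _ wu; rewrite ln_div ?posrE// => h.
have : u * (ln w - ln u) <= u * (w / u - 1) by rewrite ler_wpM2l.
have -> : u * (w / u - 1) = w - u by field; rewrite gt_eqF.
lra.
Qed.

Lemma llogp_ge0 (u : R) : 0 <= u -> 0 <= u * logp u.
Proof. by move=> u0; rewrite mulr_ge0// /logp; case: ifP => // h; rewrite ln_ge0// ltW. Qed.

End Tangent.

(** * De la Vallée Poussin means of [f] and Jensen's inequality *)

Section TorusPolynomial.
Context {R : realType}.
Local Notation C := R[i].
Local Notation plane := (plane R).
Local Open Scope complex_scope.

Definition echar (m k : int) (p : plane) : C := expi (m%:~R * p.1 + k%:~R * p.2).

Lemma measurable_phase (m k : int) (s : R) :
  measurable_fun setT (fun p : plane => s * (m%:~R * p.1 + k%:~R * p.2)).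
Proof.
by apply: measurable_funM => //; apply: measurable_funD; apply: measurable_funM.
Qed.

Lemma measurable_cos_phase (m k : int) (s : R) :
  measurable_fun setT (fun p : plane => cos (s * (m%:~R * p.1 + k%:~R * p.2))).
Proof.
apply: (measurableT_comp _ (measurable_phase m k s)).
exact: continuous_measurable_fun (@continuous_cos R).
Qed.

Lemma measurable_sin_phase (m k : int) (s : R) :
  measurable_fun setT (fun p : plane => sin (s * (m%:~R * p.1 + k%:~R * p.2))).
Proof.
apply: (measurableT_comp _ (measurable_phase m k s)).
exact: continuous_measurable_fun (@continuous_sin R).
Qed.

Lemma measurable_torus2 : measurable (torus2 : set plane).
Proof. exact: measurableX. Qed.

Lemma mu2_torus2 : mu2 (torus2 : set plane) = (4 * pi ^+ 2)%:E.
Proof.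
have pi0 : 0 < pi :> R := pi_gt0 R.
rewrite /torus2 mu2_setX// !lebesgue_measure_itv/= lte_fin.
rewrite (_ : - pi < pi :> R); last by lra.
rewrite -EFinB -EFinM; congr EFin; ring.
Qed.

Lemma measurable_logp : measurable_fun setT (logp : R -> R).
Proof.
apply: measurable_fun_ifT => //; first exact: measurable_fun_ltr.
Qed.

Variable g : plane -> C.
Hypothesis mRe : measurable_fun setT (fun p => complex.Re (g p)).
Hypothesis mIm : measurable_fun setT (fun p => complex.Im (g p)).

Lemma measurable_llogl : measurable_fun setT (fun p => modc (g p) * logp (modc (g p))).
Proof.
have mg : measurable_fun setT (fun p => modc (g p)) by exact: measurable_modc.
apply: measurable_funM => //; exact: (measurableT_comp measurable_logp mg).
Qed.

Hypothesis finA : (LlogL_integral g < +oo)%E.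

Lemma integrable_modc : mu2.-integrable torus2 (EFin \o (fun p => modc (g p))).
Proof.
have mT := measurable_torus2.
have mg : measurable_fun setT (fun p => modc (g p)) by exact: measurable_modc.
have mgT : measurable_fun torus2 (fun p => modc (g p)) by exact: measurable_funS mg.
have ml := measurable_funS measurableT (@subsetT _ torus2) measurable_llogl.
apply/integrableP; split; first by apply/measurable_EFinP.
apply: (@le_lt_trans _ _ (\int[mu2]_(p in torus2)
   ((modc (g p) * logp (modc (g p)))%:E + 4%:E))%E).
  apply: ge0_le_integral => //.
  - by apply: measurableT_comp => //; apply/measurable_EFinP.
  - by apply: emeasurable_funD => //; apply/measurable_EFinP.
  - move=> p _ /=; rewrite ger0_norm ?modc_ge0// -EFinD lee_fin.
    exact: le_logp (modc_ge0 _).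
rewrite ge0_integralD//; last 2 first.
- by move=> p _; rewrite lee_fin llogp_ge0// modc_ge0.
- by apply/measurable_EFinP.
rewrite integral_cst// [X in (_ + _ * X)%E]mu2_torus2 lte_add_pinfty//.
by rewrite -EFinM ltry.
Qed.

Lemma cintegrable_mul (e : plane -> C) :
  measurable_fun setT (fun p => complex.Re (e p)) ->
  measurable_fun setT (fun p => complex.Im (e p)) ->
  (forall p, modc (e p) <= 1) -> cintegrable mu2 torus2 (fun p => g p * e p).
Proof.
move=> eRe eIm e1.
have mT := measurable_torus2.
have key (u : plane -> R) : measurable_fun setT u ->
    (forall p, `|u p| <= modc (g p * e p)) -> mu2.-integrable torus2 (EFin \o u).
  move=> mu hu; apply: (le_integrable mT _ _ integrable_modc).
    by apply/measurable_EFinP; exact: measurable_funS mu.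
  move=> p _ /=; rewrite lee_fin (le_trans (hu p))// modcM.
  by rewrite [leRHS]ger0_norm ?modc_ge0// ler_piMr ?modc_ge0.
split; apply: key.
- rewrite (_ : (fun p => _) = (fun p => complex.Re (g p) * complex.Re (e p) -
     complex.Im (g p) * complex.Im (e p))); first by apply: measurable_funB; exact: measurable_funM.
  by apply/funext => p; rewrite ReM.
- by move=> p; exact: Re_modc.
- rewrite (_ : (fun p => _) = (fun p => complex.Re (g p) * complex.Im (e p) +
     complex.Im (g p) * complex.Re (e p))); first by apply: measurable_funD; exact: measurable_funM.
  by apply/funext => p; rewrite ImM.
- by move=> p; exact: Im_modc.
Qed.

Lemma cintegrable_char m k :
  cintegrable mu2 torus2 (fun p => g p * expi (- (m%:~R * p.1 + k%:~R * p.2))).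
Proof.
apply: cintegrable_mul.
- rewrite (_ : (fun p => _) = (fun p => cos (-1 * (m%:~R * p.1 + k%:~R * p.2)))).
    exact: measurable_cos_phase.
  by apply/funext => p; rewrite mulN1r.
- rewrite (_ : (fun p => _) = (fun p => sin (-1 * (m%:~R * p.1 + k%:~R * p.2)))).
    exact: measurable_sin_phase.
  by apply/funext => p; rewrite mulN1r.
- by move=> p; rewrite modc_expi.
Qed.

Section Smoothing.
Variable N : nat.
Hypothesis N0 : (0 < N)%N.
Local Notation I := (('I_N.*2 * 'I_N.*2) * ('I_N.*2 * 'I_N.*2))%type.

Definition tm (i : I) : int := i.1.1%:Z - i.1.2%:Z.
Definition tk (i : I) : int := i.2.1%:Z - i.2.2%:Z.

(* De la Vallee Poussin means, divided by [18] so that the kernel bounding them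
   in [modc_tpoly] has total mass [1]: each of the two factors of the kernel has
   mean [3], and [modc_cintegral] loses a factor [2]. *)
Definition tcoef (i : I) : C :=
  (vpw i.1 * vpw i.2 / (2 * 9))%:C * fourier_coef g (tm i) (tk i).

Definition tpoly (p : plane) : C := \sum_i tcoef i * echar (tm i) (tk i) p.

Definition tker (p q : plane) : R :=
  kplus N (q.1 - p.1) * kplus N (q.2 - p.2) / (9 * (4 * pi ^+ 2)).

Lemma tker_ge0 p q : 0 <= tker p q.
Proof.
apply: divr_ge0; first by rewrite mulr_ge0 ?kplus_ge0.
by rewrite !mulr_ge0 ?exprn_ge0 ?pi_ge0.
Qed.

(** The signed kernel of [tpoly]. The leading [2] in the denominator pays for [modc_cintegral], the
    [9] for the two factors of mean [3]. *)
Definition vker (p q : plane) : R :=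
  (modc (fdir N.*2 (p.1 - q.1)) ^+ 2 - modc (fdir N (p.1 - q.1)) ^+ 2) / N%:R *
  ((modc (fdir N.*2 (p.2 - q.2)) ^+ 2 - modc (fdir N (p.2 - q.2)) ^+ 2) / N%:R) /
  (2 * (9 * (4 * pi ^+ 2))).

Let a (p : plane) (i : I) : C :=
  (vpw i.1 * vpw i.2 / (2 * 9) / (4 * pi ^+ 2))%:C * echar (tm i) (tk i) p.

Lemma vker_expand p q : (vker p q)%:C * g q =
  \sum_i a p i * (g q * expi (- ((tm i)%:~R * q.1 + (tk i)%:~R * q.2))).
Proof.
rewrite /vker rmorphM rmorphM/= -!vpw_sum big_distrl/= big_distrl/= big_distrl/=.
under eq_bigr do rewrite big_distrr/= big_distrl/= big_distrl/=.
rewrite pair_bigA/=; apply: eq_bigr => -[s t] _ /=.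
rewrite /a /tm /tk /=; set m := s.1%:Z - s.2%:Z; set k := t.1%:Z - t.2%:Z.
have E : echar m k p * expi (- (m%:~R * q.1 + k%:~R * q.2)) =
    expi (m%:~R * (p.1 - q.1)) * expi (k%:~R * (p.2 - q.2)).
  by rewrite /echar -!expiD; congr expi; ring.
rewrite [RHS]mulrCA -[_ * echar _ _ _ * _]mulrA E.
have -> : vpw s * vpw t / (2 * 9) / (4 * pi ^+ 2) =
    vpw s * vpw t * (2 * (9 * (4 * pi ^+ 2)))^-1 :> R.
  by rewrite -[LHS]mulrA -invfM -[2 * 9 * _]mulrA.
move: (2 * (9 * _))^-1 (vpw s) (vpw t) => u v w.
by rewrite !(rmorphM (real_complex R)); ring.
Qed.

Lemma cintegrable_vker p : cintegrable mu2 torus2 (fun q => (vker p q)%:C * g q).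
Proof.
rewrite (_ : (fun q => _) = (fun q => \sum_i a p i *
    (g q * expi (- ((tm i)%:~R * q.1 + (tk i)%:~R * q.2))))).
  apply: (cintegrable_sum measurable_torus2) => i.
  by apply: (cintegrableZ measurable_torus2); exact: cintegrable_char.
by apply/funext => q; rewrite vker_expand.
Qed.

Lemma tpolyE p : tpoly p = cintegral mu2 torus2 (fun q => (vker p q)%:C * g q).
Proof.
have mT := measurable_torus2.
transitivity (\sum_i cintegral mu2 torus2 (fun q => a p i *
    (g q * expi (- ((tm i)%:~R * q.1 + (tk i)%:~R * q.2))))).
  apply: eq_bigr => i _; rewrite (cintegralZ mT _ (cintegrable_char _ _)).
  rewrite /tcoef /fourier_coef /a; move: (_ / (2 * 9)) => w.
  by rewrite (rmorphM (real_complex R) w); ring.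
rewrite -(cintegral_sum mT); last by move=> i; apply: (cintegrableZ mT); exact: cintegrable_char.
by congr cintegral; apply/funext => q; rewrite vker_expand.
Qed.

Lemma vker_le p q : 2 * `|vker p q| <= tker p q.
Proof.
have V x : `|(modc (fdir N.*2 x) ^+ 2 - modc (fdir N x) ^+ 2) / N%:R| <= kplus N x.
  rewrite normrM normfV normr_nat ler_wpM2r ?invr_ge0//.
  by rewrite (le_trans (ler_normB _ _))// !ger0_norm ?exprn_ge0 ?modc_ge0.
rewrite /vker /tker -(kplusN _ (q.1 - _)) -(kplusN _ (q.2 - _)) !opprB.
set k := 9 * _; have k0 : 0 < k by rewrite !mulr_gt0 ?exprn_gt0 ?pi_gt0.
rewrite normrM normrM normfV (gtr0_norm (mulr_gt0 _ k0))//.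
rewrite invfM mulrCA [2 * _]mulrA divff ?pnatr_eq0// mul1r ler_wpM2r ?invr_ge0 ?(ltW k0)//.
by apply: ler_pM => //; exact: V.
Qed.

Lemma measurable_tker p : measurable_fun setT (tker p : plane -> R).
Proof.
have mf K : measurable_fun setT (fun x : R => modc (fdir K x) ^+ 2).
  have mfd : (fun x : R => complex.Re (fdir K x)) = fun x => \sum_(b < K) cos (b%:R * x).
    by apply/funext => x; rewrite /fdir Re_sum.
  have mfi : (fun x : R => complex.Im (fdir K x)) = fun x => \sum_(b < K) sin (b%:R * x).
    by apply/funext => x; rewrite /fdir Im_sum.
  apply: measurable_funX; apply: measurable_modc.
    rewrite mfd; apply: measurable_sum => b.
    apply: (measurableT_comp (continuous_measurable_fun (@continuous_cos R))).
    exact: measurable_funM.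
  rewrite mfi; apply: measurable_sum => b.
  apply: (measurableT_comp (continuous_measurable_fun (@continuous_sin R))).
  exact: measurable_funM.
have mk : measurable_fun setT (kplus N : R -> R).
  by apply: measurable_funM => //; exact: measurable_funD.
apply: measurable_funM => //; apply: measurable_funM.
  apply: (measurableT_comp mk); exact: measurable_funB.
apply: (measurableT_comp mk); exact: measurable_funB.
Qed.

Lemma modc_tpoly p :
  ((modc (tpoly p))%:E <= \int[mu2]_(q in torus2) (modc (g q) * tker p q)%:E)%E.
Proof.
have mT := measurable_torus2.
have [iRe iIm] := cintegrable_vker p.
have mg : measurable_fun setT (fun p => modc (g p)) by exact: measurable_modc.
rewrite tpolyE (le_trans (modc_cintegral mT iRe iIm))//.
have mm : measurable_fun torus2 (fun q => (modc ((vker p q)%:C * g q))%:E).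
  by apply/measurable_EFinP; apply: measurable_modc;
    [case/integrableP: iRe => /measurable_EFinP|case/integrableP: iIm => /measurable_EFinP].
rewrite -ge0_integralZl//; last by move=> q _; rewrite lee_fin modc_ge0.
apply: ge0_le_integral => //.
- by move=> q _; rewrite mule_ge0// lee_fin modc_ge0.
- exact: emeasurable_funM.
- apply/measurable_EFinP; apply: measurable_funM; first exact: measurable_funS mg.
  exact: measurable_funS (measurable_tker p).
move=> q _; rewrite -EFinM lee_fin modcM modcR mulrA mulrC ler_wpM2l ?modc_ge0//.
exact: vker_le.
Qed.

Lemma sum_tker l p q : (N.*2 <= l.+2)%N ->
  \sum_(j : 'I_l.+2 * 'I_l.+2) tker p (shift2 (node j) q) = (l.+2%:R) ^+ 2 / (4 * pi ^+ 2).
Proof.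
move=> NL; have pi0 : pi != 0 :> R by rewrite gt_eqF// pi_gt0.
transitivity ((\sum_(t : 'I_l.+2) kplus N (q.1 - p.1 + ang t)) *
   (\sum_(t : 'I_l.+2) kplus N (q.2 - p.2 + ang t)) / (9 * (4 * pi ^+ 2))); last first.
  by rewrite !sum_kplus//; move: pi l.+2%:R pi0 => P L P0; field.
rewrite big_distrl/= big_distrl/=; under [RHS]eq_bigr do rewrite big_distrr/= big_distrl/=.
rewrite pair_bigA; apply: eq_bigr => -[s t] _ /=.
by rewrite /tker /shift2 /node/=; congr (kplus _ _ * kplus _ _ / _); ring.
Qed.

Lemma tker_sym p q : tker p q = tker q p.
Proof. by rewrite /tker -(kplusN _ (q.1 - _)) -(kplusN _ (q.2 - _)) !opprB. Qed.

(** On a grid with [L = 2 N + 2] points per side the sum of the kernel is [L ^ 2 / (4 pi ^ 2)]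
    whatever the translation, and a cell has area [(2 pi / L) ^ 2]; no trigonometric integral has to
    be computed. *)
Lemma tker_mass p : (\int[mu2]_(q in torus2) (tker p q)%:E <= 1)%E.
Proof.
have mk := measurable_tker p.
have pi0 : pi != 0 :> R by rewrite gt_eqF// pi_gt0.
apply: (le_trans (@grid_integral R N.*2 (fun q => (tker p q)%:E) _ _)).
- by apply/measurable_EFinP.
- by move=> q; rewrite lee_fin tker_ge0.
rewrite (eq_integral (fun=> (N.*2.+2%:R ^+ 2 / (4 * pi ^+ 2))%:E)); last first.
  by move=> q _; rewrite sumEFin sum_tker// -[X in (X <= _)%N]addn0 -addn2 leq_add2l.
rewrite integral_cst; last exact: measurable_cell.
rewrite [X in (_ * X)%E]mu2_cell -EFinM lee_fin le_eqVlt; apply/orP; left; apply/eqP.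
have : N.*2.+2%:R != 0 :> R by rewrite pnatr_eq0.
by move: pi N.*2.+2%:R pi0 => P L P0 L0; field; rewrite L0.
Qed.

(** Jensen's inequality. The tangent is taken at [w], the modulus of [tpoly p], and integrated
    against [tker p]; its constant term costs at most [w], the mass of the kernel being at most
    [1]. *)
Lemma llogl_tpoly p :
  ((modc (tpoly p) * logp (modc (tpoly p)))%:E <=
   \int[mu2]_(q in torus2) (modc (g q) * logp (modc (g q)) * tker p q)%:E)%E.
Proof.
have mT := measurable_torus2.
have mg : measurable_fun setT (fun p => modc (g p)) by exact: measurable_modc.
have mk := measurable_tker p.
have ml := measurable_llogl.
have int0 : (0 <= \int[mu2]_(q in torus2) (modc (g q) * logp (modc (g q)) * tker p q)%:E)%E.
  by apply: integral_ge0 => q _; rewrite lee_fin mulr_ge0 ?tker_ge0 ?llogp_ge0 ?modc_ge0.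
have mgk : measurable_fun torus2 (fun q => (modc (g q) * tker p q)%:E).
  by apply/measurable_EFinP; apply: measurable_funS (measurable_funM mg mk).
have gk0 q : torus2 q -> (0 <= (modc (g q) * tker p q)%:E)%E.
  by move=> _; rewrite lee_fin mulr_ge0 ?modc_ge0 ?tker_ge0.
have mlk : measurable_fun torus2 (fun q => (modc (g q) * logp (modc (g q)) * tker p q)%:E).
  by apply/measurable_EFinP; apply: measurable_funS (measurable_funM ml mk).
have lk0 q : torus2 q -> (0 <= (modc (g q) * logp (modc (g q)) * tker p q)%:E)%E.
  by move=> _; rewrite lee_fin mulr_ge0 ?tker_ge0 ?llogp_ge0 ?modc_ge0.
have mkT : measurable_fun torus2 (fun q => (tker p q)%:E).
  by apply/measurable_EFinP; apply: measurable_funS mk.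
have k0 q : torus2 q -> (0 <= (tker p q)%:E)%E by move=> _; rewrite lee_fin tker_ge0.
set w := modc (tpoly p); rewrite {1}/logp; case: ifPn => [w1|_]; last by rewrite mulr0.
have w0 : 0 < w by exact: lt_trans w1.
have s0 : (0 <= (1 + ln w)%:E)%E by rewrite lee_fin addr_ge0// ln_ge0// ltW.
have w0' : (0 <= w%:E)%E by rewrite lee_fin ltW.
have mwk : measurable_fun torus2 (fun q => w%:E * (tker p q)%:E)%E by exact: emeasurable_funM.
have wk0 q : torus2 q -> (0 <= w%:E * (tker p q)%:E)%E by move=> /k0; exact: mule_ge0.
have h1 : (((1 + ln w) * w)%:E <=
    \int[mu2]_(q in torus2) ((modc (g q) * logp (modc (g q)) * tker p q)%:E +
      w%:E * (tker p q)%:E))%E.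
  rewrite EFinM (le_trans (lee_wpmul2l _ (modc_tpoly p)))//.
  rewrite -ge0_integralZl//.
  apply: ge0_le_integral => //.
  - by move=> q /gk0; exact: mule_ge0.
  - exact: emeasurable_funM.
  - exact: emeasurable_funD.
  move=> q _; rewrite -!EFinM -EFinD lee_fin mulrA -mulrDl ler_wpM2r ?tker_ge0//.
  exact: logp_tangent (modc_ge0 _) w1.
rewrite ge0_integralD// ge0_integralZl// in h1.
have h2 : (w%:E * \int[mu2]_(q in torus2) (tker p q)%:E <= w%:E)%E.
  by rewrite -[leRHS]mule1 lee_wpmul2l// tker_mass.
have := le_trans h1 (leeD (lexx _) h2).
by rewrite -leeBlDr// -EFinB mulrDl mul1r addrAC subrr add0r mulrC.
Qed.

Lemma llogl_grid l theta : (N.*2 <= l.+2)%N ->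
  \sum_(j : 'I_l.+2 * 'I_l.+2) (modc (tpoly (shift2 (node j) theta)) *
     logp (modc (tpoly (shift2 (node j) theta)))) <=
  l.+2%:R ^+ 2 / (4 * pi ^+ 2) * fine (LlogL_integral g).
Proof.
move=> NL; have mT := measurable_torus2; have ml := measurable_llogl.
have fA : LlogL_integral g \is a fin_num.
  rewrite ge0_fin_numE//; apply: integral_ge0 => q _.
  by rewrite lee_fin llogp_ge0 ?modc_ge0.
rewrite -lee_fin EFinM fineK// -sumEFin.
apply: (le_trans (lee_sum _ (fun j _ => llogl_tpoly (shift2 (node j) theta)))).
rewrite -ge0_integral_sum//; last 2 first.
- move=> j; apply/measurable_EFinP; apply: measurable_funS (measurable_funM ml (measurable_tker _)) => //.
- by move=> j q _; rewrite lee_fin mulr_ge0 ?tker_ge0 ?llogp_ge0 ?modc_ge0.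
have mlT : measurable_fun torus2 (fun q => (modc (g q) * logp (modc (g q)))%:E).
  by apply/measurable_EFinP; apply: measurable_funS ml.
have l0 q : torus2 q -> (0 <= (modc (g q) * logp (modc (g q)))%:E)%E.
  by move=> _; rewrite lee_fin llogp_ge0 ?modc_ge0.
have c0 : (0 <= (l.+2%:R ^+ 2 / (4 * pi ^+ 2) : R)%:E)%E.
  by rewrite lee_fin divr_ge0 ?exprn_ge0// mulr_ge0 ?exprn_ge0 ?pi_ge0.
rewrite /LlogL_integral -ge0_integralZl//.
rewrite le_eqVlt; apply/orP; left; apply/eqP; apply: eq_integral => q _.
rewrite sumEFin -EFinM -mulr_sumr mulrC; congr (_ * _)%:E.
by rewrite -(sum_tker q theta NL); apply: eq_bigr => j _; rewrite tker_sym.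
Qed.

End Smoothing.
End TorusPolynomial.

Lemma freq_tm_tk N (i : ('I_N.*2 * 'I_N.*2) * ('I_N.*2 * 'I_N.*2)) : (freq (@tm N) (@tk N) i <= N.*2)%N.
Proof.
case: i => -[a b] [c d]; rewrite /freq /tm /tk/= geq_max.
by have := ltn_ord a; have := ltn_ord b; have := ltn_ord c; have := ltn_ord d; lia.
Qed.

(** * Restriction of the smoothed function to translated grids *)

Section GridRestriction.
Context {R : realType}.
Local Notation C := R[i].
Local Open Scope complex_scope.
Variables (g : plane R -> C) (N : nat) (l : nat) (theta : plane R).
Hypothesis N0 : (0 < N)%N.
Local Notation I := (('I_N.*2 * 'I_N.*2) * ('I_N.*2 * 'I_N.*2))%type.
Local Notation X := ('I_l.+2 * 'I_l.+2)%type.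

Definition gcoef (i : I) : C := tcoef g i * echar (tm i) (tk i) theta.

Lemma echar_shift (m k : int) (j : X) :
  echar m k theta * (chi m j.1 * chi k j.2) = echar m k (shift2 (node j) theta).
Proof. by rewrite /echar /chi -!expiD /=; congr expi; ring. Qed.

Lemma pol_tpoly (j : X) :
  pol (@tm N) (@tk N) gcoef j = tpoly g N (shift2 (node j) theta).
Proof.
by apply: eq_bigr => i _; rewrite /gcoef -mulrA echar_shift.
Qed.

(** The multiplier of the means is [1] on frequencies up to [N], so partial sums of order at most
    [N] are unchanged but for the factor [1/18]. Repeated indices of the same frequency are
    collected by [vpw_count]. *)
Lemma ring_sum_quad n (j : X) : (n <= N)%N ->
  ring_sum (@tm N) (@tk N) gcoef n j =
  ((2 * 9)^-1)%:C * quad_sum g n (shift2 (node j) theta).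
Proof.
move=> nN; set P := shift2 (node j) theta.
pose F (m k : int) : C := fourier_coef g m k * echar m k P.
pose v (i : I) : R := vpw i.1 * vpw i.2 / (2 * 9).
pose idx (a : 'I_n.*2.+1) : int := a%:Z - n%:Z.
have sel (G : int -> C) (m : int) :
    \sum_(a < n.*2.+1) (m == idx a)%:R * G (idx a) = (`|m| <= n)%N%:R * G m.
  case: leqP => mn; last first.
    rewrite big1 ?mul0r// => a _; rewrite (_ : _ == _ = false) ?mul0r//.
    by apply/eqP; rewrite /idx; have := ltn_ord a; lia.
  have hm : (`|(m + n%:Z)%R| < n.*2.+1)%N by lia.
  have im : idx (Ordinal hm) = m by rewrite /idx/=; lia.
  rewrite (bigD1 (Ordinal hm))//= im eqxx !mul1r big1 ?addr0// => a ha.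
  rewrite (_ : _ == _ = false) ?mul0r//; apply: contraNF ha => /eqP mi.
  by rewrite -val_eqE/=; apply/eqP; move: mi; rewrite /idx; lia.
have step (i : I) : (freq (@tm N) (@tk N) i <= n)%N%:R * F (tm i) (tk i) =
    \sum_(a < n.*2.+1) \sum_(b < n.*2.+1) (tm i == idx a)%:R * ((tk i == idx b)%:R * F (idx a) (idx b)).
  under eq_bigr do rewrite -mulr_sumr sel.
  rewrite (sel (fun m => (`|tk i| <= n)%N%:R * F m (tk i))) mulrA -natrM mulnb.
  by rewrite /freq geq_max.
transitivity (\sum_i (v i)%:C * ((freq (@tm N) (@tk N) i <= n)%N%:R * F (tm i) (tk i))).
  rewrite /ring_sum big_mkcond; apply: eq_bigr => i _.
  case: ifP => _; last by rewrite mul0r mulr0.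
  by rewrite mul1r /gcoef -mulrA echar_shift /tcoef -mulrA.
under eq_bigr do rewrite step mulr_sumr.
rewrite exchange_big/= /quad_sum mulr_sumr; apply: eq_bigr => a _.
under eq_bigr do rewrite mulr_sumr.
rewrite exchange_big/= mulr_sumr; apply: eq_bigr => b _.
have ha : (`|idx a| <= N)%N by rewrite /idx; have := ltn_ord a; lia.
have hb : (`|idx b| <= N)%N by rewrite /idx; have := ltn_ord b; lia.
transitivity ((\sum_i (v i * ((tm i == idx a)%:R * (tk i == idx b)%:R)))%:C * F (idx a) (idx b)).
  rewrite rmorph_sum mulr_suml; apply: eq_bigr => i _.
  by rewrite !(rmorphM (real_complex R)) !(rmorph_nat (real_complex R)); ring.
rewrite -[RHS]/(((2 * 9)^-1)%:C * F (idx a) (idx b)); congr (_%:C * _).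
transitivity ((\sum_(s : 'I_N.*2 * 'I_N.*2) vpw s * (s.1%:Z - s.2%:Z == idx a)%:R) *
   (\sum_(s : 'I_N.*2 * 'I_N.*2) vpw s * (s.1%:Z - s.2%:Z == idx b)%:R) / (2 * 9) : R).
  rewrite big_distrl/= big_distrl/=; under [RHS]eq_bigr do rewrite big_distrr/= big_distrl/=.
  by rewrite pair_bigA; apply: eq_bigr => -[s t] _; rewrite /v /tm /tk/=; ring.
by rewrite !vpw_count// !mul1r.
Qed.

Lemma llogl_gcoef : llogl_sum l (@tm N) (@tk N) gcoef =
  \sum_(j : X) modc (tpoly g N (shift2 (node j) theta)) *
     logp (modc (tpoly g N (shift2 (node j) theta))).
Proof. by apply: eq_bigr => j _; rewrite pol_tpoly. Qed.

End GridRestriction.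

(** * The exceptional sets on the torus *)

Section BadSets.
Context {R : realType}.
Local Notation C := R[i].
Local Notation plane := (plane R).
Local Open Scope complex_scope.

Definition bavg (S : nat -> C) (a J : nat) : C := avg (fun b => S (a + b)%N) J.

(** Deviation is taken from the block average and not from the best constant, so that measurability
    is immediate; the price is a factor [2]. *)
Definition osc_set (S : nat -> plane -> C) (s : R) (a J : nat) : set plane :=
  [set p | s * J%:R < \sum_(b < J) modc (S (a + b)%N p - bavg (S^~ p) a J)].

Definition avg_set (S : nat -> plane -> C) (s : R) (n : nat) : set plane :=
  [set p | s < modc (avg (S^~ p) n.+1)].

Definition bad_set (S : nat -> plane -> C) (s t : R) (N : nat) : set plane :=
  \bigcup_(q in [set q : nat * nat | (q.1 + q.2 <= N)%N]) osc_set S s q.1 q.2 `|`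
  \bigcup_(n in [set n : nat | (n < N)%N]) avg_set S t n.

Lemma bad_set_homo S s t : {homo bad_set S s t : n m / (n <= m)%N >-> (n <= m)%O}.
Proof.
move=> n m nm; apply/subsetPset => p [[q qn hq]|[k kn hk]]; [left|right].
  by exists q => //=; exact: leq_trans qn nm.
by exists k => //=; exact: leq_trans kn nm.
Qed.

Lemma BMO_seq_le (S : nat -> plane -> C) (s t : R) (p : plane) : 0 <= s ->
  (forall N, ~ bad_set S s t N p) -> (BMO_seq (S^~ p) <= (9 * s + t)%:E)%E.
Proof.
move=> s0 hp; apply: ge_ereal_sup => _ [n _ <-].
have blocks a J : (a + J <= n.+1)%N ->
    exists z, \sum_(b < J) modc (S (a + b)%N p - z) <= s * J%:R.
  move=> aJ; exists (bavg (S^~ p) a J); rewrite leNgt; apply/negP => h.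
  by apply: (hp n.+1); left; exists (a, J).
apply: (le_trans (BMO_step s0 blocks)); rewrite lee_fin lerD2l leNgt.
by apply/negP => h; apply: (hp n.+1); right; exists n => //=; exact: ltnSn.
Qed.

Definition cmeasurable (u : plane -> C) :=
  measurable_fun setT (fun p => complex.Re (u p)) /\
  measurable_fun setT (fun p => complex.Im (u p)).

Lemma cmeasurableM u v : cmeasurable u -> cmeasurable v ->
  cmeasurable (fun p => u p * v p).
Proof.
move=> [u1 u2] [v1 v2]; split.
  rewrite (_ : (fun p => _) = (fun p => complex.Re (u p) * complex.Re (v p) -
    complex.Im (u p) * complex.Im (v p))); first by apply: measurable_funB; exact: measurable_funM.
  by apply/funext => p; rewrite ReM.
rewrite (_ : (fun p => _) = (fun p => complex.Re (u p) * complex.Im (v p) +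
    complex.Im (u p) * complex.Re (v p))); first by apply: measurable_funD; exact: measurable_funM.
by apply/funext => p; rewrite ImM.
Qed.

Lemma cmeasurable_cst (z : C) : cmeasurable (fun=> z).
Proof. by split. Qed.

Lemma cmeasurable_sum I (r : seq I) (F : I -> plane -> C) :
  (forall i, cmeasurable (F i)) -> cmeasurable (fun p => \sum_(i <- r) F i p).
Proof.
move=> hF; split.
  rewrite (_ : (fun p => _) = (fun p => \sum_(i <- r) complex.Re (F i p))).
    by apply: measurable_sum => i; case: (hF i).
  by apply/funext => p; rewrite Re_sum.
rewrite (_ : (fun p => _) = (fun p => \sum_(i <- r) complex.Im (F i p))).
  by apply: measurable_sum => i; case: (hF i).
by apply/funext => p; rewrite Im_sum.
Qed.

Lemma cmeasurableB u v : cmeasurable u -> cmeasurable v ->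
  cmeasurable (fun p => u p - v p).
Proof.
move=> [u1 u2] [v1 v2]; split.
  rewrite (_ : (fun p => _) = (fun p => complex.Re (u p) - complex.Re (v p))).
    exact: measurable_funB.
  by apply/funext => p; rewrite ReD ReN.
rewrite (_ : (fun p => _) = (fun p => complex.Im (u p) - complex.Im (v p))).
  exact: measurable_funB.
by apply/funext => p; rewrite ImD ImN.
Qed.

Lemma cmeasurable_echar m k : cmeasurable (@echar R m k).
Proof.
split.
  rewrite (_ : (fun p => _) = (fun p => cos (1 * (m%:~R * p.1 + k%:~R * p.2)))).
    exact: measurable_cos_phase.
  by apply/funext => p; rewrite mul1r.
rewrite (_ : (fun p => _) = (fun p => sin (1 * (m%:~R * p.1 + k%:~R * p.2)))).
  exact: measurable_sin_phase.
by apply/funext => p; rewrite mul1r.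
Qed.

Lemma cmeasurable_quad_sum g n : cmeasurable (quad_sum g n).
Proof.
apply: cmeasurable_sum => i; apply: cmeasurable_sum => j.
apply: cmeasurableM; [exact: cmeasurable_cst|exact: cmeasurable_echar].
Qed.

Lemma cmeasurable_avg (S : nat -> plane -> C) J :
  (forall n, cmeasurable (S n)) -> cmeasurable (fun p => avg (S^~ p) J).
Proof.
move=> hS; apply: cmeasurableM; first exact: cmeasurable_cst.
by apply: cmeasurable_sum.
Qed.

Lemma measurable_gt (u : plane -> R) (c : R) : measurable_fun setT u ->
  measurable [set p | c < u p].
Proof.
move=> mu; rewrite (_ : [set p | _] = setT `&` u @^-1` `]c, +oo[).
  by apply: mu => //; exact: measurable_itv.
by rewrite setTI; apply/seteqP; split => p; rewrite /= in_itv/= andbT.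
Qed.

Lemma measurable_bad_set S s t N : (forall n, cmeasurable (S n)) ->
  measurable (bad_set S s t N).
Proof.
move=> hS; apply: measurableU.
  rewrite bigcup_mkcond; apply: countable_bigcupT_measurable => [|q]; first exact: countableP.
  case: ifP => // _; apply: measurable_gt; apply: measurable_sum => b.
  have [h1 h2] : cmeasurable (fun p => S (q.1 + b)%N p - bavg (S^~ p) q.1 q.2).
    by apply: cmeasurableB => //; exact: (@cmeasurable_avg (fun b => S (q.1 + b)%N)).
  exact: measurable_modc h1 h2.
apply: bigcup_measurable => n _; apply: measurable_gt.
have [h1 h2] := cmeasurable_avg n.+1 hS.
exact: measurable_modc h1 h2.
Qed.

End BadSets.

(** * Measure of the exceptional sets *)

Section BadSetMeasure.
Context {R : realType}.
Local Notation C := R[i].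
Local Open Scope complex_scope.
Variable g : plane R -> C.
Hypothesis mRe : measurable_fun setT (fun p => complex.Re (g p)).
Hypothesis mIm : measurable_fun setT (fun p => complex.Im (g p)).
Hypothesis finA : (LlogL_integral g < +oo)%E.

(** In the thresholds [18] undoes the normalization of the smoothed polynomial and [2] replaces a
    constant by the block average. The bound does not depend on [N], so that [N] can tend to
    infinity. *)
Lemma measure_bad_set (s : R) (N : nat) : 0 < s ->
  (mu2 (bad_set (quad_sum g) (2 * (18 * (2200 * s))) (18 * (100 * (1000 * s))) N
        `&` torus2) <=
   (30 * 1000 * (fine (LlogL_integral g) + 4 * pi ^+ 2) / s)%:E)%E.
Proof.
move=> s0; set E := bad_set _ _ _ _; set A := fine _.
(* Smoothing at order [N.+1] keeps the order positive when [N = 0]; the resulting frequencies are at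
   most [D]. *)
pose K := N.+1; pose D := K.*2.
have [l [hL hK]] : exists l, (2 ^ D.*2 * N + 32 * D ^ 2 < l.+2)%N /\ (K.*2 <= l.+2)%N.
  have DD : (D <= D ^ 2)%N by rewrite -[X in (X <= _)%N]expn1 leq_pexp2l.
  exists (2 ^ D.*2 * N + 32 * D ^ 2)%N; split; first by rewrite ltnW.
  rewrite -/D (leq_trans DD)// ltnW// ltnW// !ltnS.
  by rewrite (leq_trans (leq_pmull (D ^ 2) (isT : (0 < 32)%N)))// leq_addl.
pose M := 30 * 1000 * (l.+2%:R ^+ 2 / (4 * pi ^+ 2) * A + l.+2%:R ^+ 2) / s.
have A0 : 0 <= A.
  by apply: fine_ge0; apply: integral_ge0 => q _; rewrite lee_fin llogp_ge0 ?modc_ge0.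
have M0 : 0 <= M.
  apply: divr_ge0; last exact: ltW.
  apply: (mulr_ge0 (mulr_ge0 (ler0n R 30) (ler0n R 1000))).
  apply: addr_ge0; last exact: exprn_ge0.
  apply: mulr_ge0 => //; apply: divr_ge0; first exact: exprn_ge0.
  by apply: mulr_ge0 => //; rewrite exprn_ge0 ?pi_ge0.
have mE : measurable E by apply: measurable_bad_set => n; exact: cmeasurable_quad_sum.
have -> : 30 * 1000 * (A + 4 * pi ^+ 2) / s = (pi *+ 2 / l.+2%:R) ^+ 2 * M.
  rewrite /M; have : l.+2%:R != 0 :> R by rewrite pnatr_eq0.
  have : pi != 0 :> R by rewrite gt_eqF// pi_gt0.
  have : s != 0 by rewrite gt_eqF.
  move: pi l.+2%:R (30 * 1000) => P Lr cst s1 P0 L1; field.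
  by rewrite s1 P0 L1.
apply: (measure_grid mE M0) => theta.
have [B [hB H]] := @grid_weak_type R l _ (@tm K) (@tk K) (gcoef g theta) D
  (@freq_tm_tk K) N s isT hL s0.
rewrite /M ler_pdivlMr// mulrC (le_trans _ (le_trans hB _))//; last first.
  apply: (ler_wpM2l (mulr_ge0 (ler0n R 30) (ler0n R 1000))).
  by rewrite llogl_gcoef natrX lerD2r; exact: llogl_grid.
rewrite ler_wpM2l ?(ltW s0)// ler_nat; apply: subset_leq_card; apply/fintype.subsetP => j.
rewrite inE; apply: contraLR => jB; have [osc av] := H j jB.
rewrite notin_setE; set P := shift2 _ _ in osc av *.
have c18 : (18%:R)%:C = 18 :> C by rewrite rmorph_nat.
have SE n : (n <= N)%N -> quad_sum g n P = 18 * ring_sum (@tm K) (@tk K) (gcoef g theta) n j.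
  move=> nN; rewrite (@ring_sum_quad R g K l theta isT n j (leqW nN)) -/P mulrA.
  rewrite (_ : 18 * ((2 * 9)^-1)%:C = 1) ?mul1r//.
  rewrite -c18 -(rmorphM (real_complex R)) (_ : _ * _ = 1)//.
  by rewrite -natrM divff// pnatr_eq0.
case=> [[[a J] /= aJ]|[n /= nN]].
  rewrite /osc_set /=; apply/negP; rewrite -leNgt.
  have [->|J0] := posnP J; first by rewrite big_ord0 mulr0.
  have [z hz] := osc a J aJ.
  have hz' : \sum_(b < J) modc (quad_sum g (a + b)%N P - 18 * z) <= 18 * (2200 * s) * J%:R.
    rewrite -mulrA (le_trans _ (ler_wpM2l _ hz))// mulr_sumr; apply: ler_sum => b _.
    rewrite SE; last by rewrite (leq_trans _ aJ)// leq_add2l ltnW.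
    by rewrite -mulrBr modcM modc_nat.
  have hav := @avg_dist R (fun b => quad_sum g (a + b)%N P) _ J _ J0 hz'.
  apply: (@le_trans _ _ (\sum_(b < J) (modc (quad_sum g (a + b)%N P - 18 * z) + 18 * (2200 * s)))).
    apply: ler_sum => b _; rewrite (le_trans (modc_triangle (18 * z) _ _))// lerD2l.
    by rewrite modcBC.
  rewrite big_split/= sumr_const card_ord -[_ *+ J]mulr_natr.
  move: hz'; set x := 18 * (2200 * s) => hz2.
  have -> : 2 * x * J%:R = x * J%:R + x * J%:R by ring.
  by rewrite lerD2r.
rewrite /avg_set /=; apply/negP; rewrite -leNgt.
have -> : avg ((quad_sum g)^~ P) n.+1 =
    18 * avg (fun k => ring_sum (@tm K) (@tk K) (gcoef g theta) k j) n.+1.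
  rewrite /avg mulrCA; congr (_ * _); rewrite mulr_sumr; apply: eq_bigr => k _.
  by rewrite SE// (leq_trans _ nN)// ltnW.
by rewrite modcM modc_nat ler_wpM2l// av.
Qed.

End BadSetMeasure.

(** * Outer monotonicity and conclusion *)

Section OuterMonotone.
Context {R : realType}.

(** The integral is a supremum over simple functions below the integrand. This lets the set in the
    theorem be bounded without showing that it is measurable. *)
Lemma le_integral_nonmeasurable d (T : measurableType d) (mu : {measure set T -> \bar R})
    (f h : T -> \bar R) : (forall x, (0 <= f x)%E) -> (forall x, (f x <= h x)%E) ->
  (\int[mu]_x f x <= \int[mu]_x h x)%E.
Proof.
move=> f0 fh; rewrite !ge0_integralTE//; last by move=> x; exact: le_trans (fh x).
apply: ereal_sup_le => _ [u /= hu <-]; exists u => //= x.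
exact: le_trans (hu x) (fh x).
Qed.

(* Both factors of [mu2] are outer measures defined on all sets. *)
Lemma le_mu2 : {homo (@mu2 R) : A B / A `<=` B >-> (A <= B)%E}.
Proof.
move=> A B AB; apply: le_integral_nonmeasurable => x /=; first exact: mu_ext_ge0.
by apply: le_mu_ext => y; rewrite /xsection /= !inE; exact: AB.
Qed.

End OuterMonotone.

Theorem theorem1 (R : realType) :
  exists2 c : R, 0 < c &
    forall (f : plane R -> R[i]) (lambda : R), LlogL f -> 0 < lambda ->
      (mu2 [set p : plane R | torus2 p /\
              lambda%:E < BMO_seq (fun n => quad_sum f n p)]
       <= (c / lambda)%:E * (1 + LlogL_integral f))%E.
Proof.
(* Chosen so that, for [s = lambda / W], the bound [9 * k1 + k2] of [BMO_seq_le] is exactly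
   [lambda]. *)
pose W : R := 9 * (2 * (18 * 2200)) + 18 * (100 * 1000).
have W0 : 0 < W.
  by apply: addr_gt0; repeat apply: mulr_gt0; rewrite ltr0n.
have cst0 : 0 < 30 * 1000 :> R by apply: mulr_gt0; rewrite ltr0n.
have P0 : 0 <= 4 * pi ^+ 2 :> R by rewrite mulr_ge0// exprn_ge0// pi_ge0.
exists (30 * 1000 * W * (1 + 4 * pi ^+ 2)).
  by apply: mulr_gt0; [exact: mulr_gt0|rewrite ltr_wpDr].
move=> f lambda Lf la0.
have [g [mRe mIm fg Ag]] := exists_borel Lf.
have finA : (LlogL_integral g < +oo)%E by case: Lf => _ _ _ _; rewrite Ag.
have qf n : quad_sum f n = quad_sum g n by apply/funext => p; rewrite /quad_sum fg.
pose s := lambda / W; have s0 : 0 < s by exact: divr_gt0.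
pose k1 := 2 * (18 * (2200 * s)); pose k2 := 18 * (100 * (1000 * s)).
have k12 : 9 * k1 + k2 = lambda.
  by rewrite -[RHS](divfK (lt0r_neq0 W0)) -/s /k1 /k2 [RHS]mulrC [RHS]mulrDl !mulrA.
have k10 : 0 <= k1.
  exact: (mulr_ge0 (ler0n R 2) (mulr_ge0 (ler0n R 18) (mulr_ge0 (ler0n R 2200) (ltW s0)))).
pose F N := bad_set (quad_sum g) k1 k2 N `&` torus2.
have mF N : measurable (F N).
  apply: measurableI; last exact: measurable_torus2.
  by apply: measurable_bad_set => n; exact: cmeasurable_quad_sum.
have mU : measurable (\bigcup_N F N) by exact: bigcupT_measurable.
set A := LlogL_integral g in finA.
have A0 : (0 <= A)%E.
  by apply: integral_ge0 => q _; rewrite lee_fin llogp_ge0 ?modc_ge0.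
have AE : A = (fine A)%:E by rewrite fineK// ge0_fin_numE.
have fA0 : 0 <= fine A by exact: fine_ge0.
rewrite Ag -/A AE -EFinD -EFinM.
(* The exceptional sets increase with [N] and their union contains the set in question; continuity
   from below then transfers the uniform bound. *)
apply: (@le_trans _ _ (mu2 (\bigcup_N F N))).
  apply: le_mu2 => p [Tp hp].
  apply: contrapT => notF.
  have nb N : ~ bad_set (quad_sum g) k1 k2 N p by move=> h; apply: notF; exists N.
  have := BMO_seq_le k10 nb; rewrite k12 leNgt => /negP; apply.
  rewrite (_ : (fun n => quad_sum g n p) = (fun n => quad_sum f n p))//.
  by apply/funext => n; rewrite qf.
have cv : (mu2 \o F) x @[x --> \oo] --> mu2 (\bigcup_N F N).
  apply: nondecreasing_cvg_mu => // n m nm; apply/subsetPset => p [hp Tp]; split => //.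
  by have /subsetPset := bad_set_homo (quad_sum g) k1 k2 nm; exact.
rewrite -(cvg_lim _ cv)//; apply: lime_le; first by apply/cvg_ex; exists (mu2 (\bigcup_N F N)).
apply: nearW => N /=; apply: (le_trans (measure_bad_set mRe mIm finA N s0)).
rewrite lee_fin -/A /s.
move: (30 * 1000) cst0 (W) W0 (fine A) fA0 (4 * pi ^+ 2) P0 => c c0 V V0 a a0 q q0.
have -> : c * (a + q) / (lambda / V) = c * V / lambda * (a + q).
  by rewrite invf_div; ring.
have -> : c * V * (1 + q) / lambda * (1 + a) = c * V / lambda * ((1 + q) * (1 + a)) by ring.
apply: ler_wpM2l; first by rewrite divr_ge0 ?(ltW la0)// mulr_ge0 ?ltW.
by have := mulr_ge0 q0 a0; lra.
Qed.
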